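(* Let $m,n\ge 1$ and let $\mathbb{B}$ be the open unit ball of $(\mathcal{Q}_m)^n_s$. Let $f\in\mathcal{SR}(\mathbb{B},(\mathbb{R}_m)^n)$ be a slice regular mapping such that, for some $I\in\mathbb{S}_m$, one has $f(\mathbb{B}_I)\subseteq\mathbb{C}_I^n$ and the restriction $f_I:=f|_{\mathbb{B}_I}:\mathbb{B}_I\to\mathbb{C}_I^n$ is a convex mapping. If $f(0)=0$ and $f'(0)=\mathbb{I}_n$ (the identity matrix of order $n$), then $$\frac{\|x\|}{1+\|x\|}\le\|f(x)\|\le\frac{\|x\|}{1-\|x\|},\qquad \forall\,x\in\mathbb{B}.$$ These estimates are sharp, i.e. for each of the two inequalities and each $r\in(0,1)$ equality is attained for some data satisfying the hypotheses and some $x\in\mathbb{B}$ with $\|x\|=r$.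
   Context: $\mathbb{R}_m$ is the real Clifford algebra generated by $e_1,\dots,e_m$ with $e_\imath e_\jmath+e_\jmath e_\imath=-2\delta_{\imath\jmath}$; every $x\in\mathbb{R}_m$ is uniquely $x=\sum_A x_Ae_A$ with $x_A\in\mathbb{R}$, $A$ ranging over subsets $\{h_1<\dots<h_r\}$ of $\{1,\dots,m\}$, $e_A=e_{h_1}\cdots e_{h_r}$, $e_\varnothing=1$. $|x|=(\sum_A x_A^2)^{1/2}$ and, for $x=(x_1,\dots,x_n)\in(\mathbb{R}_m)^n$, $\|x\|=(\sum_t|x_t|^2)^{1/2}$. $x^c$ is Clifford conjugation (the anti-involution with $e_\imath^c=-e_\imath$), $t(x)=x+x^c$, $n(x)=xx^c$. The quadratic cone is $\mathcal{Q}_m=\mathbb{R}\cup\{x\in\mathbb{R}_m: t(x)\in\mathbb{R},\,n(x)\in\mathbb{R},\,4n(x)>t(x)^2\}$, and $\mathbb{S}_m=\{J\in\mathcal{Q}_m:J^2=-1\}=\{x\in\mathbb{R}_m: t(x)=0,\ n(x)=1\}$. Elements of $\mathbb{R}_m$ act on $(\mathbb{R}_m)^n$ by componentwise left multiplication. For $I\in\mathbb{S}_m$, $\mathbb{C}_I^n=\mathbb{R}^n+I\mathbb{R}^n$ (identified with $\mathbb{C}^n$ via $i\leftrightarrow I$), and $(\mathcal{Q}_m)^n_s=\bigcup_{I\in\mathbb{S}_m}\mathbb{C}_I^n$. The unit ball is $\mathbb{B}=\{x\in(\mathcal{Q}_m)^n_s:\|x\|<1\}$ and $\mathbb{B}_I=\mathbb{B}\cap\mathbb{C}_I^n$.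 Let $D$ be the open unit ball of $\mathbb{C}^n$ and $(\mathbb{R}_m)^n_{\mathbb{C}}=(\mathbb{R}_m)^n+i(\mathbb{R}_m)^n$ the complexification. A stem mapping is $F=F_1+iF_2:D\to(\mathbb{R}_m)^n_{\mathbb{C}}$ ($F_1,F_2$ with values in $(\mathbb{R}_m)^n$) with $F_1(\bar z)=F_1(z)$, $F_2(\bar z)=-F_2(z)$. It induces the slice mapping $f=\mathcal{I}(F):\mathbb{B}\to(\mathbb{R}_m)^n$, $f(\alpha+J\beta)=F_1(\alpha+i\beta)+JF_2(\alpha+i\beta)$ for $\alpha,\beta\in\mathbb{R}^n$, $\alpha+i\beta\in D$, $J\in\mathbb{S}_m$. $f$ is slice regular if $F$ is $C^1$ and holomorphic, i.e. $\frac{\partial F}{\partial\bar z_t}=\frac12\big(\frac{\partial F}{\partial\alpha_t}+i\frac{\partial F}{\partial\beta_t}\big)=0$ for $t=1,\dots,n$; $\mathcal{SR}(\mathbb{B},(\mathbb{R}_m)^n)$ is the set of slice regular mappings. The derivative $f'=\frac{\partial f}{\partial x}$ is the $n\times n$ matrix whose $(s,t)$ entry is the slice function induced by $\frac{\partial F^s}{\partial z_t}=\frac12\big(\frac{\partial F^s}{\partial\alpha_t}-i\frac{\partial F^s}{\partial\beta_t}\big)$, where $F=(F^1,\dots,F^n)$. A convex mapping is, as usual in several complex variables, a holomorphic mapping that is biholomorphic onto its image and whose image is convex. *)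

(* Defs.v *)
From HB Require Import structures.
From mathcomp Require Import all_boot all_order all_algebra ring complex.
From mathcomp Require Import all_classical all_reals all_analysis.
Set Implicit Arguments.
Unset Strict Implicit.
Unset Printing Implicit Defensive.

Import Order.TTheory GRing.Theory Num.Theory numFieldNormedType.Exports.

Local Open Scope classical_set_scope.
Local Open Scope ring_scope.

(* x is encoded by its coordinates (x_A)_A in the basis (e_A)_A, with A a      *)
(* subset of 'I_m; generators are numbered from 0.                             *)
Definition clifford (R : realType) (m : nat) := {ffun {set 'I_m} -> R}.

Section CliffordAlgebra.
Variables (R : realType) (m : nat).
Implicit Types (A B C : {set 'I_m}) (x y z : clifford R m).

HB.instance Definition _ :=
  GRing.Lmodule.copy (clifford R m) {ffun {set 'I_m} -> R^o}.

Definition symdiff A B : {set 'I_m} := (A :\: B) :|: (B :\: A).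

(* e_A e_B = clsign A B *: e_(symdiff A B): sorting e_A e_B swaps each pair     *)
(* (a, b) in A x B with b < a, and each b = a then contributes e_a ^ 2 = -1.    *)
Definition clsign A B : R :=
  (-1) ^+ (\sum_(a in A) \sum_(b in B) (b <= a))%N.

Definition clbasis A : clifford R m := [ffun B => (B == A)%:R].

Definition clunit : clifford R m := clbasis finset.set0.

Definition clmul x y : clifford R m :=
  [ffun C => \sum_A clsign A (symdiff A C) * x A * y (symdiff A C)].

Let symdiffE A B i : (i \in symdiff A B) = (i \in A) (+) (i \in B).
Proof. by rewrite !inE; do 2!case: (_ \in _). Qed.

Let symdiffC A B : symdiff A B = symdiff B A.
Proof. by apply/finset.setP => i; rewrite !symdiffE addbC. Qed.

Let symdiffA A B C : symdiff A (symdiff B C) = symdiff (symdiff A B) C.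
Proof. by apply/finset.setP => i; rewrite !symdiffE addbA. Qed.

Let symdiffK A : involutive (symdiff A).
Proof. by move=> B; apply/finset.setP => i; rewrite !symdiffE addKb. Qed.

Let symdiff0 A : symdiff A finset.set0 = A.
Proof. by apply/finset.setP => i; rewrite !symdiffE inE addbF. Qed.

Let symdiffv A : symdiff A A = finset.set0.
Proof. by apply/finset.setP => i; rewrite !symdiffE inE addbb. Qed.

Let clsign_prod A B :
  clsign A B = \prod_(a in A) \prod_(b in B) (-1) ^+ (b <= a)%N.
Proof.
by rewrite /clsign -prodrXr; apply: eq_bigr => a _; rewrite prodrXr.
Qed.

Let prod_symdiff (g : 'I_m -> R) A B : (forall i, g i * g i = 1) ->
  \prod_(i in symdiff A B) g i = (\prod_(i in A) g i) * (\prod_(i in B) g i).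
Proof.
move=> g2; rewrite (big_mkcond (mem A)) (big_mkcond (mem B)) -big_split /=.
rewrite big_mkcond; apply: eq_bigr => i _; rewrite symdiffE.
by case: (i \in A); case: (i \in B); rewrite /= ?g2 ?mulr1 ?mul1r.
Qed.

Let sign_sqr (b : bool) : (-1) ^+ b * (-1) ^+ b = 1 :> R.
Proof. by case: b; rewrite ?mulr1 // mulrNN mulr1. Qed.

Let clsignDr A B C : clsign A (symdiff B C) = clsign A B * clsign A C.
Proof.
rewrite !clsign_prod -big_split /=; apply: eq_bigr => a _.
by apply: prod_symdiff => i.
Qed.

Let clsignDl A B C : clsign (symdiff A B) C = clsign A C * clsign B C.
Proof.
rewrite !clsign_prod; apply: prod_symdiff => i.
by rewrite -big_split big1 //= => j _.
Qed.

Let clsign_sqr A B : clsign A B * clsign A B = 1.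
Proof. by rewrite -clsignDr symdiffv /clsign; under eq_bigr do rewrite big_set0; rewrite big1. Qed.

Let clsign0r A : clsign A finset.set0 = 1.
Proof. by rewrite -(symdiffv finset.set0) clsignDr clsign_sqr. Qed.

Let clsign0l A : clsign finset.set0 A = 1.
Proof. by rewrite -(symdiffv finset.set0) clsignDl clsign_sqr. Qed.

Let clmulA : associative clmul.
Proof.
move=> x y z; apply/ffunP => C; rewrite !ffunE.
under eq_bigr => A _ do rewrite ffunE mulr_sumr.
under [RHS]eq_bigr => D _ do rewrite ffunE mulr_sumr mulr_suml.
rewrite [RHS]exchange_big /=; apply: eq_bigr => A _.
rewrite [RHS](reindex_inj (can_inj (symdiffK A))) /=.
apply: eq_bigr => B _; rewrite symdiffK.
have -> : symdiff (symdiff A B) C = symdiff B (symdiff A C).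
  by rewrite (symdiffC A) symdiffA.
have {1}-> : symdiff A C = symdiff B (symdiff B (symdiff A C)) by rewrite symdiffK.
rewrite clsignDl clsignDr; ring.
Qed.

Let clmul1l : left_id clunit clmul.
Proof.
move=> x; apply/ffunP => C; rewrite ffunE (bigD1 finset.set0) //= big1.
  by rewrite clsign0l ffunE eqxx mul1r mul1r addr0 symdiffC symdiff0.
by move=> A A0; rewrite ffunE (negPf A0) mulr0 mul0r.
Qed.

Let clmul1r : right_id clunit clmul.
Proof.
move=> x; apply/ffunP => C; rewrite ffunE (bigD1 C) //= big1.
  by rewrite symdiffv clsign0r ffunE eqxx mul1r mulr1 addr0.
move=> A AC; rewrite [clunit _]ffunE; case: eqP => [E|]; last by rewrite mulr0.
by rewrite -(symdiffK A C) E symdiff0 eqxx in AC.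
Qed.

Let clmulDl : left_distributive clmul +%R.
Proof.
move=> x y z; apply/ffunP => C; rewrite !ffunE -big_split /=.
by apply: eq_bigr => A _; rewrite ffunE mulrDr mulrDl.
Qed.

Let clmulDr : right_distributive clmul +%R.
Proof.
move=> x y z; apply/ffunP => C; rewrite !ffunE -big_split /=.
by apply: eq_bigr => A _; rewrite ffunE mulrDr.
Qed.

Let clunit_neq0 : clunit != 0.
Proof.
apply/eqP => /ffunP /(_ finset.set0); rewrite !ffunE eqxx.
by apply/eqP; rewrite oner_eq0.
Qed.

HB.instance Definition _ := GRing.Zmodule_isNzRing.Build (clifford R m)
  clmulA clmul1l clmul1r clmulDl clmulDr clunit_neq0.

Let clscaleAl (a : R) x y : a *: (x * y) = (a *: x) * y.
Proof.
apply/ffunP => C; rewrite !ffunE scaler_sumr.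
by apply: eq_bigr => A _; rewrite ffunE [LHS]mulrA mulrCA !mulrA.
Qed.

Let clscaleAr (a : R) x y : a *: (x * y) = x * (a *: y).
Proof.
apply/ffunP => C; rewrite !ffunE scaler_sumr.
by apply: eq_bigr => A _; rewrite ffunE [LHS]mulrCA !mulrA.
Qed.

HB.instance Definition _ :=
  GRing.Lmodule_isLalgebra.Build R (clifford R m) clscaleAl.
HB.instance Definition _ :=
  GRing.Lalgebra_isAlgebra.Build R (clifford R m) clscaleAr.

Definition clgen (i : 'I_m) : clifford R m := clbasis [set i]%SET.

(* (e_{h1} ... e_{hr})^c = (-1)^r e_{hr} ... e_{h1} = (-1)^(r(r+1)/2) e_A.      *)
Definition clconj x : clifford R m :=
  [ffun A : {set 'I_m} => (-1) ^+ 'C(#|A|.+1, 2) * x A].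

Lemma clbasisM A B : clbasis A * clbasis B = clsign A B *: clbasis (symdiff A B).
Proof.
apply/ffunP => C; rewrite !ffunE (bigD1 A) //= big1 => [|D DA]; last first.
  by rewrite ffunE (negPf DA) mulr0 mul0r.
rewrite !ffunE eqxx mulr1 addr0 /GRing.scale /=.
have -> : (symdiff A C == B) = (C == symdiff A B).
  by apply/eqP/eqP => [<-|->]; rewrite symdiffK.
by case: eqP => [->|_]; rewrite ?symdiffK ?mulr0.
Qed.

Lemma clgen_anticomm (i j : 'I_m) :
  clgen i * clgen j + clgen j * clgen i = (- (2 * (i == j)%:R : R))%:A.
Proof.
rewrite !clbasisM (symdiffC [set j]%SET) /clsign !big_set1 -scalerDl.
have [->|ij] := eqVneq i j.
  rewrite leqnn symdiffv; congr (_ *: _). by rewrite mulr1 -opprD.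
rewrite mulr0 oppr0 scale0r.
have [ji|ij'] := leqP j i.
  have -> : (i <= j)%N = false by rewrite leqNgt ltn_neqAle ji andbT eq_sym ij.
  by rewrite expr1 expr0 addNr scale0r.
by rewrite (ltnW ij') expr1 expr0 subrr scale0r.
Qed.

Lemma clbasis_prod A : clbasis A = \prod_(i <- enum A) clgen i.
Proof.
have: sorted (fun i j : 'I_m => i < j)%N (enum A).
  have := iota_ltn_sorted 0 m; rewrite -val_enum_ord sorted_map => sE.
  rewrite /enum_mem; apply: sorted_filter => [a b c|]; first exact: ltn_trans.
  by move: sE; rewrite enumT.
rewrite -[in clbasis A](finset.set_enum A).
elim: (enum A) => [|i s IHs] /= ss.
  by rewrite big_nil; congr clbasis; apply/finset.setP => i; rewrite !inE.
rewrite big_cons -IHs ?(path_sorted ss) // clbasisM.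
have lt_is j : j \in s -> (i < j)%N.
  move: ss; rewrite path_sortedE => [/andP [/allP ss _] /ss //|].
  by move=> a b c; exact: ltn_trans.
rewrite /clsign big_set1 big1 => [|j]; last first.
  by rewrite inE => /lt_is; rewrite ltnNge => /negPf ->.
rewrite expr0 scale1r; congr clbasis; apply/finset.setP => j.
rewrite symdiffE !inE; have [->|//] := eqVneq j i.
by case: (boolP (i \in s)) => // /lt_is; rewrite ltnn.
Qed.

Lemma clifford_sum x : x = \sum_A x A *: clbasis A.
Proof.
apply/ffunP => C; rewrite sum_ffunE (bigD1 C) //= big1 => [|A AC].
  by rewrite !ffunE eqxx /GRing.scale /= mulr1 addr0.
by rewrite !ffunE eq_sym (negPf AC) scaler0.
Qed.

Let clconj_sign A : (-1) ^+ 'C(#|A|.+1, 2) = clsign A A.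
Proof.
rewrite /clsign; congr (_ ^+ _); apply: esym.
suff: (\sum_(a in A) \sum_(b in A) (b <= a)).*2%N = ('C(#|A|.+1, 2)).*2.
  by move/double_inj.
rewrite -addnn {2}exchange_big -big_split /=.
transitivity (\sum_(a in A) (#|A| + 1))%N; last first.
  rewrite sum_nat_const bin2 addn1 mulnC even_halfK //.
  by rewrite oddM oddS andNb.
apply: eq_bigr => a aA; rewrite -big_split /= (bigD1 a) //= leqnn.
rewrite (eq_bigr (fun=> 1%N)) => [|b /andP [_ ba]]; last first.
  by move: ba; rewrite -val_eqE /=; case: ltngtP.
rewrite sum1_card [in RHS](cardD1 a) aA addn1; apply: (congr1 (fun k => k.+2)).
by apply: eq_card => b; rewrite !inE andbC.
Qed.

Lemma clconj_gen (i : 'I_m) : clconj (clgen i) = - clgen i.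
Proof.
apply/ffunP => A; rewrite !ffunE.
by case: eqP => [->|_]; rewrite ?mulr0 ?oppr0 // cards1 expr1 mulN1r.
Qed.

Lemma clconjM x y : clconj (x * y) = clconj y * clconj x.
Proof.
apply/ffunP => C; rewrite !ffunE mulr_sumr clconj_sign.
rewrite [RHS](reindex_inj (can_inj (symdiffK C))) /=.
apply: eq_bigr => A _; rewrite !ffunE !clconj_sign [in RHS](symdiffC C A).
have -> : symdiff (symdiff A C) C = A by rewrite symdiffC (symdiffC A) symdiffK.
have: C = symdiff A (symdiff A C) by rewrite symdiffK.
move: (symdiff A C) => B ->.
rewrite !clsignDl !clsignDr.
transitivity ((clsign A B * clsign A B) *
  (clsign A A * clsign B A * clsign B B * x A * y B)); first by ring.
by rewrite clsign_sqr; ring.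
Qed.

Lemma clconjK : involutive clconj.
Proof.
by move=> x; apply/ffunP => A; rewrite !ffunE mulrA clconj_sign clsign_sqr mul1r.
Qed.

End CliffordAlgebra.

(* R[i] typed as a numClosedFieldType, the form under which it and its         *)
(* matrices carry their topology and normed module structures over itself.     *)
Definition Cplx (R : realType) : numClosedFieldType := R[i].

Section SeveralComplexVariables.
Variables (R : realType) (n : nat).
Local Notation C := (Cplx R).
Implicit Types (z v : 'rV[C]_n) (U : set 'rV[C]_n).

(* Euclidean norm; the library norm on 'rV[C]_n is the equivalent sup norm.    *)
Definition cnorm z : R :=
  Num.sqrt (\sum_t (complex.Re (z 0 t) ^+ 2 + complex.Im (z 0 t) ^+ 2)).

Definition cball : set 'rV[C]_n := [set z | cnorm z < 1].

Definition cconj z : 'rV[C]_n := map_mx Num.conj z.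

(* Complex differentiability: the base field of 'rV[C]_n is C.                 *)
Definition holomorphic_on U (phi : 'rV[C]_n -> 'rV[C]_n) :=
  open U /\ forall z, U z -> differentiable phi z.

Definition biholomorphic_onto_image U (phi : 'rV[C]_n -> 'rV[C]_n) :=
  holomorphic_on U phi /\
  exists2 psi, holomorphic_on (phi @` U) psi &
    forall z, U z -> psi (phi z) = z.

(* convex_set is taken over the scalars C; its parameters range over the       *)
(* t : C with 0 <= t <= 1, which forces t to be real.                          *)
Definition convex_mapping U (phi : 'rV[C]_n -> 'rV[C]_n) :=
  biholomorphic_onto_image U phi /\ convex_set (phi @` U).

Definition dir_alpha (t : 'I_n) : 'rV[C]_n := delta_mx 0 t.
Definition dir_beta (t : 'I_n) : 'rV[C]_n := (Complex 0 1 : C) *: delta_mx 0 t.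

Definition along (g : 'rV[C]_n -> R) v z (h : R) : R :=
  g (z + (Complex h 0 : C) *: v).

Definition pderiv (g : 'rV[C]_n -> R) v z : R := derive1 (along g v z) 0.

Definition C1_on U (g : 'rV[C]_n -> R) :=
  forall v, (exists t, v = dir_alpha t \/ v = dir_beta t) ->
  forall z, U z ->
    derivable (along g v z) 0 1 /\ {for z, continuous (pderiv g v)}.

End SeveralComplexVariables.

Section SliceRegular.
Variables (R : realType) (m n : nat).
Local Notation C := (Cplx R).
Local Notation Cl := (clifford R m).
Implicit Types (I J : Cl) (z v : 'rV[C]_n) (s t : 'I_n).

Definition clnorm (x : Cl) : R := Num.sqrt (\sum_A x A ^+ 2).

Definition vnorm (x : 'rV[Cl]_n) : R := Num.sqrt (\sum_t clnorm (x 0 t) ^+ 2).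

Definition cltr (x : Cl) : Cl := x + clconj x.
Definition cln (x : Cl) : Cl := x * clconj x.

Definition quadratic_cone : set Cl :=
  [set x | (exists a : R, x = a%:A) \/
           (exists a b : R, [/\ cltr x = a%:A, cln x = b%:A & a ^+ 2 < 4 * b])].

Definition imag_sphere : set Cl :=
  [set J | quadratic_cone J /\ J ^+ 2 = -1].

(* alpha + I beta, for z = alpha + i beta                                      *)
Definition slice_point I z : 'rV[Cl]_n :=
  \row_t ((complex.Re (z 0 t))%:A + I * (complex.Im (z 0 t))%:A).

Definition cslice I : set 'rV[Cl]_n := range (slice_point I).

Definition slice_cone : set 'rV[Cl]_n := \bigcup_(I in imag_sphere) cslice I.

Definition qball : set 'rV[Cl]_n := [set x | slice_cone x /\ vnorm x < 1].

Definition qball_slice I : set 'rV[Cl]_n := qball `&` cslice I.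

(* Elements F1 + i F2 of a complexification are pairs (F1, F2). Maps on cball  *)
(* or qball are total functions that are only ever constrained on these sets.  *)
Definition cmodule := ('rV[Cl]_n * 'rV[Cl]_n)%type.

Definition mul_i (p : Cl * Cl) : Cl * Cl := (- p.2, p.1).

Definition stem_mapping (F : 'rV[C]_n -> cmodule) :=
  forall z, cball z ->
    (F (cconj z)).1 = (F z).1 /\ (F (cconj z)).2 = - (F z).2.

Definition induces (F : 'rV[C]_n -> cmodule) (f : 'rV[Cl]_n -> 'rV[Cl]_n) :=
  forall z J, cball z -> imag_sphere J ->
    f (slice_point J z) = (F z).1 + J *: (F z).2.

Definition stem_C1 (F : 'rV[C]_n -> cmodule) :=
  forall s (A : {set 'I_m}),
    C1_on (@cball R n) (fun z => (F z).1 0 s A) /\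
    C1_on (@cball R n) (fun z => (F z).2 0 s A).

Definition stem_pderiv (F : 'rV[C]_n -> cmodule) s v z : Cl * Cl :=
  ([ffun A => pderiv (fun w => (F w).1 0 s A) v z],
   [ffun A => pderiv (fun w => (F w).2 0 s A) v z]).

Definition stem_dbar (F : 'rV[C]_n -> cmodule) s t z : Cl * Cl :=
  (2^-1 : R) *:
  (stem_pderiv F s (dir_alpha R t) z + mul_i (stem_pderiv F s (dir_beta R t) z)).

Definition stem_d (F : 'rV[C]_n -> cmodule) s t z : Cl * Cl :=
  (2^-1 : R) *:
  (stem_pderiv F s (dir_alpha R t) z - mul_i (stem_pderiv F s (dir_beta R t) z)).

Definition holomorphic_stem (F : 'rV[C]_n -> cmodule) :=
  [/\ stem_mapping F, stem_C1 F &
      forall s t z, cball z -> stem_dbar F s t z = 0].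

Definition slice_regular (f : 'rV[Cl]_n -> 'rV[Cl]_n) :=
  exists2 F, holomorphic_stem F & induces F f.

(* The stem mapping F is determined on cball by f (when 0 < m), hence so are   *)
(* the values of df on qball.                                                  *)
Definition slice_derivative (f : 'rV[Cl]_n -> 'rV[Cl]_n)
    (df : 'rV[Cl]_n -> 'M[Cl]_n) :=
  exists F, [/\ holomorphic_stem F, induces F f &
    forall z J s t, cball z -> imag_sphere J ->
      df (slice_point J z) s t = (stem_d F s t z).1 + J * (stem_d F s t z).2].

(* f restricts to a convex mapping of qball_slice I into cslice I, read through *)
(* the identification slice_point I of C^n with cslice I.                      *)
Definition convex_on_slice I (f : 'rV[Cl]_n -> 'rV[Cl]_n) :=
  f @` qball_slice I `<=` cslice I /\
  exists2 phi : 'rV[C]_n -> 'rV[C]_n,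
    convex_mapping (@cball R n) phi &
    forall z, cball z -> f (slice_point I z) = slice_point I (phi z).

Definition normalized_slice_convex (f : 'rV[Cl]_n -> 'rV[Cl]_n)
    (df : 'rV[Cl]_n -> 'M[Cl]_n) :=
  [/\ slice_regular f,
      exists2 I, imag_sphere I & convex_on_slice I f,
      f 0 = 0,
      slice_derivative f df &
      df 0 = 1%:M].

End SliceRegular.

(* Main.v *)
(* Writing x = alpha + J beta and z = alpha + i beta, the representation formula *)
(* gives |f x|^2 = (1 + t)/2 |phi z|^2 + (1 - t)/2 |phi (conj z)|^2, where        *)
(* t = <I, J> lies in [-1, 1] and phi is the convex mapping f induces on the      *)
(* slice C_I. The bounds are therefore those of a normalized convex mapping phi   *)
(* of the unit ball of C^n.                                                       *)
(*                                                                                *)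
(* Let psi be the inverse of phi. By the Schwarz lemma phi maps balls centred at  *)
(* 0 onto convex sets, so g x = <z - psi ((1 - t) phi z + t phi (x z)), z> /      *)
(* (t |z|^2) has nonnegative real part on the unit disc, vanishes at 1 and has    *)
(* derivative -1 there; hence |g 0 - 1| <= 1. As g 0 extends holomorphically      *)
(* along the complex line through z, with value 1 at 0, a second use of the       *)
(* Schwarz lemma gives                                                            *)
(*   |<psi (s phi z), z> - s |z|^2| <= (1 - s) |z|^3   for 0 <= s < 1.            *)
(* Infinitesimally, N s = |psi (s phi z)| satisfies |(s / N s)'| <= 1, and        *)
(* s / N s tends to 1 / |phi z| at 0; integrating over [0, 1] yields              *)
(* |1 / |z| - 1 / |phi z|| <= 1, which is the growth estimate.                    *)
(*                                                                                *)
(* Both bounds are attained by z / (1 - <z, e_1>) at multiples of e_1.            *)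

Require Import Defs.
From HB Require Import structures.
From mathcomp Require Import all_boot all_order all_algebra complex ring lra.
From mathcomp Require Import all_classical all_reals all_analysis.
Set Implicit Arguments.
Unset Strict Implicit.
Unset Printing Implicit Defensive.

Import Order.TTheory GRing.Theory Num.Theory numFieldNormedType.Exports.

Local Open Scope classical_set_scope.
Local Open Scope ring_scope.

(** * Complex moduli *)

(** A slice mapping is determined by its stem, so one slice controls all the others: by
    [slice_norm_sqr], [|f x|^2] is a convex combination of the squared norms of [phi z] and
    [phi (cconj z)], and [z] and [cconj z] have the same norm. What remains is [convex_growth], the
    growth estimate for a normalized convex mapping of the ball of C^n.

    Convexity enters through the inverse [psi]: it can be applied to every convex combination of
    values of [phi], which produces holomorphic functions of one variable with values in the ball.
    Schwarz and Julia lemmas for these functions give [psi_comb_le], [psi_shrink_julia] and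
    [psi_shrink] in turn. For [s] near 1 the last one becomes a differential inequality along a ray
    of the image ([ray_derivative]), which [ray_quotient_lip] integrates.

    The function theory rests on strict differentiability ([cdiff], [vdiff], [mdiff]) instead of
    contour integrals. A mean value property over roots of unity ([mean_value]) yields the maximum
    principle, removable singularities and the Schwarz lemmas. Strict differentiability of [phi]
    comes from the C^1 stem through [fdiff_mdiff], that of [psi] from [mdiff_inverse]. *)

Definition cmod (R : realType) (z : Cplx R) : R := ComplexField.Normc.normc (z : R[i]).
Definition rc (R : realType) (x : R) : Cplx R := real_complex R x.

Section Cmod.
Variable R : realType.
Local Notation C := (Cplx R).
Implicit Types (x y z : C) (a b : R).

Lemma cmodE z : cmod z = Num.sqrt (complex.Re z ^+ 2 + complex.Im z ^+ 2).
Proof. by case: z. Qed.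

Lemma normE z : `|z| = rc (cmod z).
Proof. by case: z. Qed.

Lemma cmod_sqr z : cmod z ^+ 2 = complex.Re z ^+ 2 + complex.Im z ^+ 2.
Proof. by rewrite cmodE sqr_sqrtr ?addr_ge0 ?sqr_ge0. Qed.

Lemma cmod_ge0 z : 0 <= cmod z.
Proof. by rewrite cmodE sqrtr_ge0. Qed.

Lemma cmod0 : cmod (0 : C) = 0.
Proof. exact: ComplexField.Normc.normc0. Qed.

Lemma cmod1 : cmod (1 : C) = 1.
Proof. exact: ComplexField.Normc.normc1. Qed.

Lemma cmodM x y : cmod (x * y) = cmod x * cmod y.
Proof. exact: ComplexField.Normc.normcM. Qed.

Lemma cmodV x : cmod x^-1 = (cmod x)^-1.
Proof. exact: ComplexField.Normc.normcV. Qed.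

Lemma cmodX x k : cmod (x ^+ k) = cmod x ^+ k.
Proof. by elim: k => [|k IH]; rewrite ?expr0 ?cmod1 // !exprS cmodM IH. Qed.

Lemma cmodD x y : cmod (x + y) <= cmod x + cmod y.
Proof. exact: (@le_normcD R). Qed.

Lemma cmodN x : cmod (- x) = cmod x.
Proof. exact: (@normcN R). Qed.

Lemma cmodB x y : cmod (x - y) <= cmod x + cmod y.
Proof. by rewrite -[cmod y]cmodN cmodD. Qed.

Lemma cmodC x y : cmod (x - y) = cmod (y - x).
Proof. by rewrite -cmodN opprB. Qed.

Lemma cmod_eq0 x : cmod x = 0 -> x = 0.
Proof. exact: ComplexField.Normc.eq0_normc. Qed.

Lemma cmod_gt0 x : x != 0 -> 0 < cmod x.
Proof.
by move=> x0; rewrite lt_neqAle cmod_ge0 andbT; apply: contra x0 => /eqP/esym/cmod_eq0 ->.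
Qed.

Lemma cmod_tri x y z : cmod (x - z) <= cmod (x - y) + cmod (y - z).
Proof. by apply: le_trans (cmodD _ _); rewrite addrA subrK. Qed.

Lemma cmod_lowB x y : cmod x - cmod y <= cmod (x - y).
Proof. by rewrite lerBlDr; apply: le_trans (cmodD _ _); rewrite subrK. Qed.

Lemma cmod_sum (I : Type) (r : seq I) (P : pred I) (F : I -> C) :
  cmod (\sum_(i <- r | P i) F i) <= \sum_(i <- r | P i) cmod (F i).
Proof.
elim/big_rec2: _ => [|i a b _ ab]; first by rewrite cmod0.
by apply: le_trans (cmodD _ _) _; rewrite lerD2l.
Qed.

Lemma cRe_rc a : complex.Re (rc a) = a. Proof. by []. Qed.
Lemma cIm_rc a : complex.Im (rc a) = 0. Proof. by []. Qed.
Lemma cReD x y : complex.Re (x + y) = complex.Re x + complex.Re y.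
Proof. by case: x; case: y. Qed.
Lemma cImD x y : complex.Im (x + y) = complex.Im x + complex.Im y.
Proof. by case: x; case: y. Qed.
Lemma cReN x : complex.Re (- x) = - complex.Re x.
Proof. by case: x. Qed.
Lemma cImN x : complex.Im (- x) = - complex.Im x.
Proof. by case: x. Qed.
Lemma cReM x y : complex.Re (x * y) =
  complex.Re x * complex.Re y - complex.Im x * complex.Im y.
Proof. by case: x; case: y. Qed.
Lemma cImM x y : complex.Im (x * y) =
  complex.Re x * complex.Im y + complex.Im x * complex.Re y.
Proof. by case: x; case: y => * /=; ring. Qed.
Lemma cRe_conj x : complex.Re (Num.conj x) = complex.Re x.
Proof. by case: x. Qed.
Lemma cIm_conj x : complex.Im (Num.conj x) = - complex.Im x.
Proof. by case: x. Qed.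
Lemma cRe_sum (I : Type) (r : seq I) (P : pred I) (F : I -> C) :
  complex.Re (\sum_(i <- r | P i) F i) = \sum_(i <- r | P i) complex.Re (F i).
Proof. by elim/big_rec2: _ => [//|i a b _ <-]; rewrite cReD. Qed.
Lemma CeqP x y : complex.Re x = complex.Re y -> complex.Im x = complex.Im y -> x = y.
Proof. by case: x => a b; case: y => c d /= -> ->. Qed.

Lemma rcD a b : rc (a + b) = rc a + rc b.
Proof. exact: rmorphD. Qed.
Lemma rcM a b : rc (a * b) = rc a * rc b.
Proof. exact: rmorphM. Qed.
Lemma rcN a : rc (- a) = - rc a.
Proof. exact: rmorphN. Qed.
Lemma rcB a b : rc (a - b) = rc a - rc b.
Proof. exact: rmorphB. Qed.
Lemma rcV a : rc (a^-1) = (rc a)^-1.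
Proof. exact: fmorphV. Qed.
Lemma rc0 : rc 0 = 0 :> C. Proof. by []. Qed.
Lemma rc1 : rc 1 = 1 :> C. Proof. by []. Qed.
Lemma rcn k : rc k%:R = k%:R :> C.
Proof. exact: rmorph_nat. Qed.
Lemma rcX a k : rc (a ^+ k) = rc a ^+ k.
Proof. exact: rmorphXn. Qed.
Lemma rc_eq0 a : (rc a == 0) = (a == 0).
Proof. by rewrite (fmorph_eq0 (real_complex R)). Qed.
Lemma cmod_rc a : cmod (rc a) = `|a|.
Proof. by rewrite cmodE /= expr0n addr0 sqrtr_sqr. Qed.
Lemma cmod_nat k : cmod (k%:R : C) = k%:R.
Proof. by rewrite -rcn cmod_rc normr_nat. Qed.
Lemma cmod_conj z : cmod (Num.conj z) = cmod z.
Proof. by rewrite !cmodE cRe_conj cIm_conj sqrrN. Qed.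
Lemma mul_conj z : z * Num.conj z = rc (cmod z ^+ 2).
Proof. by rewrite -normCK normE rcX. Qed.
Lemma cRe_le_cmod z : `|complex.Re z| <= cmod z.
Proof.
by rewrite -[X in _ <= X]ger0_norm ?cmod_ge0 // -ler_sqr ?nnegrE // !real_normK ?num_real // cmod_sqr lerDl sqr_ge0.
Qed.
Lemma cIm_le_cmod z : `|complex.Im z| <= cmod z.
Proof.
by rewrite -[X in _ <= X]ger0_norm ?cmod_ge0 // -ler_sqr ?nnegrE // !real_normK ?num_real // cmod_sqr lerDr sqr_ge0.
Qed.
Lemma cmod_le_ReIm z : cmod z <= `|complex.Re z| + `|complex.Im z|.
Proof.
rewrite -ler_sqr ?nnegrE ?cmod_ge0 ?addr_ge0 // cmod_sqr sqrrD !real_normK ?num_real //.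
by rewrite addrAC lerDl mulrn_wge0 // mulr_ge0.
Qed.

(** Balls of [Cplx R] have complex radii; with real radii all later limits become statements about
    real numbers. *)
Lemma nbhs_cmod (P : set C) (c : C) :
  nbhs c P <-> exists2 d : R, 0 < d & forall z, cmod (z - c) < d -> P z.
Proof.
split=> [/nbhs_ballP [e /= e0 eP]|[d d0 dP]].
  have eR : e = rc (complex.Re e).
    by rewrite /rc RRe_real // gtr0_real.
  exists (complex.Re e); first by move: e0; rewrite eR ltcR.
  by move=> z zc; apply: eP; rewrite -ball_normE /= distrC normE eR ltcR.
apply/nbhs_ballP; exists (rc d); first by rewrite /= ltcR.
by move=> z; rewrite -ball_normE /= distrC normE ltcR; exact: dP.
Qed.

End Cmod.

(** * The discrete mean value property *)

(* Strict differentiability (both points move) carries the continuity of the   *)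
(* derivative along, which replaces Goursat's theorem in what follows, and is  *)
(* inherited by compositions and inverses.                                     *)
Definition cdiff (R : realType) (h : Cplx R -> Cplx R) (c l : Cplx R) :=
  forall e : R, 0 < e -> exists2 d : R, 0 < d & forall a b : Cplx R,
    cmod (a - c) < d -> cmod (b - c) < d ->
    cmod (h b - h a - l * (b - a)) <= e * cmod (b - a).

Section MeanValue.
Variable R : realType.
Local Notation C := (Cplx R).
Implicit Types (h : C -> C) (c : C) (s e : R).

(** The disc is a closed part of a square, and the square is the continuous image of a product of
    two real segments. *)
Lemma closed_disc_compact c s : compact [set z : C | cmod (z - c) <= s].
Proof.
pose f (p : R * R) : C := Complex p.1 p.2.
have fc : continuous f.
  move=> [x y] P /nbhs_cmod [d d0 dP].
  apply/nbhs_ballP; exists (d / 2); first by rewrite /= divr_gt0.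
  move=> [x' y'] [] /=; rewrite /ball /= => hx hy; apply: dP.
  apply: le_lt_trans (cmod_le_ReIm _) _.
  rewrite cReD cImD cReN cImN /= distrC [X in _ + X]distrC.
  by move: hx hy; lra.
pose Q : set (R * R) :=
  `[complex.Re c - s, complex.Re c + s] `*` `[complex.Im c - s, complex.Im c + s].
have cQ : compact Q by apply: compact_setX; exact: segment_compact.
have cfQ : compact (f @` Q).
  by apply: continuous_compact cQ; apply: continuous_subspaceT.
apply: (subclosed_compact _ cfQ).
  rewrite [X in closed X](_ : _ = (fun z : C => cmod (z - c)) @^-1` [set x | x <= s]) //.
  apply: closed_comp; last exact: closed_le.
  move=> z _ P /nbhs_ballP [e /= e0 eP]; apply/nbhs_cmod; exists e => // w wz.
  apply: eP; rewrite /ball /= ltr_norml.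
  have := cmod_tri w z c; have := cmod_tri z w c; rewrite (cmodC z w); lra.
move=> z /= zc; exists (complex.Re z, complex.Im z); last by case: (z).
have := le_trans (cRe_le_cmod _) zc; have := le_trans (cIm_le_cmod _) zc.
rewrite cReD cImD cReN cImN !ler_norml => hI hR.
by split; rewrite /= in_itv /=; lra.
Qed.

(** Start from -1 and take square roots [v] with nonnegative real part. Then [|v + 1|^2 >= 2], and
    [w - 1 = (v - 1) * (v + 1)] shows that each root at least halves [|w - 1|^2]. *)
Lemma unity_root_near1 k : exists w : C,
  [/\ cmod w = 1, w != 1, w ^+ (2 ^ k.+1) = 1 & cmod (w - 1) ^+ 2 <= 4 / 2 ^+ k].
Proof.
elim: k => [|k [w [w1 wn1 wk wb]]].
  exists (- 1); split.
  - by rewrite cmodN cmod1.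
  - by rewrite eqNr oner_eq0.
  - by rewrite expn1 sqrrN expr1n.
  - by rewrite -opprD cmodN -[1 + 1]/(2%:R) cmod_nat expr0 divr1 -natrX.
have [v [v2 vRe]] : exists v : C, v ^+ 2 = w /\ 0 <= complex.Re v.
  have [h|h] := leP 0 (complex.Re (sqrtC w)).
    by exists (sqrtC w); rewrite sqrtCK.
  by exists (- sqrtC w); rewrite sqrrN sqrtCK cReN oppr_ge0 ltW.
have v1 : cmod v = 1.
  have : cmod v ^+ 2 = 1 by rewrite -cmodX v2.
  by move/eqP; rewrite sqrf_eq1 => /orP[/eqP//|/eqP h]; have := cmod_ge0 v; rewrite h; lra.
exists v; split => //.
- by apply: contra wn1 => /eqP v1'; rewrite -v2 v1' expr1n.
- by rewrite expnS exprM v2.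
have -> : (4 / 2 ^+ k.+1 : R) = (4 / 2 ^+ k) / 2 by rewrite exprS invfM mulrCA mulrC.
have E : cmod (w - 1) ^+ 2 = cmod (v - 1) ^+ 2 * cmod (v + 1) ^+ 2.
  by rewrite -exprMn -cmodM -v2 subr_sqr_1.
have F : 2 <= cmod (v + 1) ^+ 2.
  have : cmod v ^+ 2 = 1 by rewrite v1 expr1n.
  by rewrite !cmod_sqr cReD cImD /=; nra.
rewrite ler_pdivlMr //; apply: le_trans wb; rewrite E.
by rewrite ler_wpM2l // sqr_ge0.
Qed.

(** Compactness of the closed disc replaces the radii of strict differentiability by a single [d];
    each point keeps its own slope [l]. *)
Lemma cdiff_uniform h c s : (forall a, cmod (a - c) <= s -> exists l, cdiff h a l) ->
  forall e, 0 < e -> exists2 d : R, 0 < d & forall a, cmod (a - c) <= s ->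
    exists l, forall b, cmod (b - a) < d ->
      cmod (h b - h a - l * (b - a)) <= e * cmod (b - a).
Proof.
move=> hd e e0.
have /compact_near_coveringP := @closed_disc_compact c s.
pose P (d : R) (a : C) := exists l, forall b, cmod (b - a) < d ->
      cmod (h b - h a - l * (b - a)) <= e * cmod (b - a).
move/(_ _ (0^'+ : set_system R) P _).
case.
  move=> a /hd [l /(_ _ e0) [d d0 dP]].
  (* One half of [d] bounds the distance from [a] to the new centre, the other half the radius
     around that centre. *)
  exists ([set z | cmod (z - a) < d / 2], [set x | x < d / 2]).
    split; first by apply/nbhs_cmod; exists (d / 2); rewrite ?divr_gt0.
    by apply: nbhs_right_lt; rewrite divr_gt0.
  move=> [z x] /= [zd xd]; exists l => b bz; apply: dP; first by lra.
  by have := cmod_tri b z a; lra.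
move=> x /= x0 xP.
exists (x / 2); first by rewrite divr_gt0.
apply: (xP (x / 2)).
- by rewrite /= sub0r normrN gtr0_norm ?divr_gt0 //; lra.
- by rewrite divr_gt0.
Qed.

(* With w a root of unity close to 1, the angular increments of h on a circle  *)
(* sum to 0, and by strict differentiability the radial increments are         *)
(* proportional to them up to a small error.                                   *)
Lemma mean_value h c s : 0 < s ->
  (forall a, cmod (a - c) <= s -> exists l, cdiff h a l) ->
  forall e, 0 < e -> exists N (w : C), [/\ (0 < N)%N, cmod w = 1, w != 1, w ^+ N = 1 &
    cmod (\sum_(j < N) h (c + rc s * w ^+ j) - N%:R * h c) <= N%:R * e].
Proof.
(* The circle of radius [s] is reached from the centre in [K] radial steps of length [eta = s / K],
   each with an error [2 * e1 * eta] per root of unity; together they cost [e]. *)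
move=> s0 hd e e0; pose e1 := e / (2 * s).
have e10 : 0 < e1 by rewrite divr_gt0 // mulr_gt0.
have [d d0 dP] := cdiff_uniform hd e10.
have [k kP] : exists k : nat, 4 * s ^+ 2 / d ^+ 2 < 2 ^+ k.
  exists (Num.trunc (4 * s ^+ 2 / d ^+ 2)).+1.
  apply: lt_trans (_ : (Num.trunc (4 * s ^+ 2 / d ^+ 2)).+1%:R < _).
    by rewrite truncnS_gt.
  by rewrite -natrX ltr_nat ltn_expl.
have [w [w1 wn1 wN wb]] := unity_root_near1 k.
set N := (2 ^ k.+1)%N in wN *.
have N0 : (0 < N)%N by rewrite expn_gt0.
exists N, w; split => //.
have swd : s * cmod (w - 1) < d.
  rewrite -ltr_sqr ?nnegrE ?mulr_ge0 ?cmod_ge0 ?ltW // exprMn.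
  have h2 : 0 < (2 : R) ^+ k by rewrite exprn_gt0.
  have hd2 : 0 < d ^+ 2 by rewrite exprn_gt0.
  apply: le_lt_trans (_ : s ^+ 2 * (4 / 2 ^+ k) < _).
    by rewrite ler_wpM2l // sqr_ge0.
  by rewrite mulrA ltr_pdivrMr // mulrC [_ * 2 ^+ k]mulrC -ltr_pdivrMr.
have [K [K0 Kd]] : exists K : nat, (0 < K)%N /\ s / K%:R < d.
  exists (Num.trunc (s / d)).+1; split => //.
  by rewrite ltr_pdivrMr ?ltr0n // mulrC -ltr_pdivrMr // truncnS_gt.
set eta := s / K%:R in Kd.
have K0' : 0 < (K%:R : R) by rewrite ltr0n.
have eta0 : 0 < eta by rewrite divr_gt0.
have cw j : cmod (w ^+ j) = 1 by rewrite cmodX w1 expr1n.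
have sw : \sum_(j < N) w ^+ j = 0.
  apply: (mulfI (_ : w - 1 != 0)); first by rewrite subr_eq0.
  by rewrite -subrX1 wN subrr mulr0.
pose S (r : R) := \sum_(j < N) h (c + rc r * w ^+ j).
suff H i : (i <= K)%N -> cmod (S (i%:R * eta) - N%:R * h c) <= N%:R * (2 * e1 * (i%:R * eta)).
  have := H K (leqnn _).
  have -> : K%:R * eta = s by rewrite /eta mulrC divfK // gt_eqF.
  by rewrite (_ : 2 * e1 * s = e) // /e1 mulrAC mulrC divfK // mulf_neq0 ?gt_eqF.
elim: i => [_|i IH iK].
  rewrite mul0r /S.
  under eq_bigr do rewrite rc0 mul0r addr0.
  by rewrite sumr_const card_ord mulr_natl subrr cmod0 !mulr0.
have step : cmod (S (i.+1%:R * eta) - S (i%:R * eta)) <= N%:R * (2 * e1 * eta).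
  rewrite /S -sumrB.
  set r := i%:R * eta.
  have -> : i.+1%:R * eta = r + eta by rewrite -natr1 mulrDl mul1r.
  have r0 : 0 <= r by rewrite mulr_ge0 ?ler0n // ltW.
  have rs : r <= s.
    apply: le_trans (_ : K%:R * eta <= s).
      by rewrite ler_pM2r // ler_nat ltnW.
    by rewrite /eta mulrC divfK // gt_eqF.
  have inD j : cmod (c + rc r * w ^+ j - c) <= s.
    by rewrite addrC addKr cmodM cw mulr1 cmod_rc ger0_norm.
  have near_rad j : cmod (c + rc (r + eta) * w ^+ j - (c + rc r * w ^+ j)) = eta.
    have -> : c + rc (r + eta) * w ^+ j - (c + rc r * w ^+ j) = rc eta * w ^+ j.
      by rewrite rcD; ring.
    by rewrite cmodM cw mulr1 cmod_rc gtr0_norm.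
  suff [D D0 DP] : exists2 D : nat -> C, \sum_(j < N) D j = 0 & forall j,
      cmod (h (c + rc (r + eta) * w ^+ j) - h (c + rc r * w ^+ j) - D j) <= 2 * e1 * eta.
    rewrite -[X in cmod X]subr0 -[X in _ - X]D0 -sumrB.
    apply: le_trans (cmod_sum _ _ _) _.
    apply: (@le_trans _ _ (\sum_(j < N) (2 * e1 * eta))).
      by apply: ler_sum => j _; exact: DP.
    by rewrite sumr_const card_ord [leRHS]mulr_natl.
  (* At the centre there are no angular increments, but the linear part of [h] at [c] itself sums to
     zero over the roots of unity. *)
  have [rz|rnz] := eqVneq r 0.
    have [l lP] : exists l : C, forall b, cmod (b - c) < d ->
        cmod (h b - h c - l * (b - c)) <= e1 * cmod (b - c).
      by apply: dP; rewrite subrr cmod0 ltW.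
    exists (fun j => l * rc eta * w ^+ j) => [|j]; first by rewrite -mulr_sumr sw mulr0.
    rewrite rz rc0 mul0r addr0 add0r.
    have := lP (c + rc eta * w ^+ j); rewrite (addrC c) addrK cmodM cw mulr1 cmod_rc gtr0_norm //.
    move=> /(_ Kd); rewrite mulrA => H; apply: le_trans H _.
    by rewrite -mulrA; have := mulr_gt0 e10 eta0; lra.
  have rp : 0 < r by rewrite lt_neqAle eq_sym rnz.
  have rwn : rc r * (w - 1) != 0 by rewrite mulf_neq0 ?rc_eq0 // subr_eq0.
  (* The radial step [rc eta * w ^+ j] is [kap] times the chord to the next point of the circle of
     radius [r], with [kap] independent of [j]. The increments of [h] along the chords telescope
     since [w ^+ N = 1]. *)
  pose kap : C := rc eta / (rc r * (w - 1)).
  exists (fun j => kap * (h (c + rc r * w ^+ j.+1) - h (c + rc r * w ^+ j))) => [|j].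
    rewrite -mulr_sumr -(big_mkord xpredT (fun j => h (c + rc r * w ^+ j.+1) - h (c + rc r * w ^+ j))).
    by rewrite telescope_sumr // wN expr0 subrr mulr0.
  have [l lP] := dP _ (inD j).
  set a := c + rc r * w ^+ j in lP *.
  have near_ang : c + rc r * w ^+ j.+1 - a = rc r * (w - 1) * w ^+ j.
    by rewrite /a exprS; ring.
  have mod_ang : cmod (c + rc r * w ^+ j.+1 - a) = r * cmod (w - 1).
    by rewrite near_ang !cmodM cw mulr1 cmod_rc ger0_norm.
  have E1 := lP (c + rc (r + eta) * w ^+ j); rewrite near_rad in E1; have {}E1 := E1 Kd.
  have E2 := lP (c + rc r * w ^+ j.+1); rewrite mod_ang in E2.
  have {}E2 : cmod (h (c + rc r * w ^+ j.+1) - h a - l * (c + rc r * w ^+ j.+1 - a))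
      <= e1 * (r * cmod (w - 1)).
    apply: E2; apply: le_lt_trans swd.
    by rewrite ler_wpM2r // cmod_ge0.
  set h2 := h (c + rc r * w ^+ j.+1) in E2 *; set h1 := h (c + rc (r + eta) * w ^+ j) in E1 *.
  have -> : h1 - h a - kap * (h2 - h a) =
     (h1 - h a - l * (c + rc (r + eta) * w ^+ j - a)) -
     kap * (h2 - h a - l * (c + rc r * w ^+ j.+1 - a)).
    rewrite near_ang.
    have -> : c + rc (r + eta) * w ^+ j - a = rc eta * w ^+ j by rewrite /a rcD; ring.
    have : kap * (rc r * (w - 1)) = rc eta by rewrite /kap divfK.
    move: kap => kp <-; ring.
  apply: le_trans (cmodB _ _) _.
  have -> : 2 * e1 * eta = e1 * eta + e1 * eta by ring.
  apply: lerD E1 _; rewrite cmodM.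
  apply: le_trans (ler_wpM2l (cmod_ge0 _) E2) _.
  rewrite /kap cmodM cmodV cmodM !cmod_rc !gtr0_norm // mulrCA ler_pM2l //.
  rewrite divfK // gt_eqF // mulr_gt0 // cmod_gt0 // subr_eq0 //.
apply: le_trans (cmod_tri _ (S (i%:R * eta)) _) _.
apply: le_trans (lerD step (IH (ltnW iK))) _.
have -> // : N%:R * (2 * e1 * (i.+1%:R * eta)) =
  N%:R * (2 * e1 * eta) + N%:R * (2 * e1 * (i%:R * eta)).
by rewrite -(natr1 i); ring.
Qed.

End MeanValue.

(** * Calculus of strictly differentiable functions *)

Section CDiff.
Variable R : realType.
Local Notation C := (Cplx R).
Implicit Types (h k : C -> C) (c l : C) (d e : R).

Definition ccont h c := forall e, 0 < e -> exists2 d, 0 < d &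
  forall z, cmod (z - c) < d -> cmod (h z - h c) < e.

Lemma cdiff_lip h c l : cdiff h c l -> exists2 d, 0 < d & forall a b,
  cmod (a - c) < d -> cmod (b - c) < d -> cmod (h b - h a) <= (cmod l + 1) * cmod (b - a).
Proof.
move=> /(_ _ ltr01) [d d0 dP]; exists d => // a b ac bc.
have := dP _ _ ac bc; have := cmodD (h b - h a - l * (b - a)) (l * (b - a)).
by rewrite subrK cmodM; lra.
Qed.

Lemma cdiff_cont h c l : cdiff h c l -> ccont h c.
Proof.
move=> /cdiff_lip [d d0 dP] e e0.
have K0 : 0 < cmod l + 1 by have := cmod_ge0 l; lra.
exists (Num.min d (e / (cmod l + 1))); first by rewrite lt_min d0 divr_gt0.
move=> z; rewrite lt_min => /andP [zd ze].
apply: le_lt_trans (dP c z _ zd) _; first by rewrite subrr cmod0.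
by rewrite mulrC -ltr_pdivlMr.
Qed.

Lemma cdiff_near h k c l d : 0 < d -> (forall z, cmod (z - c) < d -> h z = k z) ->
  cdiff h c l -> cdiff k c l.
Proof.
move=> d0 hk hd e /hd [d' d'0 dP]; exists (Num.min d d'); first by rewrite lt_min d0.
move=> a b; rewrite !lt_min => /andP [ad ad'] /andP [bd bd'].
by rewrite -!hk //; exact: dP.
Qed.

Lemma cdiff_cst v c : cdiff (fun=> v) c 0.
Proof.
move=> e e0; exists 1 => // a b _ _.
by rewrite subrr mul0r subrr cmod0 mulr_ge0 ?cmod_ge0 // ltW.
Qed.

Lemma cdiff_id c : cdiff id c 1.
Proof.
move=> e e0; exists 1 => // a b _ _.
by rewrite mul1r /id subrr cmod0 mulr_ge0 ?cmod_ge0 // ltW.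
Qed.

Lemma cdiffD h k c l l' : cdiff h c l -> cdiff k c l' ->
  cdiff (fun z => h z + k z) c (l + l').
Proof.
move=> hd kd e e0.
have e20 : 0 < e / 2 by rewrite divr_gt0.
have [d d0 dP] := hd _ e20; have [d' d'0 dP'] := kd _ e20.
exists (Num.min d d'); first by rewrite lt_min d0.
move=> a b; rewrite !lt_min => /andP [ad ad'] /andP [bd bd'].
have -> : h b + k b - (h a + k a) - (l + l') * (b - a) =
  (h b - h a - l * (b - a)) + (k b - k a - l' * (b - a)) by ring.
apply: le_trans (cmodD _ _) _.
by have := dP _ _ ad bd; have := dP' _ _ ad' bd'; lra.
Qed.

Lemma cdiff_comp h k c l l' : cdiff h c l -> cdiff k (h c) l' ->
  cdiff (fun z => k (h z)) c (l' * l).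
Proof.
move=> hd kd e e0.
have [dl dl0 dlP] := cdiff_lip hd.
have L0 : 0 < cmod l + 1 by have := cmod_ge0 l; lra.
have L0' : 0 < cmod l' + 1 by have := cmod_ge0 l'; lra.
have e10 : 0 < e / 2 / (cmod l + 1) by rewrite !divr_gt0.
have e20 : 0 < e / 2 / (cmod l' + 1) by rewrite !divr_gt0.
have [d1 d10 d1P] := hd _ e20; have [d2 d20 d2P] := kd _ e10.
have [d3 d30 d3P] := cdiff_cont hd d20.
exists (Num.min dl (Num.min d1 d3)); first by rewrite !lt_min dl0 d10.
move=> a b; rewrite !lt_min => /andP [al /andP[a1 a3]] /andP [bl /andP[b1 b3]].
have -> : k (h b) - k (h a) - l' * l * (b - a) =
  (k (h b) - k (h a) - l' * (h b - h a)) + l' * (h b - h a - l * (b - a)) by ring.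
have A := d2P _ _ (d3P _ a3) (d3P _ b3).
have B := d1P _ _ a1 b1; have D := dlP _ _ al bl.
apply: le_trans (cmodD _ _) _; rewrite cmodM.
have A' : cmod (k (h b) - k (h a) - l' * (h b - h a)) <= e / 2 * cmod (b - a).
  apply: le_trans A _; rewrite -[leLHS]mulrA ler_pM2l ?divr_gt0 //.
  by rewrite mulrC ler_pdivrMr // mulrC.
have B' : cmod l' * cmod (h b - h a - l * (b - a)) <= e / 2 * cmod (b - a).
  apply: (@le_trans _ _ ((cmod l' + 1) * cmod (h b - h a - l * (b - a)))).
    by rewrite ler_wpM2r ?cmod_ge0 //; lra.
  by rewrite -ler_pdivlMl // mulrA [_^-1 * _]mulrC.
by lra.
Qed.

Lemma cdiff_sqr c : cdiff (fun z => z * z) c (2 * c).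
Proof.
move=> e e0; exists (e / 2); first by rewrite divr_gt0.
move=> a b ac bc.
have -> : b * b - a * a - 2 * c * (b - a) = ((a - c) + (b - c)) * (b - a) by ring.
by rewrite cmodM ler_wpM2r ?cmod_ge0 //; have := cmodD (a - c) (b - c); lra.
Qed.

Lemma cdiffZ v h c l : cdiff h c l -> cdiff (fun z => v * h z) c (v * l).
Proof.
move=> hd; have vd : cdiff (fun z => v * z) (h c) v.
  move=> e e0; exists 1 => // a b _ _.
  by rewrite mulrBr subrr cmod0 mulr_ge0 ?cmod_ge0 // ltW.
exact: cdiff_comp hd vd.
Qed.

Lemma cdiffM h k c l l' : cdiff h c l -> cdiff k c l' ->
  cdiff (fun z => h z * k z) c (l * k c + h c * l').
Proof.
(* By polarization the product reduces to the square. *)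
move=> hd kd.
have s1 := cdiff_comp (cdiffD hd kd) (@cdiff_sqr _).
have s2 := cdiff_comp (cdiffD hd (cdiffZ (-1) kd)) (@cdiff_sqr _).
have := cdiffD (cdiffZ 4^-1 s1) (cdiffZ (- 4^-1) s2).
have -> : 4^-1 * (2 * (h c + k c) * (l + l')) + - 4^-1 * (2 * (h c + -1 * k c) * (l + -1 * l'))
  = l * k c + h c * l' by field.
by apply: (@cdiff_near _ _ _ _ 1) => // z _; field.
Qed.

Lemma cdiffX h c l n : cdiff h c l -> exists l', cdiff (fun z => h z ^+ n) c l'.
Proof.
move=> hd; elim: n => [|n [l' IH]].
  by exists 0; apply: (cdiff_near ltr01 _ (cdiff_cst 1 c)) => z _; rewrite expr0.
exists (l * h c ^+ n + h c * l').
by apply: (cdiff_near ltr01 _ (cdiffM hd IH)) => z _; rewrite exprS.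
Qed.

Lemma cdiff_inv c : c != 0 -> cdiff (fun z => z^-1) c (- (c * c)^-1).
Proof.
move=> c0.
have m0 := cmod_gt0 c0; set m := cmod c in m0.
(* The first radius gives [m / 2 < |a|, |b|] and [|a| <= 2 m]. The numerator below is then at most
   [3 m] times the second radius, against a denominator of at least [m^4 / 4]. *)
move=> e e0; exists (Num.min (m / 2) (e * m ^+ 3 / 16)).
  by rewrite lt_min !divr_gt0 ?mulr_gt0 ?exprn_gt0.
move=> a b; rewrite !lt_min => /andP [a1 a2] /andP [b1 b2].
have Hm z : cmod (z - c) < m / 2 -> m / 2 < cmod z.
  by have := cmod_lowB c z; rewrite cmodC -/m; lra.
have nz z : cmod (z - c) < m / 2 -> z != 0.
  by move=> /Hm h; apply: contraTneq h => ->; rewrite cmod0 -leNgt divr_ge0 ?ltW.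
have a0 := nz _ a1; have b0 := nz _ b1.
have -> : b^-1 - a^-1 - - (c * c)^-1 * (b - a) =
   (a * b * (c * c))^-1 * (a * (b - c) + c * (a - c)) * (b - a) .
  by field; rewrite c0 a0 b0.
rewrite cmodM ler_wpM2r ?cmod_ge0 //.
rewrite cmodM cmodV !cmodM -/m.
have hA := Hm _ a1; have hB := Hm _ b1.
have Am : cmod a <= 2 * m by have := cmod_lowB a c; rewrite -/m; lra.
have hN := cmodD (a * (b - c)) (c * (a - c)); rewrite !cmodM -/m in hN.
have y0 := cmod_ge0 (b - c); have x0 := cmod_ge0 (a - c).
set A := cmod a in hA Am hN *; set B := cmod b in hB *.
set y := cmod (b - c) in b2 hN y0; set x := cmod (a - c) in a2 hN x0.
have p0 : 0 < A * B * (m * m) by rewrite !mulr_gt0 //; lra.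
rewrite mulrC ler_pdivrMr //.
apply: le_trans hN _.
have : A * y <= 2 * m * y by rewrite ler_wpM2r.
have : m * m / 4 <= A * B by nra.
move=> hAB hy.
have : e * (m * m / 4 * (m * m)) <= e * (A * B * (m * m)).
  by rewrite ler_pM2l // ler_wpM2r // mulr_ge0 ?ltW.
have : m * y <= m * (e * m ^+ 3 / 16) by rewrite ler_pM2l // ltW.
have : m * x <= m * (e * m ^+ 3 / 16) by rewrite ler_pM2l // ltW.
have : 0 <= e * m ^+ 4 by rewrite mulr_ge0 ?exprn_ge0 // ltW.
rewrite !exprS expr0 mulr1; lra.
Qed.

Lemma cdiffV h c l : h c != 0 -> cdiff h c l -> exists l', cdiff (fun z => (h z)^-1) c l'.
Proof. by move=> h0 hd; eexists; exact: cdiff_comp hd (cdiff_inv h0). Qed.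

End CDiff.

(** * Maximum principle and Schwarz lemmas *)

Section MaxPrinciple.
Variable R : realType.
Local Notation C := (Cplx R).
Implicit Types (h : C -> C) (c l z : C) (d e : R).

Lemma cmod_circle_sqr c (s : R) (w : C) : cmod w = 1 ->
  cmod (c + rc s * w) ^+ 2 = cmod c ^+ 2 + s ^+ 2 + 2 * s * complex.Re (Num.conj c * w).
Proof.
move=> w1; have : cmod w ^+ 2 = 1 by rewrite w1 expr1n.
rewrite !cmod_sqr cReD cImD !cReM !cImM cRe_rc cIm_rc cRe_conj cIm_conj => h.
have := congr1 (fun x => s ^+ 2 * x) h; lra.
Qed.

(* At an interior maximum of |h| + ep |z|^2 the discrete mean value of the     *)
(* second term exceeds its value at the centre by ep s^2.                      *)
Lemma max_principle h rho M : 0 < rho ->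
  (forall z, cmod z <= rho -> ccont h z) ->
  (forall z, cmod z < rho -> h z != 0 -> exists l, cdiff h z l) ->
  (forall z, cmod z = rho -> cmod (h z) <= M) ->
  forall z, cmod z <= rho -> cmod (h z) <= M.
Proof.
move=> rho0 hc hd hM z0 z0r; rewrite leNgt; apply/negP => Mz0.
have M0 : 0 <= M.
  by apply: le_trans (hM (rc rho) _); rewrite ?cmod_ge0 // cmod_rc gtr0_norm.
(* Small enough that the maximum of [u] exceeds [M + ep * rho ^+ 2], so that it lies neither on the
   circle nor at a zero of [h]. *)
pose ep := (cmod (h z0) - M) / 2 / rho ^+ 2.
have rho20 : 0 < rho ^+ 2 by rewrite exprn_gt0.
have ep0 : 0 < ep by rewrite !divr_gt0 // subr_gt0.
have epr : ep * rho ^+ 2 = (cmod (h z0) - M) / 2 by rewrite /ep divfK // gt_eqF.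
pose u z := cmod (h z) + ep * cmod z ^+ 2.
pose K := [set z : C | cmod (z - 0) <= rho].
have KE z : K z <-> cmod z <= rho by rewrite /K /= subr0.
have [c cK cmax] : exists2 c, cmod c <= rho & forall z, cmod z <= rho -> u z <= u c.
  have uc : {within K, continuous u}.
    apply: continuous_in_subspaceT => z /set_mem /KE zK P /nbhs_ballP [e /= e0 eP].
    apply/nbhs_cmod.
    have e20 : 0 < e / 2 by rewrite divr_gt0.
    have [d1 d10 d1P] := hc _ zK _ e20.
    have sqd := @cdiff_sqr R z; have [d2 d20 d2P] := cdiff_cont sqd (divr_gt0 e20 ep0).
    exists (Num.min d1 d2) => [|w]; first by rewrite lt_min d10.
    rewrite lt_min => /andP [/d1P w1 /d2P w2]; apply: eP.
    have eqn x : cmod x ^+ 2 = cmod (x * x) by rewrite cmodM expr2.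
    rewrite /ball /= ltr_norml /u !eqn.
    have := cmod_lowB (h z) (h w); have := cmod_lowB (h w) (h z).
    have := cmod_lowB (z * z) (w * w); have := cmod_lowB (w * w) (z * z).
    rewrite (cmodC (h z)) (cmodC (z * z)).
    move: w2; rewrite ltr_pdivlMr //.
    move: (cmod (w * w - z * z)) => t t0 h1 h2.
    have := ler_wpM2l (ltW ep0) h1; have := ler_wpM2l (ltW ep0) h2; lra.
  have K0 : K !=set0 by exists 0; apply/KE; rewrite cmod0 ltW.
  have [c /set_mem/KE cK cm] := compact_EVT_max K0 (@closed_disc_compact R 0 rho) uc.
  by exists c => // z zK; apply: cm; apply/mem_set/KE.
have uc : M + ep * rho ^+ 2 < u c.
  apply: lt_le_trans (cmax _ z0r).
  apply: (@lt_le_trans _ _ (cmod (h z0))); first by rewrite epr; lra.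
  by rewrite /u lerDl mulr_ge0 ?sqr_ge0 // ltW.
have cr2 : ep * cmod c ^+ 2 <= ep * rho ^+ 2.
  by rewrite ler_pM2l // ler_sqr ?nnegrE ?cmod_ge0 // ltW.
have cr : cmod c < rho.
  rewrite lt_neqAle cK andbT; apply/eqP => cE.
  by have := hM _ cE; move: uc; rewrite /u; lra.
have hcn : h c != 0.
  by apply/eqP => cE; move: uc; rewrite /u cE cmod0; lra.
have [s s0 sP] : exists2 s : R, 0 < s & forall a, cmod (a - c) <= s ->
    cmod a < rho /\ h a != 0.
  have [d d0 dP] := hc _ cK _ (cmod_gt0 hcn).
  exists (Num.min d (rho - cmod c) / 2); first by rewrite divr_gt0 // lt_min d0 subr_gt0.
  move=> a ac.
  have : cmod (a - c) < Num.min d (rho - cmod c).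
    apply: le_lt_trans ac _; rewrite ltr_pdivrMr // mulr_natr mulr2n ltrDl.
    by rewrite lt_min d0 subr_gt0.
  rewrite lt_min => /andP [/dP a1 a2]; split.
    by have := cmod_lowB a c; lra.
  by apply: contraTneq a1 => ->; rewrite sub0r cmodN ltxx.
have md a : cmod (a - c) <= s -> exists l, cdiff h a l.
  by move=> /sP [? ?]; exact: hd.
have e0 : 0 < ep * s ^+ 2 / 2 by rewrite divr_gt0 // mulr_gt0 // exprn_gt0.
have [N [w [N0 w1 wn1 wN wP]]] := mean_value s0 md e0.
have cw j : cmod (w ^+ j) = 1 by rewrite cmodX w1 expr1n.
have sw : \sum_(j < N) w ^+ j = 0.
  apply: (mulfI (_ : w - 1 != 0)); first by rewrite subr_eq0.
  by rewrite -subrX1 wN subrr mulr0.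
have su : \sum_(j < N) u (c + rc s * w ^+ j) <= N%:R * u c.
  apply: (@le_trans _ _ (\sum_(j < N) u c)); last first.
    by rewrite sumr_const card_ord [leRHS]mulr_natl.
  apply: ler_sum => j _; apply: cmax; apply/ltW; apply: (sP _ _).1.
  by rewrite addrC addKr cmodM cw mulr1 cmod_rc gtr0_norm.
(* The terms linear in [w ^+ j] cancel, which leaves the excess [s ^+ 2]. *)
have s2 : \sum_(j < N) cmod (c + rc s * w ^+ j) ^+ 2 = N%:R * (cmod c ^+ 2 + s ^+ 2).
  under eq_bigr do rewrite cmod_circle_sqr //.
  rewrite big_split /= sumr_const card_ord -mulr_sumr -cRe_sum -mulr_sumr sw mulr0 mulr0 addr0.
  by rewrite mulr_natl.
have s1 : N%:R * cmod (h c) <= \sum_(j < N) cmod (h (c + rc s * w ^+ j)) + N%:R * (ep * s ^+ 2 / 2).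
  have := cmod_lowB (N%:R * h c) (\sum_(j < N) h (c + rc s * w ^+ j)).
  rewrite cmodC cmodM cmod_nat.
  have := cmod_sum (index_enum 'I_N) xpredT (fun j : 'I_N => h (c + rc s * w ^+ j)).
  by move: wP; lra.
move: su; rewrite /u big_split /= -mulr_sumr s2.
have N0' : 0 < (N%:R : R) by rewrite ltr0n.
have : 0 < N%:R * (ep * s ^+ 2) := mulr_gt0 N0' (mulr_gt0 ep0 (exprn_gt0 2 s0)).
move: s1; lra.
Qed.

(* The exceptional zeros of [P] are removable: apply the maximum principle to *)
(* [h ^ k * P] and let [k] tend to infinity.                                  *)
Lemma max_principle_removable h (P : C -> C) rho rho1 M B : 0 < rho -> rho < rho1 ->
  (forall z, cmod z < rho1 -> exists l, cdiff P z l) ->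
  (forall z, cmod z < rho1 -> cmod (P z) <= 1) ->
  (forall z, cmod z < rho1 -> P z != 0 -> exists l, cdiff h z l) ->
  (forall z, cmod z < rho1 -> cmod (h z) <= B) ->
  (forall z, cmod z = rho -> cmod (h z) <= M) ->
  forall z, cmod z <= rho -> P z != 0 -> cmod (h z) <= M.
Proof.
move=> rho0 rho1r Pd P1 hd hB hM z0 z0r Pz0.
have M0 : 0 <= M.
  by apply: le_trans (hM (rc rho) _); rewrite ?cmod_ge0 // cmod_rc gtr0_norm.
have B0 : 0 <= B by apply: le_trans (hB z0 _); rewrite ?cmod_ge0 //; lra.
have key k : cmod (h z0) ^+ k * cmod (P z0) <= M ^+ k.
  rewrite -cmodX -cmodM.
  apply: (@max_principle (fun z => h z ^+ k * P z) rho) => // z zr.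
  (* At a zero of [P] the product is continuous because [P] tends to 0 and the power of [h] is
     bounded. *)
  - have [Pz|Pz] := eqVneq (P z) 0; last first.
      have z1 : cmod z < rho1 by lra.
      have [l hl] := hd _ z1 Pz; have [l' Pl] := Pd _ z1.
      have [l'' hkl] := cdiffX k hl.
      exact: cdiff_cont (cdiffM hkl Pl).
    move=> e e0; have z1 : cmod z < rho1 by lra.
    have [l' Pl] := Pd _ z1.
    have Bk : 0 < B ^+ k + 1 by have := exprn_ge0 k B0; lra.
    have [d d0 dP] := cdiff_cont Pl (divr_gt0 e0 Bk).
    exists (Num.min d (rho1 - cmod z)); first by rewrite lt_min d0 subr_gt0.
    move=> w; rewrite lt_min Pz mulr0 subr0 => /andP [/dP]; rewrite Pz subr0 => Pw wz.
    have w1 : cmod w < rho1 by have := cmod_lowB w z; lra.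
    rewrite cmodM cmodX; apply: (@le_lt_trans _ _ ((B ^+ k + 1) * cmod (P w))).
      rewrite ler_wpM2r ?cmod_ge0 //.
      apply: (@le_trans _ _ (B ^+ k)); last by lra.
      by rewrite lerXn2r ?nnegrE ?cmod_ge0 //; exact: hB.
    by rewrite mulrC -ltr_pdivlMr.
  - move=> hz; have Pz : P z != 0 by apply: contraNneq hz => ->; rewrite mulr0.
    have z1 : cmod z < rho1 by lra.
    have [l hl] := hd _ z1 Pz; have [l' Pl] := Pd _ z1.
    have [l'' hkl] := cdiffX k hl.
    by eexists; exact: cdiffM hkl Pl.
  - rewrite cmodM cmodX -[leRHS]mulr1 ler_pM ?exprn_ge0 ?cmod_ge0 //.
      by rewrite lerXn2r ?nnegrE ?cmod_ge0 //; exact: hM.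
    by apply: P1; lra.
rewrite leNgt; apply/negP => hz0.
have p0 : 0 < cmod (P z0) by exact: cmod_gt0.
have [M00|Mn0] := eqVneq M 0.
  have := key 1%N; rewrite !expr1 M00 leNgt mulr_gt0 //.
  by rewrite -M00.
have Mp : 0 < M by rewrite lt_neqAle eq_sym Mn0.
(* Now [q ^+ k * |P z0| <= 1] for all [k] with [q > 1] and [P z0] nonzero, against Bernoulli's
   inequality. *)
pose q := cmod (h z0) / M.
have q1 : 1 < q by rewrite ltr_pdivlMr // mul1r.
have keyq k : q ^+ k * cmod (P z0) <= 1.
  rewrite expr_div_n mulrAC ler_pdivrMr ?mul1r; first exact: key.
  by rewrite exprn_gt0.
have bern k : 1 + k%:R * (q - 1) <= q ^+ k.
  elim: k => [|k IH]; first by rewrite mul0r addr0 expr0.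
  rewrite exprS -natr1.
  have : 0 <= k%:R * (q - 1) by rewrite mulr_ge0 ?ler0n //; lra.
  by move: IH; nra.
pose k := (Num.trunc ((cmod (P z0))^-1 / (q - 1))).+1.
have : (cmod (P z0))^-1 / (q - 1) < k%:R by rewrite truncnS_gt.
rewrite ltr_pdivrMr ?subr_gt0 // => kP.
have := keyq k; rewrite -ler_pdivlMr // div1r.
by have := bern k; lra.
Qed.

End MaxPrinciple.

Section Schwarz.
Variable R : realType.
Local Notation C := (Cplx R).
Implicit Types (h g Q : C -> C) (c l z : C) (d e : R).

Lemma le_limit (x y k : R) : (forall e, 0 < e -> e <= 1 -> x <= y + e * k) -> x <= y.
Proof.
move=> H; rewrite leNgt; apply/negP => yx.
have k0 : 0 < `|k| + 1 by have := normr_ge0 k; lra.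
pose e := Num.min 1 ((x - y) / 2 / (`|k| + 1)).
have e0 : 0 < e by rewrite lt_min ltr01 !divr_gt0 // subr_gt0.
have := H e e0; rewrite ge_min lexx /= => /(_ isT).
have : e * (`|k| + 1) <= (x - y) / 2 by rewrite -ler_pdivlMr // ge_min lexx orbT.
have : e * k <= e * (`|k| + 1).
  by rewrite ler_pM2l //; have := ler_norm k; lra.
lra.
Qed.

(* The divided difference of Q at a is bounded, with removable singularities   *)
(* at a and at 0, where Q is merely continuous.                                *)
Lemma schwarz_lip Q rho M : 0 < rho -> Q 0 = 0 -> ccont Q 0 ->
  (forall z, z != 0 -> cmod z < rho -> exists l, cdiff Q z l) ->
  (forall z, cmod z < rho -> cmod (Q z) <= M) ->
  forall a, a != 0 -> cmod a < rho / 4 -> cmod (Q a) <= 8 * M / rho * cmod a.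
Proof.
move=> rho0 Q0 Qc Qd QM a a0 ar.
have M0 : 0 <= M by rewrite (le_trans (cmod_ge0 _) (QM 0 _)) // cmod0.
pose h z := (Q z - Q a) * (z - a)^-1.
pose k : C := (rc (2 * rho ^+ 2))^-1.
have rho2 : 0 < 2 * rho ^+ 2 by rewrite mulr_gt0 // exprn_gt0.
have kn0 : k != 0 by rewrite invr_eq0 rc_eq0 gt_eqF.
(* [P] vanishes exactly at the two exceptional points, and [k] keeps its modulus at most 1 on the
   disc. *)
pose P z := k * (z * (z - a)).
have subd v z : cdiff (fun z => z - v) z 1.
  have := cdiffD (cdiff_id z) (cdiff_cst (- v) z); rewrite addr0; exact.
have Pd z : exists l, cdiff P z l.
  by eexists; exact: cdiffZ (cdiffM (cdiff_id z) (subd a z)).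
have P1 z : cmod z < rho -> cmod (P z) <= 1.
  move=> zr; rewrite !cmodM cmodV cmod_rc gtr0_norm // mulrC ler_pdivrMr // mul1r.
  have : cmod (z - a) <= 2 * rho by have := cmodB z a; lra.
  move=> h1; rewrite (_ : 2 * rho ^+ 2 = rho * (2 * rho)); last by ring.
  by rewrite ler_pM ?cmod_ge0 // ltW.
have Pn0 z : P z != 0 -> z != 0 /\ z - a != 0.
  by rewrite !mulf_eq0 !negb_or => /and3P [].
have hd z : cmod z < rho -> P z != 0 -> exists l, cdiff h z l.
  move=> zr /Pn0 [z0 za].
  have [l Ql] := Qd _ z0 zr.
  have [l' Vl] := @cdiffV _ (fun z => z - a) z 1 za (subd a z).
  by eexists; exact: cdiffM (cdiffD Ql (cdiff_cst (- Q a) z)) Vl.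
have ar' : cmod a < rho by lra.
have [B hB] : exists B, forall z, cmod z < rho -> cmod (h z) <= B.
  have [l Ql] := Qd _ a0 ar'.
  have [d d0 dP] := cdiff_lip Ql.
  exists (Num.max (cmod l + 1) (2 * M / d)) => z zr.
  have [->|za] := eqVneq z a.
    by rewrite /h subrr mul0r cmod0 le_max; have := cmod_ge0 l; lra.
  have za0 : 0 < cmod (z - a) by rewrite cmod_gt0 // subr_eq0.
  rewrite /h cmodM cmodV.
  have [zd|zd] := ltP (cmod (z - a)) d.
    rewrite le_max ler_pdivrMr // dP //.
    by rewrite subrr cmod0.
  rewrite le_max; apply/orP; right.
  rewrite ler_pM ?cmod_ge0 ?invr_ge0 ?cmod_ge0 //.
    by have := cmodB (Q z) (Q a); have := QM _ zr; have := QM _ ar'; lra.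
  by rewrite lef_pV2 ?posrE.
have rho20 : 0 < rho / 2 by rewrite divr_gt0.
have rho21 : rho / 2 < rho by lra.
(* On this circle [|z - a| >= rho / 4], and the numerator is at most [2 * M]. *)
have hM z : cmod z = rho / 2 -> cmod (h z) <= 8 * M / rho.
  move=> zr; rewrite /h cmodM cmodV (_ : 8 * M / rho = (2 * M) * (rho / 4)^-1); last first.
    by rewrite invfM invrK; field; rewrite gt_eqF.
  have za : rho / 4 <= cmod (z - a) by have := cmod_lowB z a; lra.
  rewrite ler_pM ?cmod_ge0 ?invr_ge0 ?cmod_ge0 //.
    have zr' : cmod z < rho by lra.
    by have := cmodB (Q z) (Q a); have := QM _ zr'; have := QM _ ar'; lra.
  by rewrite lef_pV2 ?posrE //; lra.
have K0 : 0 <= 8 * M / rho by rewrite divr_ge0 ?mulr_ge0 // ltW.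
have key z : z != 0 -> z != a -> cmod z <= rho / 2 ->
    cmod (Q z - Q a) <= 8 * M / rho * cmod (z - a).
  move=> z0 za zr.
  have za0 : 0 < cmod (z - a) by rewrite cmod_gt0 // subr_eq0.
  have Pz : P z != 0 by rewrite !mulf_neq0 // subr_eq0.
  have := max_principle_removable rho20 rho21 (fun z _ => Pd z) P1 hd hB hM zr Pz.
  by rewrite /h cmodM cmodV ler_pdivrMr.
(* Apply [key] at a small positive real [x] and let [x] tend to 0, where [Q] is continuous with
   value 0. *)
apply: (@le_limit _ _ (8 * M / rho + 1)) => e e0 _.
have [d d0 dP] := Qc _ e0.
pose x := Num.min (Num.min e d) (cmod a) / 2.
have x0 : 0 < x by rewrite divr_gt0 // !lt_min e0 d0 cmod_gt0.
have : Num.min (Num.min e d) (cmod a) = 2 * x by rewrite /x mulrC divfK.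
move/esym => xE.
have : 2 * x <= Num.min (Num.min e d) (cmod a) by rewrite xE.
rewrite !le_min => /andP [/andP [xe xd] xa].
have cx : cmod (rc x) = x by rewrite cmod_rc gtr0_norm.
have h1 := dP (rc x); rewrite subr0 Q0 subr0 cx in h1.
have {}h1 : cmod (Q (rc x)) < e by apply: h1; lra.
have h2 : cmod (Q (rc x) - Q a) <= 8 * M / rho * cmod (rc x - a).
  apply: key; last by rewrite cx; lra.
    by rewrite rc_eq0 gt_eqF.
  by apply/eqP => E; move: xa; rewrite -E cx; lra.
have h3 : cmod (Q a) <= cmod (Q (rc x)) + cmod (Q (rc x) - Q a).
  by have := cmod_lowB (Q a) (Q (rc x)); rewrite cmodC; lra.
have h4 : 8 * M / rho * cmod (rc x - a) <= 8 * M / rho * (e + cmod a).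
  by rewrite ler_wpM2l //; have := cmodB (rc x) a; rewrite cx; lra.
by lra.
Qed.

(** The quotient [Q z / z] is bounded near 0 by [schwarz_lip], so the maximum principle with a
    removable singularity applies on circles of radius [r < rho]; then [r] tends to [rho]. Mere
    continuity of [Q] at 0 suits the divided difference in [psi_shrink]. *)
Lemma schwarz Q rho M : 0 < rho -> Q 0 = 0 -> ccont Q 0 ->
  (forall z, z != 0 -> cmod z < rho -> exists l, cdiff Q z l) ->
  (forall z, cmod z < rho -> cmod (Q z) <= M) ->
  forall z, cmod z < rho -> cmod (Q z) <= M * cmod z / rho.
Proof.
move=> rho0 Q0 Qc Qd QM z zr.
have M0 : 0 <= M by rewrite (le_trans (cmod_ge0 _) (QM 0 _)) // cmod0.
have [->|z0] := eqVneq z 0; first by rewrite Q0 cmod0 mulr0 mul0r.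
have lipQ := schwarz_lip rho0 Q0 Qc Qd QM.
pose h z := Q z * z^-1.
pose k : C := (rc rho)^-1.
have kn0 : k != 0 by rewrite invr_eq0 rc_eq0 gt_eqF.
pose P z := k * z.
have Pd w : exists l, cdiff P w l by eexists; exact: cdiffZ (cdiff_id w).
have P1 w : cmod w < rho -> cmod (P w) <= 1.
  by move=> wr; rewrite cmodM cmodV cmod_rc gtr0_norm // mulrC ler_pdivrMr // mul1r ltW.
have Pn0 w : (P w != 0) = (w != 0) by rewrite mulf_eq0 (negPf kn0).
have hd w : cmod w < rho -> P w != 0 -> exists l, cdiff h w l.
  rewrite Pn0 => wr w0; have [l Ql] := Qd _ w0 wr.
  by eexists; exact: cdiffM Ql (cdiff_inv w0).
have hB w : cmod w < rho -> cmod (h w) <= Num.max (8 * M / rho) (M / (rho / 4)).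
  move=> wr; rewrite /h cmodM cmodV.
  have [->|w0] := eqVneq w 0.
    by rewrite cmod0 invr0 mulr0 le_max !divr_ge0 ?mulr_ge0 // ltW.
  have w0' := cmod_gt0 w0.
  rewrite le_max; have [ws|ws] := ltP (cmod w) (rho / 4).
    by rewrite ler_pdivrMr // lipQ.
  apply/orP; right; rewrite ler_pM ?cmod_ge0 ?invr_ge0 ?cmod_ge0 //; first exact: QM.
  by rewrite lef_pV2 ?posrE // divr_gt0.
have z0' := cmod_gt0 z0.
have key r : cmod z <= r -> r < rho -> r * cmod (Q z) <= M * cmod z.
  move=> zr' rr; have r0 : 0 < r by lra.
  have hM w : cmod w = r -> cmod (h w) <= M / r.
    move=> wr; rewrite cmodM cmodV wr ler_pM2r ?invr_gt0 //.
    by apply: QM; rewrite wr.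
  have Pz : P z != 0 by rewrite Pn0.
  have := max_principle_removable r0 rr (fun z _ => Pd z) P1 hd hB hM zr' Pz.
  by rewrite cmodM cmodV ler_pdivlMr // mulrC mulrA ler_pdivrMr.
rewrite ler_pdivlMr // mulrC.
apply: (@le_limit _ _ ((rho - cmod z) * cmod (Q z))) => e e0 e1.
have : 0 < e * (rho - cmod z) by rewrite mulr_gt0 // subr_gt0.
have : e * (rho - cmod z) <= rho - cmod z.
  by rewrite -[leRHS]mul1r ler_wpM2r // subr_ge0 ltW.
move=> h1 h2.
have := key (rho - e * (rho - cmod z)); rewrite mulrBl -[e * _ * _]mulrA lerBlDr.
by apply; lra.
Qed.

(** Schwarz lemma for the Cayley transform [(g - g 0) / (g + conj (g 0))]. As the real part of [g]
    may vanish, [g] is first replaced by [g + e], which adds [2 * e] to the denominator, and [e]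
    tends to 0. *)
Lemma schwarz_pick_halfplane g : (forall z, cmod z < 1 -> exists l, cdiff g z l) ->
  (forall z, cmod z < 1 -> 0 <= complex.Re (g z)) ->
  forall z, cmod z < 1 ->
    cmod (g z - g 0) <= cmod z * cmod (g z + Num.conj (g 0)).
Proof.
move=> gd gR z z1.
apply: (@le_limit _ _ (cmod z * 2)) => e e0 _.
pose den w := g w + (Num.conj (g 0) + rc (2 * e)).
have dRe w : cmod w < 1 -> 0 < complex.Re (den w).
  move=> w1; rewrite /den !cReD cRe_conj cRe_rc.
  have := gR _ w1; have : 0 <= complex.Re (g 0) by apply: gR; rewrite cmod0.
  by lra.
have den0 w : cmod w < 1 -> den w != 0.
  by move=> /dRe; apply: contraTneq => ->; rewrite ltxx.
pose G w := (g w - g 0) * (den w)^-1.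
have Gd w : cmod w < 1 -> exists l, cdiff G w l.
  move=> w1; have [l gl] := gd _ w1.
  have [l' dl] := cdiffV (den0 _ w1) (cdiffD gl (cdiff_cst (Num.conj (g 0) + rc (2 * e)) w)).
  by eexists; exact: cdiffM (cdiffD gl (cdiff_cst (- g 0) w)) dl.
have cm01 : cmod (0 : C) < 1 by rewrite cmod0.
have [l0 Gl0] := Gd _ cm01.
have G1 w : cmod w < 1 -> cmod (G w) <= 1.
  move=> w1; rewrite cmodM cmodV ler_pdivrMr ?cmod_gt0 ?den0 // mul1r.
  rewrite -ler_sqr ?nnegrE ?cmod_ge0 // !cmod_sqr !cReD !cImD !cReN !cImN cRe_conj cIm_conj cRe_rc cIm_rc.
  have := gR _ w1; have : 0 <= complex.Re (g 0) by apply: gR; rewrite cmod0.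
  by nra.
have := schwarz ltr01 _ (cdiff_cont Gl0) (fun w _ => @Gd w) G1 z1.
rewrite {1}/G subrr mul0r => /(_ erefl).
rewrite mul1r divr1 /G cmodM cmodV ler_pdivrMr ?cmod_gt0 ?den0 // => H.
apply: le_trans H _; rewrite mulrCA -mulrDr ler_wpM2l ?cmod_ge0 //.
have -> : den z = g z + Num.conj (g 0) + rc (2 * e) by rewrite /den addrA.
apply: le_trans (cmodD _ _) _.
by rewrite cmod_rc gtr0_norm; lra.
Qed.

(* Julia's boundary lemma: the Schwarz-Pick inequality at 1 - x, divided by x, *)
(* as x tends to 0.                                                            *)
Lemma julia_halfplane g : (forall z, cmod z < 1 -> exists l, cdiff g z l) ->
  (forall z, cmod z < 1 -> 0 <= complex.Re (g z)) ->
  (forall e, 0 < e -> exists2 d, 0 < d & forall x, 0 < x -> x < d ->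
     cmod (g (rc (1 - x)) - rc x) <= e * x) ->
  cmod (g 0 - 1) <= 1.
Proof.
move=> gd gR gb.
set a := g 0.
have a0 : 0 <= complex.Re a by apply: gR; rewrite cmod0.
(* The disc [|a - 1| <= 1] is the set [|a|^2 <= 2 Re a]. *)
suff H : 2 * cmod a ^+ 2 <= 4 * complex.Re a.
  rewrite -(@ler_sqr _ _ 1) ?nnegrE ?cmod_ge0 // expr1n.
  move: H; rewrite !cmod_sqr cReD cImD cReN cImN /=; nra.
apply: (@le_limit _ _ (4 * cmod a + cmod a ^+ 2)) => e e0 e1.
have [d d0 dP] := gb _ e0.
pose x := Num.min d e / 2.
have x0 : 0 < x by rewrite divr_gt0 // lt_min d0.
have xE : Num.min d e = 2 * x by rewrite /x mulrC divfK.
have : 2 * x <= Num.min d e by rewrite xE.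
clearbody x; rewrite le_min => /andP [xd xe].
have {}xd : x < d by lra.
have cx : cmod (rc (1 - x)) = 1 - x by rewrite cmod_rc ger0_norm; lra.
have x1 : cmod (rc (1 - x)) < 1 by rewrite cx; lra.
have P := schwarz_pick_halfplane gd gR x1; rewrite cx in P.
have Y := dP _ x0 xd.
set y := g (rc (1 - x)) in P Y.
have {}P : cmod (y - a) ^+ 2 <= (1 - x) ^+ 2 * cmod (y + Num.conj a) ^+ 2.
  by rewrite -exprMn ler_sqr ?nnegrE ?mulr_ge0 ?cmod_ge0 //; lra.
have A1 := le_trans (cRe_le_cmod (Num.conj a * (y - rc x))) (_ : _ <= cmod a * (e * x)).
have {}A1 : `|complex.Re (Num.conj a * (y - rc x))| <= cmod a * (e * x).
  by apply: A1; rewrite cmodM cmod_conj ler_wpM2l ?cmod_ge0.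
have A2 : `|complex.Re (a * (y - rc x))| <= cmod a * (e * x).
  by apply: le_trans (cRe_le_cmod _) _; rewrite cmodM ler_wpM2l ?cmod_ge0.
move: P A1 A2; rewrite !ler_norml !cmod_sqr !cReM !cReD !cImD !cReN !cImN cRe_conj cIm_conj.
rewrite cRe_rc cIm_rc.
have ca : cmod a ^+ 2 = complex.Re a ^+ 2 + complex.Im a ^+ 2 by rewrite cmod_sqr.
move: (complex.Re a) (complex.Im a) (complex.Re y) (complex.Im y) a0 ca.
have := cmod_ge0 a; move: (cmod a) => A A0 p q u v p0 ca P /andP [_ A1] /andP [_ A2].
pose w := (1 - x) ^+ 2.
have w1 : w <= 1 by rewrite /w expr_le1 //; lra.
have w0 : 0 <= w by exact: sqr_ge0.
have wE : 1 - w = x * (2 - x) by rewrite /w; ring.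
rewrite -/w in P; clearbody w.
have B1 : p * u + q * v <= x * (p + A * e) by lra.
have B2 : w * (p * u - q * v) <= x * (p + A * e).
  have : w * (p * u - q * v) <= w * (x * (p + A * e)) by rewrite ler_wpM2l //; lra.
  have : 0 <= x * (p + A * e) by rewrite mulr_ge0 ?addr_ge0 ?mulr_ge0 ?(ltW x0) ?(ltW e0).
  nra.
have B3 : 0 <= (1 - w) * (u ^+ 2 + v ^+ 2).
  by apply: mulr_ge0; [lra | rewrite addr_ge0 ?sqr_ge0].
(* The expanded Schwarz-Pick inequality. Since [1 - w = x * (2 - x)], division by [x] leaves
   [(2 - x) * |a|^2 <= 4 * (Re a + e * |a|)]. *)
have B4 : (1 - w) * A ^+ 2 <= 4 * (x * (p + A * e)).
  rewrite ca; move: P; lra.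
rewrite wE -mulrA [4 * _]mulrCA ler_pM2l // in B4.
have : x * A ^+ 2 <= e * A ^+ 2 by rewrite ler_wpM2r ?sqr_ge0 //; lra.
rewrite -ca; lra.
Qed.

End Schwarz.

(** * Hermitian vectors and strictly differentiable maps *)

Section Vectors.
Variables (R : realType) (n : nat).
Local Notation C := (Cplx R).
Implicit Types (u v w z : 'rV[C]_n) (k : C) (M : 'M[C]_n).

Definition dot u v : C := \sum_t u 0 t * Num.conj (v 0 t).

Lemma cnorm_sqr z : cnorm z ^+ 2 = \sum_t cmod (z 0 t) ^+ 2.
Proof.
rewrite /cnorm sqr_sqrtr; first by apply: eq_bigr => t _; rewrite cmod_sqr.
by rewrite sumr_ge0 // => t _; rewrite addr_ge0 ?sqr_ge0.
Qed.

Lemma cnorm_ge0 z : 0 <= cnorm z.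
Proof. exact: sqrtr_ge0. Qed.

Lemma dotvv z : dot z z = rc (cnorm z ^+ 2).
Proof.
rewrite cnorm_sqr /dot /rc (rmorph_sum (real_complex R)).
by apply: eq_bigr => t _; exact: mul_conj.
Qed.

Lemma dotDl u v w : dot (u + v) w = dot u w + dot v w.
Proof. by rewrite /dot -big_split; apply: eq_bigr => t _; rewrite mxE mulrDl. Qed.
Lemma dotZl k u w : dot (k *: u) w = k * dot u w.
Proof. by rewrite /dot mulr_sumr; apply: eq_bigr => t _; rewrite mxE mulrA. Qed.
Lemma dotNl u w : dot (- u) w = - dot u w.
Proof. by rewrite -scaleN1r dotZl mulN1r. Qed.
Lemma dotC u v : dot v u = Num.conj (dot u v).
Proof.
rewrite /dot rmorph_sum; apply: eq_bigr => t _.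
by rewrite rmorphM /= conjCK mulrC.
Qed.
Lemma dotZr k u w : dot u (k *: w) = Num.conj k * dot u w.
Proof. by rewrite dotC dotZl rmorphM /= -dotC. Qed.

Lemma cnormZ k z : cnorm (k *: z) = cmod k * cnorm z.
Proof.
apply/eqP; rewrite -(@eqrXn2 _ 2) ?mulr_ge0 ?cnorm_ge0 ?cmod_ge0 //.
rewrite exprMn !cnorm_sqr mulr_sumr; apply/eqP/eq_bigr => t _.
by rewrite mxE cmodM exprMn.
Qed.

Lemma cnorm0 : cnorm (0 : 'rV[C]_n) = 0.
Proof. by rewrite -(scale0r 0) cnormZ cmod0 mul0r. Qed.

Lemma cnormN z : cnorm (- z) = cnorm z.
Proof. by rewrite -scaleN1r cnormZ cmodN cmod1 mul1r. Qed.

Lemma cnorm_eq0 z : cnorm z = 0 -> z = 0.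
Proof.
move=> z0; apply/rowP => t; rewrite mxE; apply: cmod_eq0.
have := cnorm_sqr z; rewrite z0 expr0n /= => /esym /eqP.
rewrite psumr_eq0 => [/allP /(_ t)|i _]; last by rewrite sqr_ge0.
by rewrite mem_index_enum => /(_ isT); rewrite /= sqrf_eq0 => /eqP.
Qed.

Lemma cnorm_gt0 z : z != 0 -> 0 < cnorm z.
Proof.
move=> z0; rewrite lt_neqAle cnorm_ge0 andbT.
by apply: contra z0 => /eqP/esym/cnorm_eq0 ->.
Qed.

(** Cauchy-Schwarz, from the squared norm of [|v|^2 u - <u, v> v]. *)
Lemma dot_le u v : cmod (dot u v) <= cnorm u * cnorm v.
Proof.
have [->|v0] := eqVneq v 0.
  by rewrite cnorm0 mulr0 -(scale0r 0) dotZr rmorph0 mul0r cmod0.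
have N0 := cnorm_gt0 v0; set b := cnorm v in N0 *.
rewrite -ler_sqr ?nnegrE ?cmod_ge0 ?mulr_ge0 ?cnorm_ge0 //.
have : 0 <= cnorm (rc (b ^+ 2) *: u - dot u v *: v) ^+ 2 by exact: sqr_ge0.
have -> : cnorm (rc (b ^+ 2) *: u - dot u v *: v) ^+ 2 =
    b ^+ 2 * (b ^+ 2 * cnorm u ^+ 2 - cmod (dot u v) ^+ 2).
  have inj : injective (@rc R) by exact: (fmorph_inj (real_complex R)).
  apply: inj; rewrite -dotvv rcM rcB -mul_conj rcM -dotvv.
  rewrite dotDl dotNl !dotZl ![dot _ (_ - _)]dotC !dotDl !dotNl !dotZl.
  rewrite !rmorphB !rmorphM /= -!dotC dotvv -/b.
  have -> : Num.conj (rc (b ^+ 2)) = rc (b ^+ 2).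
    by apply: CeqP; rewrite ?cRe_conj ?cIm_conj //= oppr0.
  rewrite [dot v v]dotvv -/b; ring.
rewrite pmulr_rge0 ?exprn_gt0 // subr_ge0 exprMn mulrC; exact.
Qed.

Lemma cnormD u v : cnorm (u + v) <= cnorm u + cnorm v.
Proof.
rewrite -ler_sqr ?nnegrE ?addr_ge0 ?cnorm_ge0 //.
have E : cnorm (u + v) ^+ 2 = cnorm u ^+ 2 + cnorm v ^+ 2 + 2 * complex.Re (dot u v).
  have h w : cnorm w ^+ 2 = complex.Re (dot w w) by rewrite dotvv.
  rewrite !h dotDl ![dot _ (u + v)]dotC !dotDl !rmorphD /= -!dotC !cReD.
  by rewrite (dotC u v) cRe_conj; ring.
rewrite E sqrrD; have := dot_le u v; have := cRe_le_cmod (dot u v).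
by rewrite ler_norml => /andP [_ h1] h2; lra.
Qed.

Lemma cnormB u v : cnorm (u - v) <= cnorm u + cnorm v.
Proof. by rewrite -[cnorm v]cnormN cnormD. Qed.

Lemma cnormC u v : cnorm (u - v) = cnorm (v - u).
Proof. by rewrite -cnormN opprB. Qed.

Lemma cnorm_lowB u v : cnorm u - cnorm v <= cnorm (u - v).
Proof. by rewrite lerBlDr; apply: le_trans (cnormD _ _); rewrite subrK. Qed.

Lemma coord_le_cnorm z t : cmod (z 0 t) <= cnorm z.
Proof.
rewrite -ler_sqr ?nnegrE ?cmod_ge0 ?cnorm_ge0 // cnorm_sqr (bigD1 t) //= lerDl.
by rewrite sumr_ge0 // => i _; exact: sqr_ge0.
Qed.

Lemma cnorm_sum (I : Type) (r : seq I) (P : pred I) (F : I -> 'rV[C]_n) :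
  cnorm (\sum_(i <- r | P i) F i) <= \sum_(i <- r | P i) cnorm (F i).
Proof.
elim/big_rec2: _ => [|i a b _ ab]; first by rewrite cnorm0.
by apply: le_trans (cnormD _ _) _; rewrite lerD2l.
Qed.

Lemma cnorm_delta t : cnorm (delta_mx 0 t : 'rV[C]_n) = 1.
Proof.
apply/eqP; rewrite -(@eqrXn2 _ 2) ?cnorm_ge0 // expr1n cnorm_sqr (bigD1 t) //= big1.
  by rewrite mxE !eqxx cmod1 expr1n addr0.
by move=> i it; rewrite mxE (negPf it) andbF cmod0 expr0n.
Qed.

Lemma cnorm_le_sum z : cnorm z <= \sum_t cmod (z 0 t).
Proof.
rewrite {1}[z]row_sum_delta; apply: le_trans (cnorm_sum _ _ _) _.
by apply: ler_sum => t _; rewrite cnormZ cnorm_delta mulr1.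
Qed.

(** A crude bound for the operator norm of [v -> v *m M]; matrices act on row vectors from the right
    throughout. *)
Definition opbound M : R := \sum_s \sum_t cmod (M t s).

Lemma opbound_ge0 M : 0 <= opbound M.
Proof. by apply: sumr_ge0 => s _; apply: sumr_ge0 => t _; exact: cmod_ge0. Qed.

Lemma cnorm_mulmx v M : cnorm (v *m M) <= opbound M * cnorm v.
Proof.
apply: le_trans (cnorm_le_sum _) _; rewrite mulr_suml; apply: ler_sum => s _.
rewrite mxE mulr_suml; apply: le_trans (cmod_sum _ _ _) _; apply: ler_sum => t _.
by rewrite cmodM mulrC ler_wpM2l ?cmod_ge0 ?coord_le_cnorm.
Qed.

Lemma nbhs_cnorm (P : set 'rV[C]_n) (c : 'rV[C]_n) :
  nbhs c P <-> exists2 d : R, 0 < d & forall z, cnorm (z - c) < d -> P z.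
Proof.
split=> [/nbhs_ballP [e /= e0 eP]|[d d0 dP]].
  have eR : e = rc (complex.Re e) by rewrite /rc RRe_real // gtr0_real.
  have e0' : 0 < complex.Re e by move: e0; rewrite eR ltcR.
  exists (complex.Re e) => // z zc; apply: eP; split => // i j.
  rewrite -ball_normE /= distrC normE eR ltcR (ord1 i).
  have -> : z 0 j - c 0 j = (z - c) 0 j by rewrite !mxE.
  by apply: le_lt_trans zc; exact: coord_le_cnorm.
(* With [n.+1] in place of [n], the [n] coordinates add up to strictly less than [d], also when
   [n = 0]. *)
apply/nbhs_ballP; exists (rc (d / n.+1%:R)).
  by rewrite /= ltcR divr_gt0 // ltr0n.
move=> z zc; apply: dP; apply: le_lt_trans (cnorm_le_sum _) _.
apply: (@le_lt_trans _ _ (\sum_(t < n) (d / n.+1%:R))).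
  apply: ler_sum => t _; have := zc.2 0 t.
  by rewrite -ball_normE /= distrC normE ltcR !mxE => /ltW.
rewrite sumr_const card_ord -[ltLHS]mulr_natl mulrCA gtr_pMr // ltr_pdivrMr ?ltr0n //.
by rewrite mul1r ltr_nat.
Qed.

End Vectors.

Section StrictDiff.
Variables (R : realType) (n : nat).
Local Notation C := (Cplx R).
Local Notation V := 'rV[C]_n.
Implicit Types (u v w z : V) (c k : C) (M : 'M[C]_n) (g : V -> V) (p : C -> V) (d e : R).

Definition vdiff p c v := forall e, 0 < e -> exists2 d, 0 < d & forall a b,
  cmod (a - c) < d -> cmod (b - c) < d ->
  cnorm (p b - p a - (b - a) *: v) <= e * cmod (b - a).

Definition mdiff g z M := forall e, 0 < e -> exists2 d, 0 < d & forall a b,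
  cnorm (a - z) < d -> cnorm (b - z) < d ->
  cnorm (g b - g a - (b - a) *m M) <= e * cnorm (b - a).

Lemma vdiff_lip p c v : vdiff p c v -> exists2 d, 0 < d & forall a b,
  cmod (a - c) < d -> cmod (b - c) < d -> cnorm (p b - p a) <= (cnorm v + 1) * cmod (b - a).
Proof.
move=> /(_ _ ltr01) [d d0 dP]; exists d => // a b ac bc.
have := dP _ _ ac bc; have := cnormD (p b - p a - (b - a) *: v) ((b - a) *: v).
by rewrite subrK cnormZ; lra.
Qed.

Lemma vdiff_cst v c : vdiff (fun=> v) c 0.
Proof.
move=> e e0; exists 1 => // a b _ _.
by rewrite subrr scaler0 subr0 cnorm0 mulr_ge0 ?cmod_ge0 // ltW.
Qed.

Lemma vdiff_line v c : vdiff (fun x => x *: v) c v.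
Proof.
move=> e e0; exists 1 => // a b _ _.
by rewrite -scalerBl subrr cnorm0 mulr_ge0 ?cmod_ge0 // ltW.
Qed.

Lemma vdiffD p q c v w : vdiff p c v -> vdiff q c w ->
  vdiff (fun x => p x + q x) c (v + w).
Proof.
move=> hd kd e e0.
have e20 : 0 < e / 2 by rewrite divr_gt0.
have [d d0 dP] := hd _ e20; have [d' d'0 dP'] := kd _ e20.
exists (Num.min d d'); first by rewrite lt_min d0.
move=> a b; rewrite !lt_min => /andP [ad ad'] /andP [bd bd'].
have -> : p b + q b - (p a + q a) - (b - a) *: (v + w) =
  (p b - p a - (b - a) *: v) + (q b - q a - (b - a) *: w).
  by apply/rowP => t; rewrite !mxE; ring.
apply: le_trans (cnormD _ _) _.
by have := dP _ _ ad bd; have := dP' _ _ ad' bd'; lra.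
Qed.

Lemma vdiffZ k p c v : vdiff p c v -> vdiff (fun x => k *: p x) c (k *: v).
Proof.
move=> hd e e0.
have k0 : 0 < cmod k + 1 by have := cmod_ge0 k; lra.
have [d d0 dP] := hd _ (divr_gt0 e0 k0).
exists d => // a b ac bc; have := dP _ _ ac bc.
have -> : k *: p b - k *: p a - (b - a) *: (k *: v) = k *: (p b - p a - (b - a) *: v).
  by apply/rowP => t; rewrite !mxE; ring.
rewrite cnormZ mulrAC ler_pdivlMr // mulrC => H; apply: le_trans H.
by rewrite ler_wpM2r ?cnorm_ge0 //; lra.
Qed.

Lemma vdiff_dot p c v w : vdiff p c v -> cdiff (fun x => dot (p x) w) c (dot v w).
Proof.
move=> hd e e0.
have k0 : 0 < cnorm w + 1 by have := cnorm_ge0 w; lra.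
have [d d0 dP] := hd _ (divr_gt0 e0 k0).
exists d => // a b ac bc; have := dP _ _ ac bc.
have -> : dot (p b) w - dot (p a) w - dot v w * (b - a) = dot (p b - p a - (b - a) *: v) w.
  by rewrite !dotDl !dotNl dotZl [dot v w * _]mulrC.
rewrite mulrAC ler_pdivlMr // => H; apply: le_trans H.
apply: le_trans (dot_le _ _) _.
by rewrite ler_wpM2l ?cnorm_ge0 //; lra.
Qed.

Lemma vdiff_mdiff g p c v M : vdiff p c v -> mdiff g (p c) M ->
  vdiff (fun x => g (p x)) c (v *m M).
Proof.
move=> hd kd e e0.
have [dl dl0 dlP] := vdiff_lip hd.
have L0 : 0 < cnorm v + 1 by have := cnorm_ge0 v; lra.
have L0' : 0 < opbound M + 1 by have := opbound_ge0 M; lra.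
have e10 : 0 < e / 2 / (cnorm v + 1) by rewrite !divr_gt0.
have e20 : 0 < e / 2 / (opbound M + 1) by rewrite !divr_gt0.
have [d1 d10 d1P] := hd _ e20; have [d2 d20 d2P] := kd _ e10.
have d30 : 0 < d2 / (cnorm v + 1) by rewrite divr_gt0.
have cc : cmod (c - c) < dl by rewrite subrr cmod0.
have d3P a : cmod (a - c) < dl -> cmod (a - c) < d2 / (cnorm v + 1) ->
    cnorm (p a - p c) < d2.
  move=> al ad; apply: le_lt_trans (dlP _ _ cc al) _.
  by rewrite mulrC -ltr_pdivlMr.
exists (Num.min dl (Num.min d1 (d2 / (cnorm v + 1)))); first by rewrite !lt_min dl0 d10.
move=> a b; rewrite !lt_min => /andP [al /andP[a1 a3]] /andP [bl /andP[b1 b3]].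
have -> : g (p b) - g (p a) - (b - a) *: (v *m M) =
  (g (p b) - g (p a) - (p b - p a) *m M) + (p b - p a - (b - a) *: v) *m M.
  by rewrite [X in _ = _ + X]mulmxBl -scalemxAl addrA subrK.
have A := d2P _ _ (d3P _ al a3) (d3P _ bl b3).
have B := d1P _ _ a1 b1; have D := dlP _ _ al bl.
apply: le_trans (cnormD _ _) _.
have A' : cnorm (g (p b) - g (p a) - (p b - p a) *m M) <= e / 2 * cmod (b - a).
  apply: le_trans A _; rewrite -[leLHS]mulrA ler_pM2l ?divr_gt0 //.
  by rewrite mulrC ler_pdivrMr // mulrC.
have B' : cnorm ((p b - p a - (b - a) *: v) *m M) <= e / 2 * cmod (b - a).
  apply: le_trans (cnorm_mulmx _ _) _.
  apply: (@le_trans _ _ ((opbound M + 1) * cnorm (p b - p a - (b - a) *: v))).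
    by rewrite ler_wpM2r ?cnorm_ge0 //; lra.
  by rewrite -ler_pdivlMl // mulrA [_^-1 * _]mulrC.
by lra.
Qed.

Lemma mdiff_inverse g h z M : mdiff g z M -> M \in unitmx -> h (g z) = z ->
  (forall e, 0 < e -> exists2 d, 0 < d & forall w, cnorm (w - g z) < d ->
     g (h w) = w /\ cnorm (h w - z) < e) ->
  mdiff h (g z) (invmx M).
Proof.
move=> gd Mu hz hc e e0.
set L := opbound (invmx M) + 1.
have L0 : 0 < L by rewrite /L; have := opbound_ge0 (invmx M); lra.
(* Let [r] be the error of [g] between [h a] and [h b]. The first bound absorbs [r] and gives
   [|h b - h a| <= 2 L |b - a|]; the second then makes the remainder [r *m invmx M] of [h] at most
   [e |b - a|]. *)
have e10 : 0 < Num.min ((2 * L)^-1) (e / (2 * L ^+ 2)).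
  by rewrite lt_min invr_gt0 divr_gt0 ?mulr_gt0 ?exprn_gt0.
have [d1 d10 d1P] := gd _ e10; have [d d0 dP] := hc _ d10.
exists d => // a b /dP [ga ad] /dP [gb bd].
have := d1P _ _ ad bd; rewrite ga gb.
set r := b - a - _; set D := cnorm (h b - h a) => hr.
have r1 : cnorm r <= (2 * L)^-1 * D.
  by apply: le_trans hr _; rewrite ler_wpM2r ?cnorm_ge0 // ge_min lexx.
have r2 : cnorm r <= e / (2 * L ^+ 2) * D.
  by apply: le_trans hr _; rewrite ler_wpM2r ?cnorm_ge0 // ge_min lexx orbT.
have E : h b - h a = (b - a - r) *m invmx M.
  by rewrite /r opprB addrCA subrr addr0 mulmxK.
have Lb x : cnorm (x *m invmx M) <= L * cnorm x.
  by apply: le_trans (cnorm_mulmx _ _) _; rewrite ler_wpM2r ?cnorm_ge0 // /L; lra.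
have D2 : D <= 2 * L * cnorm (b - a).
  have : D <= L * (cnorm (b - a) + cnorm r).
    rewrite /D E; apply: le_trans (Lb _) _.
    by rewrite ler_pM2l // cnormB.
  have : L * cnorm r <= D / 2.
    apply: (@le_trans _ _ (L * ((2 * L)^-1 * D))); first by rewrite ler_pM2l.
    by rewrite mulrA invfM mulrCA divff ?gt_eqF // mulr1 mulrC.
  by lra.
have -> : h b - h a - (b - a) *m invmx M = - (r *m invmx M).
  by rewrite E mulmxBl addrAC subrr sub0r.
rewrite cnormN; apply: le_trans (Lb _) _.
apply: (@le_trans _ _ (L * (e / (2 * L ^+ 2) * (2 * L * cnorm (b - a))))).
  rewrite ler_pM2l //; apply: le_trans r2 _.
  by rewrite ler_wpM2l // divr_ge0 ?mulr_ge0 ?exprn_ge0 // ltW.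
rewrite le_eqVlt; apply/orP; left; apply/eqP; field.
by rewrite gt_eqF.
Qed.

End StrictDiff.

(** * Growth of convex mappings of the ball *)

Section Growth.
Variables (R : realType) (n : nat).
Local Notation C := (Cplx R).
Local Notation V := 'rV[C]_n.
Variables (f psi : V -> V).
Hypothesis f0 : f 0 = 0.
Hypothesis psif : forall z, cnorm z < 1 -> psi (f z) = z.
Hypothesis fconv : forall z y (t : R), cnorm z < 1 -> cnorm y < 1 -> 0 <= t -> t <= 1 ->
  exists2 x, cnorm x < 1 & rc (1 - t) *: f z + rc t *: f y = f x.
Hypothesis fd : forall z, cnorm z < 1 ->
  exists M, [/\ M \in unitmx, mdiff f z M & mdiff psi (f z) (invmx M)].
Hypothesis fd0 : mdiff f 0 1%:M.
Hypothesis psid0 : mdiff psi 0 1%:M.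
Implicit Types (z y : V) (x : C) (s t r : R).

Lemma psi0 : psi 0 = 0.
Proof. by rewrite -{1}f0 psif // cnorm0. Qed.

(** By convexity the argument of [psi] is a value of [f], where [psi] is strictly differentiable. *)
Lemma psi_comb_diff (p q : C -> V) x v w t : 0 <= t -> t <= 1 ->
  vdiff p x v -> vdiff q x w -> cnorm (p x) < 1 -> cnorm (q x) < 1 ->
  exists v', vdiff (fun c => psi (rc (1 - t) *: f (p c) + rc t *: f (q c))) x v'.
Proof.
move=> t0 t1 pd qd p1 q1.
have [M [_ fM _]] := fd p1; have [M' [_ fM' _]] := fd q1.
have [z z1 zE] := fconv p1 q1 t0 t1; have [M'' [_ _ pM]] := fd z1.
have cd := vdiffD (vdiffZ (rc (1 - t)) (vdiff_mdiff pd fM)) (vdiffZ (rc t) (vdiff_mdiff qd fM')).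
rewrite -zE in pM.
by eexists; exact: vdiff_mdiff cd pM.
Qed.

Lemma psi_comb_lt1 z y t : cnorm z < 1 -> cnorm y < 1 -> 0 <= t -> t <= 1 ->
  cnorm (psi (rc (1 - t) *: f z + rc t *: f y)) < 1.
Proof. by move=> z1 y1 t0 t1; have [x x1 ->] := fconv z1 y1 t0 t1; rewrite psif. Qed.

(* That is, f maps balls centred at 0 onto convex sets. *)
Lemma psi_comb_le z y t r : 0 < r -> r < 1 -> cnorm z <= r -> cnorm y <= r -> 0 <= t -> t <= 1 ->
  cnorm (psi (rc (1 - t) *: f z + rc t *: f y)) <= r.
Proof.
move=> r0 r1 zr yr t0 t1.
pose W x := psi (rc (1 - t) *: f (x *: z) + rc t *: f (x *: y)).
have in1 x (v : V) : cmod x < r^-1 -> cnorm v <= r -> cnorm (x *: v) < 1.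
  move=> xr vr; rewrite cnormZ; apply: (@le_lt_trans _ _ (cmod x * r)).
    by rewrite ler_wpM2l ?cmod_ge0.
  by rewrite -ltr_pdivlMr // mul1r.
(* On the disc of radius [1 / r] the values of [W] stay in the unit ball, so [Q], which vanishes at
   0, is bounded by [|e|]. At 1 the Schwarz lemma reads [|e|^2 <= |e| * r]. *)
pose e := W 1; pose Q x := dot (W x) e.
have Qd x : cmod x < r^-1 -> exists l, cdiff Q x l.
  move=> xr.
  have [v Wd] := psi_comb_diff t0 t1 (@vdiff_line R n z x) (@vdiff_line R n y x) (in1 _ _ xr zr) (in1 _ _ xr yr).
  by exists (dot v e); exact: vdiff_dot Wd.
have W0 : W 0 = 0 by rewrite /W !scale0r f0 !scaler0 addr0 psi0.
have Q0 : Q 0 = 0 by rewrite /Q W0 -(scale0r 0) dotZl mul0r.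
have ri : 0 < r^-1 by rewrite invr_gt0.
have c01 : cmod (0 : C) < r^-1 by rewrite cmod0.
have [l0 Qd0] := Qd _ c01.
have QM x : cmod x < r^-1 -> cmod (Q x) <= cnorm e.
  move=> xr; apply: le_trans (dot_le _ _) _; rewrite -[leRHS]mul1r ler_wpM2r ?cnorm_ge0 //.
  by apply/ltW/psi_comb_lt1; rewrite ?in1.
have c11 : cmod (1 : C) < r^-1 by rewrite cmod1 invf_gt1.
have := schwarz ri Q0 (cdiff_cont Qd0) (fun x _ => Qd x) QM c11.
rewrite /Q -/e dotvv cmod_rc ger0_norm ?sqr_ge0 // cmod1 mulr1 invrK.
have -> : psi (rc (1 - t) *: f z + rc t *: f y) = e by rewrite /e /W !scale1r.
have [-> _|e0] := eqVneq (cnorm e) 0; first exact: ltW.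
by rewrite expr2 ler_pM2l // lt_neqAle eq_sym e0 cnorm_ge0.
Qed.

(* Julia's lemma for g x = <z - psi ((1 - t) f z + t f (x z)), z> / (t |z|^2). *)
Lemma psi_shrink_julia z t : z != 0 -> cnorm z < 1 -> 0 < t -> t <= 1 ->
  cmod (dot (psi (rc (1 - t) *: f z)) z - rc ((1 - t) * cnorm z ^+ 2)) <= t * cnorm z ^+ 2.
Proof.
move=> z0 z1 t0 t1; have r0 := cnorm_gt0 z0; set r := cnorm z in z1 r0 *.
pose v x := psi (rc (1 - t) *: f z + rc t *: f (x *: z)).
(* Normalizes the derivative of [g] at 1 to -1. *)
pose kap : C := (rc (t * r ^+ 2))^-1.
have tr0 : 0 < t * r ^+ 2 by rewrite mulr_gt0 // exprn_gt0.
have kap0 : rc (t * r ^+ 2) != 0 by rewrite rc_eq0 gt_eqF.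
pose g x := kap * dot (z + (-1) *: v x) z.
have gE x : g x = kap * (rc (r ^+ 2) - dot (v x) z).
  by rewrite /g dotDl dotZl mulN1r dotvv.
have v1 : v 1 = z.
  rewrite /v scale1r -scalerDl -rcD subrK scale1r; exact: psif.
have gdiff x w : vdiff v x w -> cdiff g x (kap * dot ((-1) *: w) z).
  move=> vd; apply: cdiffZ; have := vdiff_dot z (vdiffD (vdiff_cst z x) (vdiffZ (-1) vd)).
  by rewrite add0r.
have gd x : cmod x < 1 -> exists l, cdiff g x l.
  move=> x1; have xz1 : cnorm (x *: z) < 1.
    by rewrite cnormZ -/r; have := cmod_ge0 x; nra.
  have [w vd] := psi_comb_diff (ltW t0) t1 (@vdiff_cst R n z x) (@vdiff_line R n z x) z1 xz1.
  by eexists; exact: gdiff vd.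
have gR x : cmod x < 1 -> 0 <= complex.Re (g x).
  move=> x1; rewrite gE /kap -rcV cReM cRe_rc cIm_rc mul0r subr0.
  rewrite pmulr_rge0 ?invr_gt0 // cReD cReN cRe_rc subr_ge0.
  have := cRe_le_cmod (dot (v x) z); rewrite ler_norml => /andP [_ h].
  apply: le_trans h _; apply: le_trans (dot_le _ _) _.
  rewrite -/r expr2 ler_pM2r //; apply: psi_comb_le; rewrite // ?ltW //.
  rewrite -/r cnormZ -/r; have := cmod_ge0 x; nra.
have gb e : 0 < e -> exists2 d, 0 < d & forall s, 0 < s -> s < d ->
    cmod (g (rc (1 - s)) - rc s) <= e * s.
  move=> e0.
  have [M [Mu fM pM]] := fd z1.
  (* At 1 the argument of [psi] is [f z], so the Jacobians of [f] and [psi] cancel. *)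
  have vd1 : vdiff v 1 (rc t *: z).
    have fM1 : mdiff f ((1 : C) *: z) M by rewrite scale1r.
    have cd := vdiffD (vdiffZ (rc (1 - t)) (vdiff_cst (f z) 1)) (vdiffZ (rc t) (vdiff_mdiff (@vdiff_line R n z 1) fM1)).
    rewrite scaler0 add0r in cd.
    have pM1 : mdiff psi (rc (1 - t) *: f z + rc t *: f ((1 : C) *: z)) (invmx M).
      by rewrite scale1r -scalerDl -rcD subrK scale1r.
    by have := vdiff_mdiff cd pM1; rewrite -scalemxAl mulmxK.
  have [d d0 dP] := gdiff _ _ vd1 _ e0.
  exists d => // s s0 sd.
  have sE : rc (1 - s) - 1 = - rc s by rewrite rcB rc1 addrAC subrr sub0r.
  have := dP 1 (rc (1 - s)); rewrite subrr cmod0 => /(_ d0).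
  rewrite sE cmodN cmod_rc gtr0_norm // => /(_ sd).
  have -> : g 1 = 0 by rewrite gE v1 dotvv subrr mulr0.
  have -> // : g (rc (1 - s)) - 0 - kap * dot (-1 *: (rc t *: z)) z * - rc s = g (rc (1 - s)) - rc s.
  have -> : kap * dot (-1 *: (rc t *: z)) z = - 1.
    by rewrite !dotZl dotvv -/r -rcM mulN1r mulrN mulVf.
  by rewrite subr0 mulN1r opprK.
have := julia_halfplane gd gR gb; rewrite gE /v scale0r f0 scaler0 addr0.
set y := psi _ => H.
have -> : dot y z - rc ((1 - t) * r ^+ 2) = - (rc (t * r ^+ 2) * (kap * (rc (r ^+ 2) - dot y z) - 1)).
  have kK : rc (t * r ^+ 2) * kap = 1 by exact: mulfV.
  by rewrite mulrBr [_ * (kap * _)]mulrA kK !rcM rcB rc1; ring.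
by rewrite cmodN cmodM cmod_rc gtr0_norm // -[leRHS]mulr1 ler_pM2l.
Qed.

(* psi_shrink_julia bounds Q x = s - <psi (s f (x u)), u> / x by 1 - s on the  *)
(* disc, u = z / |z|; as Q vanishes at 0, Schwarz gains the factor |x|.        *)
Lemma psi_shrink z s : cnorm z < 1 -> 0 <= s -> s < 1 ->
  cmod (dot (psi (rc s *: f z)) z - rc (s * cnorm z ^+ 2)) <= (1 - s) * cnorm z ^+ 3.
Proof.
move=> z1 s0 s1.
have [->|z0] := eqVneq z 0.
  by rewrite f0 scaler0 psi0 dotvv cnorm0 expr2 !mulr0 subrr cmod0 exprS mul0r mulr0.
have r0 := cnorm_gt0 z0; set r := cnorm z in z1 r0 *.
pose u := (rc r)^-1 *: z.
have rn0 : rc r != 0 by rewrite rc_eq0 gt_eqF.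
have u1 : cnorm u = 1.
  by rewrite cnormZ cmodV cmod_rc gtr0_norm // mulVf // gt_eqF.
have zE : z = rc r *: u by rewrite scalerA mulfV // scale1r.
have u0 : u != 0 by apply/eqP => E; move: u1; rewrite E cnorm0; lra.
pose v x := psi (rc s *: f (x *: u)).
(* The value 0 is the limit at 0: as [f] and [psi] have the identity as derivative there,
   [<v x, u> = s * x + o(x)]. *)
pose Q x : C := if x == 0 then 0 else rc s - dot (v x) u * x^-1.
have Q0 : Q 0 = 0 by rewrite /Q eqxx.
have in1 x : cmod x < 1 -> cnorm (x *: u) < 1 by rewrite cnormZ u1 mulr1.
have cmn0 : cnorm (0 : V) < 1 by rewrite cnorm0.
have cdv x : cmod x < 1 -> exists l, cdiff (fun x => dot (v x) u) x l.
  move=> x1.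
  have [w vd] := psi_comb_diff s0 (ltW s1) (@vdiff_cst R n 0 x) (@vdiff_line R n u x) cmn0 (in1 _ x1).
  exists (dot w u); apply: cdiff_near ltr01 _ (vdiff_dot u vd) => y _.
  by rewrite f0 scaler0 add0r.
have Qc : ccont Q 0.
  move=> e e0.
  have f01 : mdiff f ((0 : C) *: u) 1%:M by rewrite scale0r.
  have cd := vdiffZ (rc s) (vdiff_mdiff (@vdiff_line R n u 0) f01).
  have p01 : mdiff psi (rc s *: f ((0 : C) *: u)) 1%:M by rewrite scale0r f0 scaler0.
  have vd := vdiff_dot u (vdiff_mdiff cd p01); rewrite !mulmx1 dotZl dotvv u1 expr1n mulr1 in vd.
  have e20 : 0 < e / 2 by rewrite divr_gt0.
  have [d d0 dP] := vd _ e20.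
  exists d => // x; rewrite subr0 Q0 subr0 => xd.
  rewrite /Q; case: eqVneq => [_|x0]; first by rewrite cmod0.
  have := dP 0 x; rewrite !subr0 cmod0 => /(_ d0 xd).
  rewrite scale0r f0 scaler0 psi0.
  have -> : dot 0 u = 0 by rewrite -(scale0r u) dotZl mul0r.
  rewrite subr0 -/(v x) => H.
  have -> : rc s - dot (v x) u * x^-1 = - ((dot (v x) u - rc s * x) * x^-1).
    by rewrite mulrBl mulfK // opprB.
  rewrite cmodN cmodM cmodV; apply: (@le_lt_trans _ _ (e / 2)); last by lra.
  by rewrite ler_pdivrMr // cmod_gt0.
have Qd x : x != 0 -> cmod x < 1 -> exists l, cdiff Q x l.
  move=> x0 x1; have [l vl] := cdv _ x1.
  have qd := cdiffD (cdiff_cst (rc s) x) (cdiffZ (-1) (cdiffM vl (cdiff_inv x0))).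
  eexists; apply: cdiff_near (cmod_gt0 x0) _ qd => y yx.
  rewrite /Q; case: eqVneq => [y0|_]; last by rewrite mulN1r.
  by move: yx; rewrite y0 sub0r cmodN ltxx.
(* This is [psi_shrink_julia] at [x *: u] with [t = 1 - s], divided by [|x|^2]. *)
have QM x : cmod x < 1 -> cmod (Q x) <= 1 - s.
  move=> x1; rewrite /Q; case: eqVneq => [_|x0]; first by rewrite cmod0 subr_ge0 ltW.
  have xu0 : x *: u != 0 by rewrite scaler_eq0 negb_or x0.
  have s1' : 0 < 1 - s by rewrite subr_gt0.
  have s1'' : 1 - s <= 1 by lra.
  have := psi_shrink_julia xu0 (in1 _ x1) s1' s1''.
  rewrite opprB addrCA subrr addr0 -/(v x) cnormZ u1 mulr1 dotZr.
  have -> : Num.conj x * dot (v x) u - rc (s * cmod x ^+ 2) = - (rc (cmod x ^+ 2) * (rc s - dot (v x) u * x^-1)).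
    rewrite rcM -mul_conj mulrBr opprB; congr (_ - _); last by rewrite mulrC.
    by rewrite mulrCA [x * _]mulrC -mulrA mulfV // mulr1 mulrC.
  rewrite cmodN cmodM cmod_rc ger0_norm ?sqr_ge0 // mulrC ler_pM2r //.
  by rewrite exprn_gt0 // cmod_gt0.
have r1 : cmod (rc r) < 1 by rewrite cmod_rc gtr0_norm.
have := schwarz ltr01 Q0 Qc Qd QM r1.
rewrite divr1 cmod_rc gtr0_norm // /Q (negPf rn0) /v -zE => H.
have -> : dot (psi (rc s *: f z)) z - rc (s * r ^+ 2) =
   - (rc (r ^+ 2) * (rc s - dot (psi (rc s *: f z)) u / rc r)).
  have -> : dot (psi (rc s *: f z)) z = rc r * dot (psi (rc s *: f z)) u.
    by rewrite {2}zE dotZr; congr (_ * _); apply: CeqP; rewrite ?cRe_conj ?cIm_conj //= oppr0.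
  move: (dot _ u) => D; rewrite rcM rcX; field; exact: rn0.
rewrite cmodN cmodM cmod_rc ger0_norm ?sqr_ge0 //.
rewrite (_ : (1 - s) * r ^+ 3 = r ^+ 2 * ((1 - s) * r)); last by ring.
by rewrite ler_pM2l // exprn_gt0.
Qed.

End Growth.

Lemma is_derive_eps (R : realType) (k : R -> R) (x k' : R) :
  (forall e : R, 0 < e -> exists2 d : R, 0 < d & forall h, `|h| < d ->
    `|k (x + h) - k x - k' * h| <= e * `|h|) -> is_derive x 1 k k'.
Proof.
move=> H.
have cv : (h^-1 *: ((k \o shift x) (h *: (1 : R)) - k x) @[h --> (0 : R)^']) --> k'.
  apply/cvgrPdist_le => e e0; have [d d0 dP] := H e e0.
  near=> h.
  have h0 : h != 0 by near: h; exact: nbhs_dnbhs_neq.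
  have hd : `|h| < d by near: h; apply: dnbhs0_lt.
  have := dP h hd.
  have -> : (k \o shift x) (h *: (1 : R)) = k (x + h) by rewrite /= [h *: _]mulr1 addrC.
  move=> Hh; have -> : k' - h^-1 *: (k (x + h) - k x) = - (h^-1 * (k (x + h) - k x - k' * h)).
    by rewrite /GRing.scale /=; field.
  by rewrite normrN normrM normfV mulrC ler_pdivrMr ?normr_gt0.
split; first by apply/cvg_ex; exists k'.
by apply/cvg_lim.
Unshelve. all: by end_near.
Qed.

Lemma cnorm_sqrB (R : realType) n (x y : 'rV[Cplx R]_n) :
  cnorm y ^+ 2 - cnorm x ^+ 2 = 2 * complex.Re (dot (y - x) x) + cnorm (y - x) ^+ 2.
Proof.
have nE w : cnorm w ^+ 2 = complex.Re (dot w w) by rewrite dotvv.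
rewrite !nE !dotDl !dotNl [dot y (y - x)]dotC [dot x (y - x)]dotC.
rewrite !dotDl !dotNl (dotC x y) !cReD !cReN !cRe_conj !cReD !cReN cRe_conj.
ring.
Qed.

Lemma norm_square_bound (R : realType) (u w q e a : R) :
  w <= e / 2 * a -> 0 <= w -> `|u - q| <= e / 4 * a -> `|2 * u + w - 2 * q| <= e * a.
Proof. by rewrite !ler_norml => h1 h2 /andP [h3 h4]; apply/andP; split; lra. Qed.

(** The squared norm is differentiated by expanding the inner product; the norm itself then follows
    through the square root. *)
Lemma is_derive_of_square (R : realType) (N : R -> R) (s k' : R) : 0 < N s ->
  (forall t, 0 <= N t) -> is_derive s 1 (fun t => N t ^+ 2) k' ->
  is_derive s 1 N ((2 * N s)^-1 * k').
Proof.
move=> N0 Npos kd; have k0 : 0 < N s ^+ 2 by rewrite exprn_gt0.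
have := @is_derive1_comp R Num.sqrt (fun t => N t ^+ 2) s _ _ (is_derive1_sqrt k0) kd.
have -> : Num.sqrt \o (fun t => N t ^+ 2) = N.
  by apply/funext => t; rewrite /= sqrtr_sqr ger0_norm.
by rewrite sqrtr_sqr ger0_norm.
Qed.

Lemma is_derive_id_div (R : realType) (N : R -> R) (s N' : R) : 0 < N s ->
  is_derive s 1 N N' -> is_derive s 1 (fun t => t * (N t)^-1) ((N s)^-1 - s * N' / N s ^+ 2).
Proof.
move=> N0 Nd; have Nn0 : N s != 0 by rewrite gt_eqF.
have := is_deriveM (is_derive_id s 1) (is_deriveV Nn0 Nd).
rewrite /GRing.scale /= mulr1.
by have -> : s * (- N s ^- 2 * N') + (N s)^-1 = (N s)^-1 - s * N' / N s ^+ 2 by field.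
Qed.

(** With [N' = q / N], the derivative of [s / N] is [- (s * q - N^2) / N^3]. *)
Lemma ray_slope_bound (R : realType) (N s q : R) : 0 < N ->
  `|s * q - N ^+ 2| <= N ^+ 3 -> `|N^-1 - s * ((2 * N)^-1 * (2 * q)) / N ^+ 2| <= 1.
Proof.
move=> N0 vN.
have -> : N^-1 - s * ((2 * N)^-1 * (2 * q)) / N ^+ 2 = - (s * q - N ^+ 2) / N ^+ 3.
  by field; rewrite gt_eqF.
rewrite normrM normfV normrN [`|_ ^+ 3|]ger0_norm ?exprn_ge0 ?(ltW N0) //.
by rewrite ler_pdivrMr ?exprn_gt0 // mul1r.
Qed.

(** * Integration of the infinitesimal estimate along rays *)

Section GrowthTheorem.
Variables (R : realType) (n : nat).
Local Notation C := (Cplx R).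
Local Notation V := 'rV[C]_n.
Variables (f psi : V -> V).
Hypothesis f0 : f 0 = 0.
Hypothesis psif : forall z, cnorm z < 1 -> psi (f z) = z.
Hypothesis fconv : forall z y (t : R), cnorm z < 1 -> cnorm y < 1 -> 0 <= t -> t <= 1 ->
  exists2 x, cnorm x < 1 & rc (1 - t) *: f z + rc t *: f y = f x.
Hypothesis fd : forall z, cnorm z < 1 ->
  exists M, [/\ M \in unitmx, mdiff f z M & mdiff psi (f z) (invmx M)].
Hypothesis fd0 : mdiff f 0 1%:M.
Hypothesis psid0 : mdiff psi 0 1%:M.
Variable z : V.
Hypothesis z0 : z != 0.
Hypothesis z1 : cnorm z < 1.
Implicit Types (s t r : R).

Let N s := cnorm (psi (rc s *: f z)).

Lemma fz_neq0 : f z != 0.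
Proof.
apply: contra z0 => /eqP fz; apply/eqP.
by rewrite -(psif z1) fz -f0 psif // cnorm0.
Qed.

Lemma ray_in_image s : 0 <= s -> s <= 1 ->
  exists2 x, cnorm x < 1 & rc s *: f z = f x.
Proof.
move=> s0 s1; have c0 : cnorm (0 : V) < 1 by rewrite cnorm0.
have [x x1] := fconv c0 z1 s0 s1.
by rewrite f0 scaler0 add0r => E; exists x.
Qed.

(* psi_shrink from s to s - h, divided by h, as h tends to 0.                  *)
Lemma ray_derivative s : 0 < s -> s <= 1 ->
  exists v, [/\ 0 < N s, vdiff (fun c => psi (c *: f z)) (rc s) v &
    `|s * complex.Re (dot v (psi (rc s *: f z))) - N s ^+ 2| <= N s ^+ 3].
Proof.
move=> s0 s1; have [x x1 xE] := ray_in_image (ltW s0) s1.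
have yE : psi (rc s *: f z) = x by rewrite xE psif.
have sn0 : rc s != 0 by rewrite rc_eq0 gt_eqF.
have xn0 : x != 0.
  apply/eqP => xz; move: xE; rewrite xz f0 => /eqP; rewrite scaler_eq0 (negPf sn0) /=.
  by rewrite (negPf fz_neq0).
have [M [_ _ pM]] := fd x1.
rewrite -xE in pM.
have vd := vdiff_mdiff (@vdiff_line R n (f z) (rc s)) pM.
set v := f z *m _ in vd; exists v.
rewrite /N yE; split => //; first exact: cnorm_gt0.
set a := cnorm x; have a0 : 0 < a by exact: cnorm_gt0.
apply: (@le_limit _ _ _ (s * a)) => e e0 _.
have [d d0 dP] := vd _ e0.
pose h := Num.min d s / 2.
have hE : Num.min d s = 2 * h by rewrite /h mulrC divfK.
have h0 : 0 < h by rewrite divr_gt0 // lt_min d0.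
have : 2 * h <= Num.min d s by rewrite hE.
clearbody h; rewrite le_min => /andP [hd hs].
have := dP (rc s) (rc (s - h)).
rewrite subrr cmod0 => /(_ d0).
have -> : rc (s - h) - rc s = - rc h by rewrite rcB addrAC subrr sub0r.
rewrite cmodN cmod_rc gtr0_norm // => /(_ _); rewrite yE.
have q0 : 0 <= (s - h) / s by rewrite divr_ge0 //; lra.
have q1 : (s - h) / s < 1 by rewrite ltr_pdivrMr //; lra.
(* As [f x = s * f z], scaling [f x] by [(s - h) / s] gives the point [(s - h) * f z] of the same
   ray. *)
have := psi_shrink f0 psif fconv fd fd0 psid0 x1 q0 q1.
have -> : rc ((s - h) / s) *: f x = rc (s - h) *: f z.
  by rewrite -xE scalerA -rcM divfK // gt_eqF.
set y := psi (rc (s - h) *: f z) => S D.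
have {}D : cnorm (y - x - - rc h *: v) <= e * h by apply: D; lra.
have D' : cmod (dot (y - x - - rc h *: v) x) <= e * h * a.
  by apply: le_trans (dot_le _ _) _; rewrite ler_wpM2r ?cnorm_ge0.
have := le_trans (cRe_le_cmod _) D'; have := le_trans (cRe_le_cmod _) S.
rewrite !dotDl !dotNl dotZl dotvv !cReD !cReN !cReM !cReN cImN !cRe_rc cIm_rc.
rewrite -/a oppr0 mul0r subr0 mulNr opprK.
move: (complex.Re (dot y x)) (complex.Re (dot v x)) => p q.
rewrite !ler_norml => /andP [h1 h2] /andP [h3 h4].
have E1 : (s - h) / s * a ^+ 2 = a ^+ 2 - h * (a ^+ 2 / s) by field; rewrite gt_eqF.
have E2 : (1 - (s - h) / s) * a ^+ 3 = h * (a ^+ 3 / s) by field; rewrite gt_eqF.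
rewrite E1 E2 in h1 h2.
have g1 : h * (q - a ^+ 2 / s) <= h * (a ^+ 3 / s + e * a) by lra.
have g2 : h * - (a ^+ 3 / s + e * a) <= h * (q - a ^+ 2 / s) by lra.
rewrite !ler_pM2l // in g1 g2.
have sa k : s * (k / s) = k by rewrite mulrC divfK // gt_eqF.
have := ler_wpM2l (ltW s0) g1; have := ler_wpM2l (ltW s0) g2.
rewrite mulrN !mulrBr !mulrDr !sa; lra.
Qed.

(** The derivative of [N s ^+ 2] is [2 * Re <v, psi (s * f z)>], since the remaining term
    [|y - x|^2] is quadratic in [h]; [ray_derivative] then bounds the slope of [s / N s]. *)
Lemma ray_quotient_derive s : 0 < s -> s <= 1 ->
  exists D, is_derive s 1 (fun s => s * (N s)^-1) D /\ `|D| <= 1.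
Proof.
move=> s0 s1; have [v [N0 vd vN]] := ray_derivative s0 s1.
set x := psi _ in vN; set q := complex.Re _ in vN.
have kd : is_derive s 1 (fun s => N s ^+ 2) (2 * q).
  apply: is_derive_eps => e e0.
  have [dl dl0 dlP] := vdiff_lip vd.
  have K0 : 0 < cnorm v + 1 by have := cnorm_ge0 v; lra.
  have e10 : 0 < e / 2 / (2 * N s) by rewrite !divr_gt0 // mulr_gt0.
  have [d d0 dP] := vd _ e10.
  exists (Num.min (Num.min dl d) (e / 2 / (cnorm v + 1) ^+ 2)).
    by rewrite !lt_min dl0 d0 !divr_gt0 ?exprn_gt0.
  move=> h; rewrite !lt_min => /andP [/andP [hl hd] he].
  have E : rc (s + h) - rc s = rc h by rewrite rcD addrAC subrr add0r.
  have c0 b : 0 < b -> cmod (rc s - rc s) < b by rewrite subrr cmod0.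
  have := dP (rc s) (rc (s + h)) (c0 _ d0); rewrite E cmod_rc => /(_ hd).
  have := dlP (rc s) (rc (s + h)) (c0 _ dl0); rewrite E cmod_rc => /(_ hl).
  rewrite -/x; set y := psi (rc (s + h) *: f z) => H1 H2.
  have H3 : cmod (dot (y - x - rc h *: v) x) <= e / 4 * `|h|.
    apply: le_trans (dot_le _ _) _.
    apply: le_trans (ler_wpM2r (cnorm_ge0 _) H2) _; rewrite -/(N s).
    rewrite (_ : e / 2 / (2 * N s) * `|h| * N s = e / 4 * `|h|) //.
    by field; rewrite gt_eqF.
  have H4 : cnorm (y - x) ^+ 2 <= e / 2 * `|h|.
    apply: (@le_trans _ _ (((cnorm v + 1) * `|h|) ^+ 2)).
      by rewrite ler_sqr ?nnegrE ?cnorm_ge0 // mulr_ge0 // ltW.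
    rewrite exprMn (expr2 `|h|) mulrA ler_wpM2r //.
    by rewrite mulrC -ler_pdivlMr ?exprn_gt0 // ltW.
  have Ny : N (s + h) ^+ 2 - N s ^+ 2 = 2 * complex.Re (dot (y - x) x) + cnorm (y - x) ^+ 2.
    exact: cnorm_sqrB.
  have := le_trans (cRe_le_cmod _) H3.
  have -> : complex.Re (dot (y - x - rc h *: v) x) = complex.Re (dot (y - x) x) - q * h.
    by rewrite [dot (_ - _ *: _) _]dotDl dotNl dotZl cReD cReN cReM cRe_rc cIm_rc mul0r subr0 mulrC.
  rewrite Ny -(mulrA 2 q h).
  exact: norm_square_bound H4 (sqr_ge0 _).
have Nd := is_derive_of_square N0 (fun t => cnorm_ge0 _) kd.
eexists; split; first exact: (is_derive_id_div N0 Nd).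
by apply: ray_slope_bound vN.
Qed.

(** Mean value theorem on [[s, 1]] for [s / N s], whose value at 1 is [1 / |z|]. *)
Lemma ray_quotient_lip s : 0 < s -> s <= 1 -> `|(cnorm z)^-1 - s * (N s)^-1| <= 1.
Proof.
move=> s0 s1.
pose P s := s * (N s)^-1.
have P1 : P 1 = (cnorm z)^-1 by rewrite /P /N scale1r psif // mul1r.
rewrite -P1 -/(P s).
have H t : t \in `[s, 1] -> exists D, is_derive t 1 P D /\ `|D| <= 1.
  by rewrite in_itv /= => /andP [ts t1]; apply: ray_quotient_derive; lra.
have Hd t : t \in `]s, 1[ -> is_derive t 1 P (derive1 P t).
  move=> /subset_itv_oo_cc /H [D [dD _]].
  by rewrite derive1E; apply: DeriveDef => //; case: dD.
have Hc : {within `[s, 1], continuous P}.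
  apply: continuous_in_subspaceT => t /set_mem /= /H [D [[dD _] _]].
  exact/differentiable_continuous/derivable1_diffP.
have [c cs ->] := MVT_segment s1 Hd Hc.
have [D [dD D1]] := H _ cs.
rewrite derive1E (@derive_val _ _ _ _ _ _ _ dD) normrM.
rewrite [`|1 - s|]ger0_norm ?subr_ge0 //.
have := ler_wpM2r (_ : 0 <= 1 - s) D1; rewrite subr_ge0 => /(_ s1).
by move=> /le_trans; apply; rewrite mul1r; lra.
Qed.

(** Let [s] tend to 0 in [ray_quotient_lip]. The derivative of [psi] at 0 is the identity, so
    [N s / s] tends to [|f z|], and [1 / |z|] and [1 / |f z|] differ by at most 1. The auxiliary
    [key] is this statement with an error [e] and denominators cleared. *)
Lemma convex_growth : cnorm z / (1 + cnorm z) <= cnorm (f z) /\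
  cnorm (f z) <= cnorm z / (1 - cnorm z).
Proof.
set r := cnorm z; have r0 : 0 < r by exact: cnorm_gt0.
set W := cnorm (f z).
have key e : 0 < e -> r <= (W + e) * (1 + r) /\ (W - e) * (1 - r) <= r.
  move=> e0.
  have p0 : mdiff psi ((0 : C) *: f z) 1%:M by rewrite scale0r.
  have vd := vdiff_mdiff (@vdiff_line R n (f z) 0) p0; rewrite mulmx1 in vd.
  have [d d0 dP] := vd _ e0.
  pose s := Num.min d 1 / 2.
  have sE : Num.min d 1 = 2 * s by rewrite /s mulrC divfK.
  have s0 : 0 < s by rewrite divr_gt0 // lt_min d0 /=.
  have : 2 * s <= Num.min d 1 by rewrite sE.
  clearbody s; rewrite le_min => /andP [sd s1].
  have := dP 0 (rc s); rewrite subrr cmod0 subr0 cmod_rc gtr0_norm // => /(_ d0).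
  have {}sd : s < d by lra.
  move=> /(_ sd); rewrite scale0r (psi0 f0 psif) subr0.
  have {}s1 : s <= 1 by lra.
  have [_ [N0 _ _]] := ray_derivative s0 s1.
  have := ray_quotient_lip s0 s1; rewrite -/r.
  have := cnorm_lowB (psi (rc s *: f z)) (rc s *: f z).
  have := cnorm_lowB (rc s *: f z) (psi (rc s *: f z)).
  rewrite [cnorm (rc s *: _ - _)]cnormC cnormZ cmod_rc gtr0_norm // -/(N s) -/W.
  move=> h1 h2 + h3; rewrite ler_norml => /andP [h4 h5].
  have {}h1 : s * W - N s <= e * s by apply: le_trans h1 h3.
  have {}h2 : N s - s * W <= e * s by apply: le_trans h2 h3.
  have E1 : r^-1 * (r * N s) = N s by rewrite mulrA mulVf ?mul1r ?gt_eqF.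
  have E2 : s * (N s)^-1 * (r * N s) = s * r.
    by rewrite mulrCA -[X in r * X]mulrA mulVf ?gt_eqF // mulr1 mulrC.
  have rN0 : 0 <= r * N s by rewrite mulr_ge0 ?ltW.
  have {}h4 := ler_wpM2r rN0 h4; have {}h5 := ler_wpM2r rN0 h5.
  rewrite mulrBl E1 E2 mulN1r in h4; rewrite mulrBl E1 E2 mul1r in h5.
  split.
    suff : s * r <= s * ((W + e) * (1 + r)) by rewrite ler_pM2l.
    apply: (@le_trans _ _ (N s * (1 + r))); first by lra.
    rewrite mulrA ler_wpM2r //; [lra | lra].
  suff : s * ((W - e) * (1 - r)) <= s * r by rewrite ler_pM2l.
  apply: (@le_trans _ _ (N s * (1 - r))); last by lra.
  by rewrite mulrA ler_wpM2r //; [rewrite subr_ge0 ltW | lra].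
split.
  rewrite ler_pdivrMr; last by lra.
  apply: (@le_limit _ _ _ (1 + r)) => e e0 _; have [h _] := key e e0; lra.
rewrite ler_pdivlMr ?subr_gt0 //.
apply: (@le_limit _ _ _ (1 - r)) => e e0 _; have [_ h] := key e e0; lra.
Qed.

End GrowthTheorem.

(** * Clifford norms on slices *)

Section CliffordNorm.
Variables (R : realType) (m : nat).
Local Notation Cl := (clifford R m).
Implicit Types (x y I J : Cl) (a b c d : R).

Definition sc x : R := x finset.set0.
Definition ip x y : R := \sum_A x A * y A.

Lemma clgen_sqr (i : 'I_m) : clgen R i * clgen R i = -1.
Proof.
have h := clgen_anticomm R i i; rewrite eqxx mulr1 in h.
apply: (@scalerI _ _ (2 : R)); first by rewrite pnatr_eq0.
by rewrite scalerN scaler_nat mulr2n h scaleNr.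
Qed.

(** [e_A] is a product of generators with [e_i e_i^c = 1]; conjugation reverses the product, so the
    factors cancel from the inside out. *)
Lemma clbasisM_conj (A : {set 'I_m}) : clbasis R A * clconj (clbasis R A) = 1.
Proof.
rewrite clbasis_prod; elim: (enum A) => [|i s IH].
  rewrite big_nil mul1r; apply/ffunP => B; rewrite !ffunE.
  by case: eqP => [->|_]; rewrite ?mulr0 // cards0 expr0 mulr1.
rewrite big_cons; move: (\prod_(j <- s) clgen R j) IH => X IH.
rewrite clconjM mulrA -(mulrA (clgen R i)) IH mulr1 clconj_gen mulrN.
by rewrite clgen_sqr opprK.
Qed.

Lemma scD x y : sc (x + y) = sc x + sc y.
Proof. by rewrite /sc ffunE. Qed.
Lemma scN x : sc (- x) = - sc x.
Proof. by rewrite /sc ffunE. Qed.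
Lemma scZ a x : sc (a *: x) = a * sc x.
Proof. by rewrite /sc ffunE. Qed.
Lemma sc1 : sc 1 = 1.
Proof. by rewrite /sc ffunE eqxx. Qed.
Lemma sc_conj x : sc (clconj x) = sc x.
Proof. by rewrite /sc ffunE cards0 expr0 mul1r. Qed.

Lemma clconjD x y : clconj (x + y) = clconj x + clconj y.
Proof. by apply/ffunP => A; rewrite !ffunE mulrDr. Qed.
Lemma clconjZ a x : clconj (a *: x) = a *: clconj x.
Proof. by apply/ffunP => A; rewrite !ffunE /GRing.scale /= mulrCA. Qed.
Lemma clconj1 : clconj (1 : Cl) = 1.
Proof.
apply/ffunP => A; rewrite !ffunE.
by case: eqP => [->|_]; rewrite ?mulr0 // cards0 expr0 mulr1.
Qed.

(** Only the products [e_A e_A^c = 1] contribute to the scalar part. Norms can thus be computed from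
    products and conjugation instead of coordinates. *)
Lemma sc_mul_conj x y : sc (x * clconj y) = ip x y.
Proof.
have sA (A : {set 'I_m}) : symdiff A finset.set0 = A.
  by apply/finset.setP => i; rewrite !inE andbF orbF.
rewrite /sc ffunE; apply: eq_bigr => A _; rewrite sA ffunE.
have := congr1 sc (clbasisM_conj A).
have -> : clconj (clbasis R A) = (-1) ^+ 'C(#|A|.+1, 2) *: clbasis R A.
  apply/ffunP => B; rewrite !ffunE /GRing.scale /=.
  by case: eqP => [->|_]; rewrite ?mulr0.
rewrite -scalerAr clbasisM sc1 !scZ /sc ffunE.
have -> : symdiff A A = finset.set0.
  by apply/finset.setP => i; rewrite !inE; case: (i \in A).
rewrite eqxx mulr1 => e.
transitivity ((-1) ^+ 'C(#|A|.+1, 2) * clsign R A A * (x A * y A)); first by ring.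
by rewrite e mul1r.
Qed.

Lemma ipC x y : ip x y = ip y x.
Proof. by apply: eq_bigr => A _; rewrite mulrC. Qed.
Lemma ip_conj x y : ip (clconj x) (clconj y) = ip x y.
Proof.
apply: eq_bigr => A _; rewrite !ffunE mulrACA -exprMn mulrNN mulr1 expr1n.
by rewrite mul1r.
Qed.
Lemma scC x y : sc (x * y) = sc (y * x).
Proof.
by rewrite -{1}[y]clconjK sc_mul_conj -ip_conj clconjK ipC -sc_mul_conj clconjK.
Qed.
Lemma ipDl x y z : ip (x + y) z = ip x z + ip y z.
Proof. by rewrite -!sc_mul_conj mulrDl scD. Qed.
Lemma ipZl a x y : ip (a *: x) y = a * ip x y.
Proof. by rewrite -!sc_mul_conj -scalerAl scZ. Qed.
Lemma ipDr x y z : ip z (x + y) = ip z x + ip z y.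
Proof. by rewrite ![ip z _]ipC ipDl. Qed.
Lemma ipZr a x y : ip y (a *: x) = a * ip y x.
Proof. by rewrite ![ip y _]ipC ipZl. Qed.

Lemma clnorm_sqr x : clnorm x ^+ 2 = ip x x.
Proof.
by rewrite /clnorm sqr_sqrtr ?sumr_ge0 // => A _; exact: sqr_ge0.
Qed.

Lemma ip_ge0 x : 0 <= ip x x.
Proof. by rewrite -clnorm_sqr sqr_ge0. Qed.

(** If [I^2 = -1], [t(I) = a] and [n(I) = b], then [a I = b - 1]. For nonzero [a] this makes [I] a
    real number of negative square, so [a = 0] and [I^c = - I]. *)
Lemma imag_sphereP I : imag_sphere I <-> clconj I = - I /\ I * I = -1.
Proof.
split=> [[qI]|[cI II]]; last first.
  split; last by rewrite expr2.
  right; exists 0, 1; split; last by rewrite expr0n /= mulr1 ltr0n.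
    by rewrite /cltr cI subrr scale0r.
  by rewrite /cln cI mulrN II opprK scale1r.
rewrite expr2 => II; split => //.
case: qI => [[a aI]|[a [b [tI nI ab]]]].
  move: II; rewrite aI -scalerAl mul1r => /(congr1 sc).
  rewrite !scZ scN sc1 => h; suff : (0 : R) < 0 by rewrite ltxx.
  by have := sqr_ge0 a; nra.
have cI : clconj I = a%:A - I by rewrite -tI /cltr addrAC subrr add0r.
have : a *: I = (b - 1)%:A.
  rewrite scalerBl scale1r -nI /cln cI mulrBr II -scalerAr mulr1.
  by rewrite opprK addrK.
have [a0 _|a0 E] := eqVneq a 0; first by rewrite cI a0 scale0r sub0r.
have IE : I = ((b - 1) / a)%:A.
  by rewrite mulrC -scalerA -E scalerA mulVf // scale1r.
move: II; rewrite IE -scalerAl mul1r => /(congr1 sc).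
rewrite !scZ scN sc1; move: ((b - 1) / a) => k h; suff : (0 : R) < 0 by rewrite ltxx.
by have := sqr_ge0 k; nra.
Qed.

Section Imaginary.
Variable I : Cl.
Hypothesis SI : imag_sphere I.

Lemma sc_imag : sc I = 0.
Proof.
by have [cI _] := (imag_sphereP I).1 SI; have := sc_conj I; rewrite cI scN; lra.
Qed.

Lemma ip_imag : ip I I = 1.
Proof.
have [cI II] := (imag_sphereP I).1 SI.
by rewrite -sc_mul_conj cI mulrN II opprK sc1.
Qed.

End Imaginary.

(** Both [|I + J|^2] and [|I - J|^2] are nonnegative. *)
Lemma ip_imag_bound I J : imag_sphere I -> imag_sphere J -> -1 <= ip I J <= 1.
Proof.
move=> /ip_imag SI /ip_imag SJ.
have := ip_ge0 (I + J); have := ip_ge0 (I + (-1) *: J).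
rewrite !ipDl !ipDr !ipZl !ipZr SI SJ (ipC J I); lra.
Qed.

(** [1], [I], [J] and [J * I] are unit vectors. The pairs [(I, J)] and [(1, J * I)] have inner
    products [ip I J] and [- ip I J]; all other pairs are orthogonal. *)
Lemma ip_two_slices I J a b c d : imag_sphere I -> imag_sphere J ->
  let x := (a%:A + I * b%:A) + J * (c%:A + I * d%:A) in
  ip x x = a ^+ 2 + b ^+ 2 + c ^+ 2 + d ^+ 2 + 2 * ip I J * (b * c - a * d).
Proof.
move=> SI SJ x.
have xE : x = a *: 1 + b *: I + (c *: J + d *: (J * I)).
  by rewrite /x mulrDr -!scalerAr !mulr1.
have [cI II] := (imag_sphereP I).1 SI; have [cJ JJ] := (imag_sphereP J).1 SJ.
have I1 : ip I 1 = 0 by rewrite -sc_mul_conj clconj1 mulr1 sc_imag.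
have J1 : ip J 1 = 0 by rewrite -sc_mul_conj clconj1 mulr1 sc_imag.
have JI : ip I J = - sc (J * I) by rewrite ipC -sc_mul_conj cI mulrN scN.
have JI1 : ip (J * I) 1 = sc (J * I) by rewrite -sc_mul_conj clconj1 mulr1.
have JII : ip (J * I) I = 0.
  by rewrite -sc_mul_conj cI mulrN -mulrA II mulrN1 opprK sc_imag.
have JIJ : ip (J * I) J = 0.
  by rewrite -sc_mul_conj cJ mulrN scN scC mulrA JJ mulN1r scN sc_imag // !oppr0.
have JIJI : ip (J * I) (J * I) = 1.
  rewrite -sc_mul_conj clconjM cI cJ mulrNN mulrA -[_ * I * I]mulrA II mulrN1.
  by rewrite mulNr JJ opprK sc1.
have O1 : ip (1 : Cl) 1 = 1 by rewrite -sc_mul_conj clconj1 mulr1 sc1.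
rewrite xE !ipDl !ipDr !ipZl !ipZr (ip_imag SI) (ip_imag SJ) O1 JIJI.
rewrite !(ipC 1) I1 J1 JI1 (ipC J I) (ipC I (J * I)) (ipC J (J * I)) JII JIJ JI.
ring.
Qed.

Lemma ip_slice I a b : imag_sphere I ->
  ip (a%:A + I * b%:A) (a%:A + I * b%:A) = a ^+ 2 + b ^+ 2.
Proof.
move=> SI; have := ip_two_slices a b 0 0 SI SI.
by rewrite /= scale0r mulr0 addr0 mulr0 addr0 => ->; ring.
Qed.

End CliffordNorm.

Section VectorNorm.
Variables (R : realType) (m n : nat).
Local Notation Cl := (clifford R m).
Local Notation C := (Cplx R).
Implicit Types (I J : Cl) (z : 'rV[C]_n).

Lemma vnorm_sqr (x : 'rV[Cl]_n) : vnorm x ^+ 2 = \sum_t ip (x 0 t) (x 0 t).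
Proof.
rewrite /vnorm sqr_sqrtr; last by apply: sumr_ge0 => t _; exact: sqr_ge0.
by apply: eq_bigr => t _; rewrite clnorm_sqr.
Qed.

Lemma vnorm_ge0 (x : 'rV[Cl]_n) : 0 <= vnorm x.
Proof. exact: sqrtr_ge0. Qed.

Lemma vnorm_slice J z : imag_sphere J -> vnorm (slice_point J z) = cnorm z.
Proof.
move=> SJ; apply/eqP; rewrite -(@eqrXn2 _ 2) ?vnorm_ge0 ?cnorm_ge0 //.
rewrite vnorm_sqr cnorm_sqr; apply/eqP/eq_bigr => t _.
by rewrite mxE ip_slice // cmod_sqr.
Qed.

Lemma cnorm_conj z : cnorm (cconj z) = cnorm z.
Proof.
apply/eqP; rewrite -(@eqrXn2 _ 2) ?cnorm_ge0 // !cnorm_sqr.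
by apply/eqP/eq_bigr => t _; rewrite mxE cmod_conj.
Qed.

(** The stem values are recovered from [F1 + I F2 = phi z] and [F1 - I F2 = phi (cconj z)], read in
    C_I, as half the sum and [- I] times half the difference. Both lie in C_I, so [ip_two_slices]
    gives the norm of [F1 + J F2]. *)
Lemma slice_norm_sqr (F : 'rV[C]_n -> cmodule R m n) f phi I J z :
  stem_mapping F -> induces F f -> imag_sphere I -> imag_sphere J ->
  (forall w, cball w -> f (slice_point I w) = slice_point I (phi w)) ->
  cball z ->
  vnorm (f (slice_point J z)) ^+ 2 =
    (1 + ip I J) / 2 * cnorm (phi z) ^+ 2 + (1 - ip I J) / 2 * cnorm (phi (cconj z)) ^+ 2.
Proof.
move=> Fs Ff SI SJ fphi zb.
have zb' : cball (cconj z) by rewrite /cball /= cnorm_conj.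
have [cI II] := (imag_sphereP I).1 SI.
have E1 : (F z).1 + I *: (F z).2 = slice_point I (phi z) by rewrite -fphi // -Ff.
have E2 : (F z).1 - I *: (F z).2 = slice_point I (phi (cconj z)).
  by rewrite -fphi // (Ff _ _ zb' SI) (Fs _ zb).1 (Fs _ zb).2 scalerN.
rewrite (Ff _ _ zb SJ) vnorm_sqr !cnorm_sqr !mulr_sumr -big_split /=.
apply: eq_bigr => s _; rewrite !cmod_sqr.
move/rowP/(_ s): E1; move/rowP/(_ s): E2; rewrite !mxE.
set p := complex.Re (phi z 0 s); set q := complex.Im (phi z 0 s).
set p' := complex.Re (phi (cconj z) 0 s); set q' := complex.Im (phi (cconj z) 0 s).
set F1 := (F z).1 0 s; set F2 := (F z).2 0 s => E2 E1.
have F1E : F1 = ((p + p') / 2)%:A + I * ((q + q') / 2)%:A.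
  apply: (@scalerI _ _ (2 : R)); first by rewrite pnatr_eq0.
  transitivity (F1 + I * F2 + (F1 - I * F2)).
    by rewrite addrACA subrr addr0 scaler_nat mulr2n.
  rewrite E1 E2 addrACA -mulrDr -!scalerDl scalerDr scalerA [_ *: (I * _)]scalerAr scalerA.
  by congr (_ %:A + I * _ %:A); field.
have F2E : F2 = ((q - q') / 2)%:A + I * (- ((p - p') / 2))%:A.
  have I2 x : x = - (I * (I * x)) by rewrite mulrA II mulN1r opprK.
  rewrite (I2 F2).
  have -> : I * F2 = ((p - p') / 2)%:A + I * ((q - q') / 2)%:A.
    apply: (@scalerI _ _ (2 : R)); first by rewrite pnatr_eq0.
    transitivity (F1 + I * F2 - (F1 - I * F2)).
      by rewrite opprB addrC addrA subrK scaler_nat mulr2n.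
    rewrite E1 E2 opprD addrACA -mulrBr -!scalerBl scalerDr scalerA [_ *: (I * _)]scalerAr scalerA.
    by congr (_ %:A + I * _ %:A); field.
  by rewrite mulrDr opprD -I2 scaleNr mulrN addrC.
by rewrite F1E F2E ip_two_slices //; field.
Qed.

End VectorNorm.

(** * From continuous partial derivatives to strict differentiability *)

Lemma differentiable_eps (K : numFieldType) (U W : normedModType K) (g : U -> W)
    (df : {linear U -> W}) (z : U) : continuous df ->
  (forall e : K, 0 < e -> \forall v \near (0 : U), `|g (v + z) - g z - df v| <= e * `|v|) ->
  differentiable g z.
Proof.
move=> dfc H.
have Ho : g \o shift z = cst (g z) + df +o_ 0 id.
  apply/eqaddoP => e e0; near do rewrite -![(_ - _ : _ -> _) _]/(_ - _)
    -![(_ + _ : _ -> _) _]/(_ + _) /= opprD addrA.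
  exact: H.
by apply/diff_locallyP; rewrite (diff_unique dfc Ho).
Unshelve. all: by end_near.
Qed.

Section Frechet.
Variables (R : realType) (n : nat).
Local Notation C := (Cplx R).
Local Notation V := 'rV[C]_n.
Implicit Types (g : V -> V) (z v : V) (M : 'M[C]_n).

(** Differentiability at one point: only [y] moves, whereas both points move in [mdiff]. *)
Definition fdiff g z M := forall e : R, 0 < e -> exists2 d : R, 0 < d & forall y,
  cnorm (y - z) < d -> cnorm (g y - g z - (y - z) *m M) <= e * cnorm (y - z).

Lemma mxnorm_le_cnorm v : `|v| <= rc (cnorm v).
Proof.
have [->|v0] := eqVneq `|v| 0; first by rewrite lecR cnorm_ge0.
have [[i j] /= E] := @mx_norm_neq0 _ _ _ v v0.
change (mx_norm v <= rc (cnorm v)).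
by rewrite E normE lecR (ord1 i) coord_le_cnorm.
Qed.

Lemma mxnorm_rc v : `|v| = rc (complex.Re `|v|).
Proof. by rewrite /rc RRe_real // normr_real. Qed.

Lemma cnorm_le_mxnorm v : cnorm v <= n%:R * complex.Re `|v|.
Proof.
apply: le_trans (cnorm_le_sum v) _.
apply: (@le_trans _ _ (\sum_(t < n) complex.Re `|v|)); last first.
  by rewrite sumr_const card_ord [leRHS]mulr_natl.
apply: ler_sum => t _; rewrite leNgt; apply/negP => h.
have : ball (0 : V) (rc (cmod (v 0 t))) v.
  by rewrite mx_norm_ball /ball_ /= sub0r normrN mxnorm_rc ltcR.
move=> [_ /(_ 0 t)]; rewrite -ball_normE /= mxE sub0r normrN normE ltcR.
by rewrite ltxx.
Qed.

Lemma linear_row_mx (L : {linear V -> V}) v :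
  L v = v *m (\matrix_(t, s) L (delta_mx 0 t) 0 s).
Proof.
rewrite {1}[v]row_sum_delta linear_sum; apply/rowP => s; rewrite summxE !mxE.
by apply: eq_bigr => t _; rewrite linearZ !mxE.
Qed.

Lemma differentiable_fdiff g z : differentiable g z -> exists M, fdiff g z M.
Proof.
move=> gd.
exists (\matrix_(t, s) 'd g z (delta_mx 0 t) 0 s) => e e0.
have /eqaddoP H := diff_locally gd.
have n1 : 0 < (n.+1%:R : R) by rewrite ltr0n.
have e1 : 0 < rc (e / n.+1%:R) by rewrite ltcR divr_gt0.
have /nbhs_cnorm [d d0 dP] := H _ e1.
exists d => // y yd.
have := dP (y - z); rewrite subr0 => /(_ yd).
rewrite -linear_row_mx.
have -> : (g \o shift z - (cst (g z) + 'd g z)) (y - z) = g y - g z - 'd g z (y - z).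
  rewrite -![(_ - _ : _ -> _) _]/(_ - _) -![(_ + _ : _ -> _) _]/(_ + _) /=.
  by rewrite /shift subrK opprD addrA.
move=> h1.
apply: le_trans (cnorm_le_mxnorm _) _.
have {h1} : complex.Re `|g y - g z - 'd g z (y - z)| <= e / n.+1%:R * cnorm (y - z).
  rewrite -lecR -/(rc _) -mxnorm_rc -/(rc _) rcM; apply: le_trans h1 _.
  by rewrite ler_pM2l // mxnorm_le_cnorm.
move=> h2; apply: le_trans (ler_wpM2l (ler0n _ _) h2) _.
rewrite mulrA ler_wpM2r ?cnorm_ge0 // mulrCA; apply: ler_piMr; first exact: ltW.
by rewrite ler_pdivrMr // mul1r ler_nat.
Qed.

Lemma fdiff_differentiable g z M : fdiff g z M -> differentiable g z.
Proof.
move=> gd.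
pose df : {linear V -> V} := mulmxr M.
have dfc : continuous df.
  move=> x P /nbhs_cnorm [d d0 dP]; apply/nbhs_cnorm.
  have K0 : 0 < opbound M + 1 by have := opbound_ge0 M; lra.
  exists (d / (opbound M + 1)); first by rewrite divr_gt0.
  move=> y; rewrite ltr_pdivlMr // mulrC => h; apply: dP.
  rewrite -linearB; apply: le_lt_trans (cnorm_mulmx _ _) _; apply: le_lt_trans h.
  by rewrite ler_wpM2r ?cnorm_ge0 //; lra.
apply: (@differentiable_eps _ _ _ g df) => // e e0; apply/nbhs_cnorm.
have eR : e = rc (complex.Re e) by rewrite /rc RRe_real // gtr0_real.
have n1 : 0 < (n.+1%:R : R) by rewrite ltr0n.
have e1 : 0 < complex.Re e / n.+1%:R by rewrite divr_gt0 //; move: e0; rewrite eR ltcR.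
have [d d0 dP] := gd _ e1; exists d => // v; rewrite subr0 => vd.
have := dP (v + z); rewrite addrK => /(_ vd) h.
apply: le_trans (mxnorm_le_cnorm _) _.
rewrite [`|v|]mxnorm_rc eR -rcM lecR; apply: le_trans h _.
have E0 : 0 <= complex.Re e by move: e0; rewrite {1}eR ltcR => /ltW.
rewrite -mulrA ler_wpM2l // ler_pdivrMl //.
apply: le_trans (cnorm_le_mxnorm _) _.
rewrite ler_wpM2r ?ler_nat //.
by have := normr_ge0 v; rewrite {1}mxnorm_rc lecR.
Qed.

End Frechet.

Section StrictFromFrechet.
Variables (R : realType) (n : nat).
Local Notation C := (Cplx R).
Local Notation V := 'rV[C]_n.
Implicit Types (g h : V -> V) (z v : V) (M : 'M[C]_n).

Lemma fdiff_lip g z M : fdiff g z M -> exists2 d : R, 0 < d & forall y,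
  cnorm (y - z) < d -> cnorm (g y - g z) <= (opbound M + 1) * cnorm (y - z).
Proof.
move=> /(_ _ ltr01) [d d0 dP]; exists d => // y yd.
have := dP y yd; have := cnormD (g y - g z - (y - z) *m M) ((y - z) *m M).
by rewrite subrK; have := cnorm_mulmx (y - z) M; lra.
Qed.

Lemma fdiff_continuous g z M : fdiff g z M -> forall e : R, 0 < e ->
  exists2 d : R, 0 < d & forall y, cnorm (y - z) < d -> cnorm (g y - g z) < e.
Proof.
move=> /fdiff_lip [d d0 dP] e e0.
have K0 : 0 < opbound M + 1 by have := opbound_ge0 M; lra.
exists (Num.min d (e / (opbound M + 1))); first by rewrite lt_min d0 divr_gt0.
move=> y; rewrite lt_min => /andP [/dP yd ye].
by apply: le_lt_trans yd _; rewrite mulrC -ltr_pdivlMr.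
Qed.

(** Chain rule for [h (g y) = y], tested on small increments [rc t *: v]. *)
Lemma fdiff_inverse_mx g h z M M' : fdiff g z M -> fdiff h (g z) M' ->
  (exists2 d : R, 0 < d & forall y, cnorm (y - z) < d -> h (g y) = y) ->
  M *m M' = 1%:M.
Proof.
move=> gd hd [d0 d00 hg].
have hgz : h (g z) = z by apply: hg; rewrite subrr cnorm0.
suff E v : v *m (M *m M') = v.
  by apply/row_matrixP => i; rewrite rowE [RHS]rowE E mulmx1.
apply/eqP; rewrite -subr_eq0; apply/eqP/cnorm_eq0.
apply/le_anti; rewrite cnorm_ge0 andbT.
set K := cnorm v + cnorm (v *m M) + opbound M' * cnorm v.
apply: (@le_limit _ _ _ K) => e e0 e1; rewrite add0r.
have [d1 d10 d1P] := gd _ e0; have [d2 d20 d2P] := hd _ e0.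
have [d3 d30 d3P] := fdiff_continuous gd d20.
pose m0 := Num.min d0 (Num.min d1 d3).
have m00 : 0 < m0 by rewrite !lt_min d00 d10.
have v1 : 0 < cnorm v + 1 by have := cnorm_ge0 v; lra.
pose t := m0 / (cnorm v + 1).
have t0 : 0 < t by rewrite divr_gt0.
pose y := z + rc t *: v.
have yz : y - z = rc t *: v by rewrite /y addrC addKr.
have cyz : cnorm (y - z) = t * cnorm v by rewrite yz cnormZ cmod_rc gtr0_norm.
have : cnorm (y - z) < m0.
  rewrite cyz /t mulrAC ltr_pdivrMr // ltr_pM2l //; lra.
rewrite !lt_min => /andP [y0 /andP [y1 y3]].
have H1 := d1P _ y1; have H2 := d2P _ (d3P _ y3).
rewrite (hg _ y0) hgz in H2; rewrite cyz in H1; rewrite yz in H1 H2.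
set D := g y - g z in H1 H2.
have D1 : cnorm D <= t * (cnorm v + cnorm (v *m M)).
  have := cnormD (D - (rc t *: v) *m M) ((rc t *: v) *m M).
  rewrite subrK -{2}scalemxAl [cnorm (rc t *: _)]cnormZ cmod_rc gtr0_norm //.
  have : e * (t * cnorm v) <= 1 * (t * cnorm v).
    by rewrite ler_wpM2r // mulr_ge0 ?cnorm_ge0 // ltW.
  by move: H1; lra.
have H3 : cnorm ((D - (rc t *: v) *m M) *m M') <= opbound M' * (e * (t * cnorm v)).
  apply: le_trans (cnorm_mulmx _ _) _.
  by rewrite ler_wpM2l ?opbound_ge0.
have E : rc t *: (v *m (M *m M') - v) =
   - (rc t *: v - D *m M') - (D - (rc t *: v) *m M) *m M'.
  have -> : (D - (rc t *: v) *m M) *m M' = D *m M' - rc t *: (v *m (M *m M')).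
    by rewrite mulmxBl -!scalemxAl mulmxA.
  by rewrite scalerBr !opprB [RHS]addrC addrA subrK.
have : cnorm (rc t *: (v *m (M *m M') - v)) <= t * (e * K).
  rewrite E; apply: le_trans (cnormB _ _) _; rewrite cnormN.
  apply: le_trans (lerD H2 H3) _.
  have := ler_wpM2l (ltW e0) D1; rewrite /K; lra.
by rewrite cnormZ cmod_rc gtr0_norm // ler_pM2l.
Qed.

(** Covers Re and Im at once, because the mean value theorem is about real functions. *)
Definition real_part_like (rho : C -> R) :=
  [/\ forall x y, rho (x + y) = rho x + rho y,
      forall (h : R) x, rho (rc h * x) = h * rho x &
      forall x, `|rho x| <= cmod x].

Lemma Re_part_like : real_part_like (@complex.Re R).
Proof.
split=> [|h x|]; [exact: cReD | | exact: cRe_le_cmod].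
by rewrite cReM cRe_rc cIm_rc mul0r subr0.
Qed.

Lemma Im_part_like : real_part_like (@complex.Im R).
Proof.
split=> [|h x|]; [exact: cImD | | exact: cIm_le_cmod].
by rewrite cImM cRe_rc cIm_rc mul0r addr0.
Qed.

Lemma part_likeB rho x y : real_part_like rho -> rho (x - y) = rho x - rho y.
Proof.
move=> [rD rZ _]; rewrite rD; congr (_ + _).
have := rZ (-1) y; rewrite rcN rc1 !mulN1r; exact.
Qed.

Lemma part_line_derive rho g x M v s (t : R) : real_part_like rho ->
  fdiff g (x + rc t *: v) M ->
  is_derive t 1 (fun k : R => rho (g (x + rc k *: v) 0 s)) (rho ((v *m M) 0 s)).
Proof.
move=> rr gd; have [rD rZ rN] := rr; apply: is_derive_eps => e e0.
have v0 : 0 < cnorm v + 1 by have := cnorm_ge0 v; lra.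
have [d d0 dP] := gd _ (divr_gt0 e0 v0).
exists (d / (cnorm v + 1)); first by rewrite divr_gt0.
move=> h hd; have E : x + rc (t + h) *: v - (x + rc t *: v) = rc h *: v.
  by rewrite rcD scalerDl addrA [X in X - _]addrC addrK.
have ch : cnorm (rc h *: v) = `|h| * cnorm v by rewrite cnormZ cmod_rc.
have := dP (x + rc (t + h) *: v); rewrite E ch => /(_ _) H.
have {}H : cnorm (g (x + rc (t + h) *: v) - g (x + rc t *: v) - rc h *: v *m M) <= e * `|h|.
  apply: le_trans (H _) _.
    move: hd; rewrite ltr_pdivlMr // => hd; apply: le_lt_trans hd.
    by rewrite ler_wpM2l //; lra.
  rewrite mulrAC ler_pdivrMr // -[leRHS]mulrA ler_pM2l // ler_wpM2l //; lra.
have := le_trans (rN _) (le_trans (coord_le_cnorm _ s) H).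
by rewrite -scalemxAl !mxE !(part_likeB _ _ rr) rZ [_ * h]mulrC.
Qed.

(** One-variable mean value theorem on the segment from [a] to [b], for [rho] of a coordinate of [g]
    minus its linear part under [N]. *)
Lemma part_mean_value rho g (M : V -> 'M[C]_n) a b s (e : R) N : real_part_like rho ->
  (forall t : R, 0 <= t -> t <= 1 -> fdiff g (a + rc t *: (b - a)) (M (a + rc t *: (b - a)))) ->
  (forall t : R, 0 <= t -> t <= 1 -> opbound (M (a + rc t *: (b - a)) - N) <= e) ->
  `|rho ((g b - g a - (b - a) *m N) 0 s)| <= e * cnorm (b - a).
Proof.
move=> rr gd MN; have [rD rZ rN] := rr.
pose x t := a + rc t *: (b - a).
pose c := rho (((b - a) *m N) 0 s).
pose G t := rho (g (x t) 0 s) - c * t.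
pose dG t := rho (((b - a) *m M (x t)) 0 s) - c.
have Gd t : t \in `[(0 : R), 1] -> is_derive t 1 G (dG t).
  rewrite in_itv /= => /andP [t0 t1].
  have D1 := part_line_derive s rr (gd t t0 t1).
  have D2 : is_derive t 1 (fun h : R => c * h) c.
    apply: is_derive_eps => e' e'0; exists 1 => // h _.
    have -> : c * (t + h) - c * t - c * h = 0 by ring.
    by rewrite normr0 mulr_ge0 // ltW.
  exact: is_deriveB D1 D2.
have Gc : {within `[(0 : R), 1], continuous G}.
  apply: continuous_in_subspaceT => t /set_mem /= /Gd [dd _].
  exact/differentiable_continuous/derivable1_diffP.
have Goo t : t \in `](0 : R), 1[ -> is_derive t 1 G (dG t).
  by move=> /subset_itv_oo_cc; exact: Gd.
have [u + Gu] := MVT_segment ler01 Goo Gc.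
rewrite in_itv /= => /andP [u0 u1].
have -> : rho ((g b - g a - (b - a) *m N) 0 s) = G 1 - G 0.
  rewrite /G /x scale1r scale0r addr0 [a + (b - a)]addrC subrK mulr1 mulr0 subr0 /c.
  by rewrite !mxE !(part_likeB _ _ rr) addrAC.
rewrite Gu subr0 mulr1 /dG /c -(part_likeB _ _ rr).
have -> : ((b - a) *m M (x u)) 0 s - ((b - a) *m N) 0 s = ((b - a) *m (M (x u) - N)) 0 s.
  by rewrite mulmxBr !mxE.
apply: le_trans (rN _) _; apply: le_trans (coord_le_cnorm _ _) _.
apply: le_trans (cnorm_mulmx _ _) _; rewrite ler_wpM2r ?cnorm_ge0 //; exact: MN.
Qed.

(** Differentiability near [c] with derivative continuous at [c] is strict at [c]: [part_mean_value]
    applies on segments inside the ball. The factor [2 * n.+1] accounts for the real and imaginary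
    parts of the coordinates. *)
Lemma fdiff_mdiff g (M : V -> 'M[C]_n) c (r : R) : 0 < r ->
  (forall x, cnorm (x - c) < r -> fdiff g x (M x)) ->
  (forall e : R, 0 < e -> exists2 d : R, 0 < d & forall x, cnorm (x - c) < d ->
     opbound (M x - M c) <= e) ->
  mdiff g c (M c).
Proof.
move=> r0 gd Mc e e0.
have n0 : 0 < (2 * n.+1%:R : R) by rewrite mulr_gt0 // ltr0n.
have [d d0 dP] := Mc _ (divr_gt0 e0 n0).
exists (Num.min r d); first by rewrite lt_min r0.
move=> a b; rewrite !lt_min => /andP [ar ad] /andP [br bd].
have seg k t : cnorm (a - c) < k -> cnorm (b - c) < k -> 0 <= t -> t <= 1 ->
    cnorm (a + rc t *: (b - a) - c) < k.
  move=> ak bk t0 t1.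
  have -> : a + rc t *: (b - a) - c = rc (1 - t) *: (a - c) + rc t *: (b - c).
    rewrite rcB rc1 scalerBl scale1r -[RHS]addrA [- _ + _]addrC -scalerBr.
    by rewrite opprB addrA subrK addrAC.
  apply: le_lt_trans (cnormD _ _) _; rewrite !cnormZ !cmod_rc !ger0_norm ?subr_ge0 //.
  have [->|tn0] := eqVneq t 0; first by rewrite subr0; lra.
  have tp : 0 < t by rewrite lt_neqAle eq_sym tn0.
  have : (1 - t) * cnorm (a - c) <= (1 - t) * k by rewrite ler_wpM2l ?subr_ge0 // ltW.
  have : t * cnorm (b - c) < t * k by rewrite ltr_pM2l.
  by lra.
have H rho s : real_part_like rho ->
    `|rho ((g b - g a - (b - a) *m M c) 0 s)| <= e / (2 * n.+1%:R) * cnorm (b - a).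
  move=> rr; apply: (@part_mean_value rho g M) => // t t0 t1.
    by apply: gd; apply: seg.
  by apply: dP; apply: seg.
apply: le_trans (cnorm_le_sum _) _.
apply: (@le_trans _ _ (\sum_(s < n) (2 * (e / (2 * n.+1%:R) * cnorm (b - a))))).
  apply: ler_sum => s _; apply: le_trans (cmod_le_ReIm _) _.
  by rewrite [leRHS]mulr_natl mulr2n lerD // H //; [exact: Re_part_like|exact: Im_part_like].
rewrite sumr_const card_ord -[leLHS]mulr_natl.
have -> : n%:R * (2 * (e / (2 * n.+1%:R) * cnorm (b - a))) =
   e * cnorm (b - a) * (n%:R / n.+1%:R) :> R.
  have : (n.+1%:R : R) != 0 by rewrite pnatr_eq0.
  by move: (n.+1%:R : R) => k k0; field.
apply: ler_piMr; first by rewrite mulr_ge0 ?cnorm_ge0 // ltW.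
by rewrite ler_pdivrMr ?ltr0n // mul1r ler_nat.
Qed.

End StrictFromFrechet.

Section FiniteSums.
Variable R : realType.

Lemma is_derive_bigsum (I : finType) (k : I -> R -> R) (k' : I -> R) (x : R) (a : I -> R) :
  (forall i, is_derive x 1 (k i) (k' i)) ->
  is_derive x 1 (fun h => \sum_i k i h * a i) (\sum_i k' i * a i).
Proof.
move=> kd; rewrite /index_enum; elim: (Finite.enum I) => [|i r IH].
  rewrite big_nil (_ : (fun h => _) = cst 0); first exact: is_derive_cst.
  by apply/funext => h; rewrite big_nil.
rewrite big_cons (_ : (fun h => _) = (a i \*: k i) + (fun h => \sum_(j <- r) k j h * a j)).
  by rewrite [k' i * a i]mulrC; exact: (is_deriveD (is_deriveZ (a i) (kd i)) IH).
by apply/funext => h; rewrite big_cons mulrC.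
Qed.

Definition eps_continuous (n : nat) (g : 'rV[Cplx R]_n -> R) c := forall e : R, 0 < e ->
  exists2 d : R, 0 < d & forall x, cnorm (x - c) < d -> `|g x - g c| <= e.

Lemma eps_continuous_bigsum n (I : finType) (k : I -> 'rV[Cplx R]_n -> R) c (a : I -> R) :
  (forall i, eps_continuous (k i) c) -> eps_continuous (fun x => \sum_i k i x * a i) c.
Proof.
move=> kc; rewrite /eps_continuous /index_enum; elim: (Finite.enum I) => [|i r IH] e e0.
  by exists 1 => // x _; rewrite !big_nil subrr normr0 ltW.
have e20 : 0 < e / 2 by rewrite divr_gt0.
have a0 : 0 < `|a i| + 1 by have := normr_ge0 (a i); lra.
have [d d0 dP] := IH _ e20; have [d1 d10 d1P] := kc i _ (divr_gt0 e20 a0).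
exists (Num.min d d1) => [|x]; first by rewrite lt_min d0.
rewrite lt_min => /andP [/dP h1 /d1P h2]; rewrite !big_cons.
rewrite opprD addrACA -mulrBl; apply: le_trans (ler_normD _ _) _.
rewrite normrM; move: h2; rewrite ler_pdivlMr // => h2.
have : `|k i x - k i c| * `|a i| <= `|k i x - k i c| * (`|a i| + 1).
  by rewrite ler_wpM2l //; lra.
by move: h1 h2; lra.
Qed.

Lemma eps_continuousD n (g h : 'rV[Cplx R]_n -> R) c :
  eps_continuous g c -> eps_continuous h c -> eps_continuous (fun x => g x + h x) c.
Proof.
move=> gc hc e e0; have e20 : 0 < e / 2 by rewrite divr_gt0.
have [d d0 dP] := gc _ e20; have [d1 d10 d1P] := hc _ e20.
exists (Num.min d d1) => [|x]; first by rewrite lt_min d0.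
rewrite lt_min => /andP [/dP h1 /d1P h2].
rewrite opprD addrACA; apply: le_trans (ler_normD _ _) _; lra.
Qed.

Lemma eps_continuous_at_zero n (g : 'rV[Cplx R]_n -> R) c : g c = 0 -> (forall x, 0 <= g x) ->
  (forall e : R, 0 < e -> exists2 d : R, 0 < d & forall x, cnorm (x - c) < d -> g x <= e) ->
  eps_continuous g c.
Proof.
move=> gc g0 H e /H [d d0 dP]; exists d => // x /dP.
by rewrite gc subr0 ger0_norm.
Qed.

Lemma continuous_eps n (g : 'rV[Cplx R]_n -> R) c : {for c, continuous g} -> eps_continuous g c.
Proof.
move=> gc e e0; have /nbhs_cnorm [d d0 dP] : nbhs c [set x | `|g c - g x| <= e].
  by move/cvgrPdist_le: gc; exact.
by exists d => // x /dP; rewrite distrC.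
Qed.

End FiniteSums.

(** * The Jacobian of a slice mapping read in C^n *)

Section SliceComponents.
Variables (R : realType) (m n : nat).
Local Notation Cl := (clifford R m).
Local Notation C := (Cplx R).
Local Notation V := 'rV[C]_n.
Implicit Types (I J : Cl) (x z : V).

(** The stem is C^1 coordinate by coordinate; scalar parts and inner products with [I] inherit this
    through the expansion. *)
Lemma real_linear_coord (L : Cl -> R) (X : Cl) :
  (forall X Y, L (X + Y) = L X + L Y) -> (forall a X, L (a *: X) = a * L X) ->
  L X = \sum_A X A * L (clbasis R A).
Proof.
move=> LD LZ; rewrite {1}[X]clifford_sum.
have L0 : L 0 = 0 by rewrite -(scale0r 0) LZ mul0r.
by elim/big_rec2: _ => [//|A a b _ <-]; rewrite LD LZ.
Qed.

(* Inverse of the identification z |-> Re z + I Im z of C with C_I. *)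
Definition toC I (X : Cl) : C := Complex (sc X) (ip X I).

Lemma toC_slice I (z : C) : imag_sphere I ->
  toC I ((complex.Re z)%:A + I * (complex.Im z)%:A) = z.
Proof.
move=> SI; have [cI II] := (imag_sphereP I).1 SI.
rewrite /toC -scalerAr mulr1 scD !scZ sc1 (sc_imag SI) ipDl !ipZl (ip_imag SI).
have -> : ip 1 I = 0 by rewrite ipC -sc_mul_conj clconj1 mulr1 sc_imag.
by apply: CeqP => /=; ring.
Qed.

Variables (I : Cl) (F : V -> cmodule R m n).

Definition slice_map x : V := \row_s toC I ((F x).1 0 s + I * (F x).2 0 s).

(** For a holomorphic map the real directions [dir_alpha] determine the derivative. The direction
    [t] is the row index because matrices act on row vectors. *)
Definition slice_jacobian x : 'M[C]_n := \matrix_(t, s)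
  toC I ((stem_pderiv F s (dir_alpha R t) x).1 + I * (stem_pderiv F s (dir_alpha R t) x).2).

Hypothesis FC1 : stem_C1 F.

Lemma dir_alpha_dir (t : 'I_n) :
  exists t', dir_alpha R t = dir_alpha R t' \/ dir_alpha R t = dir_beta R t'.
Proof. by exists t; left. Qed.

Lemma stem_line_derive x s t (A : {set 'I_m}) : cball x ->
  is_derive (0 : R) 1 (fun h : R => (F (x + rc h *: delta_mx 0 t)).1 0 s A)
    ((stem_pderiv F s (dir_alpha R t) x).1 A) /\
  is_derive (0 : R) 1 (fun h : R => (F (x + rc h *: delta_mx 0 t)).2 0 s A)
    ((stem_pderiv F s (dir_alpha R t) x).2 A).
Proof.
move=> xb; have [C1 C2] := FC1 s A.
have [d1 _] := C1 _ (dir_alpha_dir t) _ xb; have [d2 _] := C2 _ (dir_alpha_dir t) _ xb.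
by split; apply: DeriveDef; [exact: d1 | rewrite ffunE /pderiv derive1E
  | exact: d2 | rewrite ffunE /pderiv derive1E].
Qed.

Lemma real_linear_line_derive (L : Cl -> R) x s t :
  (forall X Y, L (X + Y) = L X + L Y) -> (forall a X, L (a *: X) = a * L X) -> cball x ->
  is_derive (0 : R) 1 (fun h : R => L ((F (x + rc h *: delta_mx 0 t)).1 0 s +
      I * (F (x + rc h *: delta_mx 0 t)).2 0 s))
    (L ((stem_pderiv F s (dir_alpha R t) x).1 + I * (stem_pderiv F s (dir_alpha R t) x).2)).
Proof.
move=> LD LZ xb; rewrite LD.
have L2D X Y : L (I * (X + Y)) = L (I * X) + L (I * Y) by rewrite mulrDr LD.
have L2Z a X : L (I * (a *: X)) = a * L (I * X) by rewrite -scalerAr LZ.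
rewrite (_ : (fun h => _) =
  (fun h : R => \sum_A (F (x + rc h *: delta_mx 0 t)).1 0 s A * L (clbasis R A)) +
  (fun h : R => \sum_A (F (x + rc h *: delta_mx 0 t)).2 0 s A * L (I * clbasis R A))).
  rewrite (real_linear_coord _ LD LZ) (@real_linear_coord (fun X => L (I * X)) _ L2D L2Z).
  by apply: is_deriveD; apply: is_derive_bigsum => A; case: (stem_line_derive s t A xb).
apply/funext => h; rewrite LD (real_linear_coord _ LD LZ).
by rewrite (@real_linear_coord (fun X => L (I * X)) _ L2D L2Z).
Qed.

Lemma real_linear_pderiv_continuous (L : Cl -> R) x s t :
  (forall X Y, L (X + Y) = L X + L Y) -> (forall a X, L (a *: X) = a * L X) -> cball x ->
  eps_continuous (fun x => L ((stem_pderiv F s (dir_alpha R t) x).1 +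
                     I * (stem_pderiv F s (dir_alpha R t) x).2)) x.
Proof.
move=> LD LZ xb.
have L2D X Y : L (I * (X + Y)) = L (I * X) + L (I * Y) by rewrite mulrDr LD.
have L2Z a X : L (I * (a *: X)) = a * L (I * X) by rewrite -scalerAr LZ.
rewrite (_ : (fun x => _) =
  (fun y => (\sum_A (stem_pderiv F s (dir_alpha R t) y).1 A * L (clbasis R A)) +
    \sum_A (stem_pderiv F s (dir_alpha R t) y).2 A * L (I * clbasis R A))); last first.
  apply/funext => y; rewrite LD (real_linear_coord _ LD LZ).
  by rewrite (@real_linear_coord (fun X => L (I * X)) _ L2D L2Z).
apply: eps_continuousD.
  apply: (@eps_continuous_bigsum _ _ _ (fun A y => (stem_pderiv F s (dir_alpha R t) y).1 A)) => A.
  have [C1 C2] := FC1 s A.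
  rewrite (_ : (fun y => _) = pderiv (fun z => (F z).1 0 s A) (dir_alpha R t)).
    by apply: continuous_eps; have [_] := C1 _ (dir_alpha_dir t) _ xb.
  by apply/funext => y; rewrite ffunE.
apply: (@eps_continuous_bigsum _ _ _ (fun A y => (stem_pderiv F s (dir_alpha R t) y).2 A)) => A.
have [C1 C2] := FC1 s A.
rewrite (_ : (fun y => _) = pderiv (fun z => (F z).2 0 s A) (dir_alpha R t)).
  by apply: continuous_eps; have [_] := C2 _ (dir_alpha_dir t) _ xb.
by apply/funext => y; rewrite ffunE.
Qed.

Lemma ip_real_linear : (forall X Y, ip (X + Y) I = ip X I + ip Y I) /\
  (forall a X, ip (a *: X) I = a * ip X I).
Proof. by split=> *; rewrite ?ipDl ?ipZl. Qed.

(** Along each real direction, the real and imaginary parts of the coordinates have a single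
    derivative, given both by [M] and by the stem. *)
Lemma slice_jacobian_unique x M : cball x -> fdiff slice_map x M -> M = slice_jacobian x.
Proof.
move=> xb Md; apply/matrixP => t s; rewrite [RHS]mxE.
have E rho : real_part_like rho -> is_derive (0 : R) 1
    (fun h : R => rho (slice_map (x + rc h *: delta_mx 0 t) 0 s)) (rho (M t s)).
  move=> rr; have M0 : fdiff slice_map (x + rc 0 *: delta_mx 0 t) M.
    by rewrite rc0 scale0r addr0.
  have := part_line_derive s rr M0.
  by rewrite -rowE mxE.
have [LD LZ] := ip_real_linear.
apply: CeqP => /=.
  have := E _ (Re_part_like R).
  have -> : (fun h : R => complex.Re (slice_map (x + rc h *: delta_mx 0 t) 0 s)) =
    (fun h : R => sc ((F (x + rc h *: delta_mx 0 t)).1 0 s + I * (F (x + rc h *: delta_mx 0 t)).2 0 s)).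
    by apply/funext => h; rewrite mxE.
  move=> [_ <-]; have [_ <-] := @real_linear_line_derive (@sc R m) x s t (@scD R m) (@scZ R m) xb.
  by [].
have := E _ (Im_part_like R).
have -> : (fun h : R => complex.Im (slice_map (x + rc h *: delta_mx 0 t) 0 s)) =
  (fun h : R => ip ((F (x + rc h *: delta_mx 0 t)).1 0 s + I * (F (x + rc h *: delta_mx 0 t)).2 0 s) I).
  by apply/funext => h; rewrite mxE.
move=> [_ <-]; have [_ <-] := @real_linear_line_derive (fun X => ip X I) x s t LD LZ xb.
by [].
Qed.

Lemma slice_jacobian_continuous x : cball x -> forall e : R, 0 < e ->
  exists2 d : R, 0 < d & forall y, cnorm (y - x) < d ->
    opbound (slice_jacobian y - slice_jacobian x) <= e.
Proof.
move=> xb.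
have [LD LZ] := ip_real_linear.
have n0 : 0 < (n.+1%:R : R) by rewrite ltr0n.
have en t s : forall e : R, 0 < e -> exists2 d : R, 0 < d & forall y, cnorm (y - x) < d ->
    cmod (slice_jacobian y t s - slice_jacobian x t s) <= e.
  move=> e e0; have e20 : 0 < e / 2 by rewrite divr_gt0.
  have [d1 d10 d1P] := @real_linear_pderiv_continuous (@sc R m) x s t (@scD R m) (@scZ R m) xb _ e20.
  have [d2 d20 d2P] := @real_linear_pderiv_continuous (fun X => ip X I) x s t LD LZ xb _ e20.
  exists (Num.min d1 d2) => [|y]; first by rewrite lt_min d10.
  rewrite lt_min => /andP [/d1P h1 /d2P h2].
  apply: le_trans (cmod_le_ReIm _) _; rewrite !mxE cReD cImD cReN cImN /=.
  by move: h1 h2; lra.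
pose sumE := fun y => \sum_(p : 'I_n * 'I_n) cmod (slice_jacobian y p.1 p.2 - slice_jacobian x p.1 p.2) * 1.
have obE y : opbound (slice_jacobian y - slice_jacobian x) = sumE y.
  rewrite /opbound exchange_big pair_bigA /=; apply: eq_bigr => p _.
  by rewrite mulr1 !mxE.
have /= H : eps_continuous sumE x.
  apply: (@eps_continuous_bigsum _ _ _ (fun p y => cmod (slice_jacobian y p.1 p.2 - slice_jacobian x p.1 p.2))).
  move=> p; apply: eps_continuous_at_zero; last exact: en.
    by rewrite subrr cmod0.
  by move=> y; exact: cmod_ge0.
move=> e /H [d d0 dP]; exists d => // y /dP.
have -> : sumE x = 0 by rewrite /sumE big1 // => p _; rewrite subrr cmod0 mul0r.
by rewrite subr0 obE; apply: le_trans; exact: ler_norm.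
Qed.

End SliceComponents.

Section Congruence.
Variables (R : realType) (n : nat).
Local Notation V := 'rV[Cplx R]_n.
Implicit Types (g h : V -> V) (z : V) (M : 'M[Cplx R]_n).

Lemma fdiff_congr g h z M : (exists2 d : R, 0 < d & forall y, cnorm (y - z) < d -> g y = h y) ->
  fdiff g z M -> fdiff h z M.
Proof.
move=> [d0 d00 gh] gd e /gd [d d1 dP]; exists (Num.min d d0); first by rewrite lt_min d1.
move=> y; rewrite lt_min => /andP [yd y0].
by rewrite -!gh ?subrr ?cnorm0 //; exact: dP.
Qed.

Lemma cball_nbhs z : cball z -> exists2 d : R, 0 < d & forall y, cnorm (y - z) < d -> cball y.
Proof.
rewrite /cball /= => z1; exists (1 - cnorm z); first by rewrite subr_gt0.
by move=> y h; have := cnorm_lowB y z; lra.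
Qed.

End Congruence.

(** * Growth of slice convex functions *)

Section GrowthOnSlices.
Variables (R : realType) (m n : nat).
Local Notation Cl := (clifford R m).
Local Notation C := (Cplx R).
Local Notation V := 'rV[C]_n.
Implicit Types (I J : Cl) (z : V).

Lemma convex_set_comb (A : set V) z y (t : R) : convex_set A -> A z -> A y ->
  0 <= t -> t <= 1 -> A (rc (1 - t) *: z + rc t *: y).
Proof.
move=> Ac Az Ay t0 t1.
have t0' : 0 <= rc t by rewrite lecR.
have t1' : rc t <= 1 by rewrite -rc1 lecR.
have := Ac y z (Itv01 t0' t1') (mem_set Ay) (mem_set Az) => /set_mem.
have -> // : conv (Itv01 t0' t1') (y : convex_lmodType V) z = rc (1 - t) *: z + rc t *: y.
by rewrite addrC rcB.
Qed.

(** Complex differentiability gives [phi] a derivative at each point; it equals [slice_jacobian],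
    which is continuous, so [phi] is strictly differentiable. The chain rule makes the Jacobian
    invertible, and [mdiff_inverse] makes [psi] strictly differentiable, as [convex_growth]
    requires. *)
Lemma stem_convex_growth (F : V -> cmodule R m n) (phi : V -> V) I :
  stem_C1 F -> (forall z, cball z -> slice_map I F z = phi z) ->
  convex_mapping (@cball R n) phi -> phi 0 = 0 -> slice_jacobian I F 0 = 1%:M ->
  forall z, cball z -> cnorm z / (1 + cnorm z) <= cnorm (phi z) /\
    cnorm (phi z) <= cnorm z / (1 - cnorm z).
Proof.
move=> FC1 Fphi [[[_ phid] [psi [oim psid] psiphi]] phic] phi0 J0 z zb.
have [->|z0] := eqVneq z 0; first by rewrite phi0 cnorm0 !mul0r.
have fphi x : cball x -> fdiff phi x (slice_jacobian I F x).
  move=> xb; have [M Md] := differentiable_fdiff (phid _ xb).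
  have [d d0 dP] := cball_nbhs xb.
  suff <- : M = slice_jacobian I F x by [].
  apply: slice_jacobian_unique => //; apply: fdiff_congr Md.
  by exists d => // y /dP /Fphi ->.
have mphi x : cball x -> mdiff phi x (slice_jacobian I F x).
  move=> xb; have [d d0 dP] := cball_nbhs xb.
  apply: (fdiff_mdiff d0); last exact: slice_jacobian_continuous.
  by move=> y /dP; exact: fphi.
have key x : cball x -> slice_jacobian I F x \in unitmx /\
    mdiff psi (phi x) (invmx (slice_jacobian I F x)).
  move=> xb; have xim : (phi @` cball (n:=n)) (phi x) by exists x.
  have [M' pd] := differentiable_fdiff (psid _ xim).
  have MM : slice_jacobian I F x *m M' = 1%:M.
    apply: fdiff_inverse_mx (fphi _ xb) pd _.
    have [d d0 dP] := cball_nbhs xb; exists d => // y /dP; exact: psiphi.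
  have [Mu _] := mulmx1_unit MM; split => //.
  apply: mdiff_inverse => //; [exact: mphi | exact: psiphi|].
  move=> e e0; have [d d0 dP] := fdiff_continuous pd e0.
  have /nbhs_cnorm [d1 d10 d1P] : nbhs (phi x) (phi @` cball (n:=n)).
    by apply: open_nbhs_nbhs; split.
  exists (Num.min d d1) => [|w]; first by rewrite lt_min d0.
  rewrite lt_min => /andP [wd /d1P [y yb yw]].
  rewrite -[X in _ - X](psiphi _ xb); split; last exact: dP.
  by rewrite -yw psiphi.
have c0 : cball (0 : V) by rewrite /cball /= cnorm0.
apply: (@convex_growth R n phi psi) => //.
- move=> x y t xb yb t0 t1.
  have [w wb wE] : (phi @` cball (n:=n)) (rc (1 - t) *: phi x + rc t *: phi y).
    by apply: convex_set_comb.
  by exists w.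
- move=> x xb; have [Mu pd] := key _ xb.
  by exists (slice_jacobian I F x); split => //; exact: mphi.
- by rewrite -J0; exact: mphi.
- by have [_] := key _ c0; rewrite phi0 J0 invmx1.
Qed.

Lemma slice_point_inj I z y : imag_sphere I -> slice_point I z = slice_point I y -> z = y.
Proof.
move=> SI E; apply/rowP => t; move/rowP/(_ t): E; rewrite !mxE => E.
by rewrite -(toC_slice (z 0 t) SI) E toC_slice.
Qed.

Lemma slice_point0 I : slice_point I (0 : V) = 0.
Proof. by apply/rowP => t; rewrite !mxE /= scale0r mulr0 addr0. Qed.

Lemma slice_convex_growth f df : normalized_slice_convex f df ->
  forall x : 'rV[Cl]_n, qball x ->
    vnorm x / (1 + vnorm x) <= vnorm (f x) /\ vnorm (f x) <= vnorm x / (1 - vnorm x).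
Proof.
move=> [_ [I SI [_ [phi phic fphi]]] f0 [F [[Fs FC1 Fdbar] Ff dfF]] df0].
move=> _ [[J SJ [z _ <-]]]; rewrite vnorm_slice // => zb.
have c0 : cball (0 : V) by rewrite /cball /= cnorm0.
have Fphi w : cball w -> slice_map I F w = phi w.
  move=> wb; apply/rowP => s; rewrite mxE.
  have := Ff _ _ wb SI; rewrite fphi // => /rowP /(_ s); rewrite !mxE => <-.
  exact: toC_slice.
have phi0 : phi 0 = 0.
  by apply: (slice_point_inj SI); rewrite -fphi // slice_point0 f0.
(* The vanishing of [stem_dbar] identifies the derivative along [dir_alpha] with [stem_d], whose
   induced value at 0 is given by [df0]. *)
have J0 : slice_jacobian I F 0 = 1%:M.
  apply/matrixP => t s; rewrite mxE.
  have := dfF _ _ s t c0 SI; rewrite slice_point0 df0 => E.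
  have := Fdbar s t _ c0; rewrite /stem_dbar /stem_d /mul_i in E *.
  case: (stem_pderiv F s (dir_alpha R t) 0) (stem_pderiv F s (dir_beta R t) 0) E
    => [a1 a2] [b1 b2] /= E [/eqP + /eqP].
  rewrite !scaler_eq0 invr_eq0 pnatr_eq0 /= subr_eq0 addr_eq0 => /eqP ab /eqP ba.
  have half (X : Cl) : (2^-1 : R) *: (X + X) = X.
    by rewrite scalerDr -scalerDl -[RHS]scale1r; congr (_ *: _); lra.
  have -> : a1 + I * a2 = 1%:M s t.
    by rewrite E opprK -ab -ba !half.
  rewrite !mxE eq_sym; case: (t == s).
    by rewrite -[RHS](toC_slice 1 SI) /= scale1r scale0r mulr0 addr0.
  by rewrite -[RHS](toC_slice 0 SI) /= scale0r mulr0 addr0.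
have growth := stem_convex_growth FC1 Fphi phic phi0 J0.
have zb' : cball (cconj z) by rewrite /cball /= cnorm_conj.
have [l1 u1] := growth _ zb; have [l2 u2] := growth _ zb'.
rewrite cnorm_conj in l2 u2.
(* The weights are nonnegative with sum 1, and both norms satisfy the same bounds. *)
have E := slice_norm_sqr Fs Ff SI SJ fphi zb.
have /andP [t1 t2] := ip_imag_bound SI SJ.
set r := cnorm z in l1 u1 l2 u2 *; have r0 : 0 <= r by exact: cnorm_ge0.
have lo0 : 0 <= r / (1 + r) by rewrite divr_ge0 //; lra.
have hi0 : 0 <= r / (1 - r) by rewrite divr_ge0 // subr_ge0 ltW.
have sq (a b : R) : 0 <= a -> a <= b -> a ^+ 2 <= b ^+ 2.
  by move=> a0 ab; rewrite ler_sqr ?nnegrE //; apply: le_trans ab.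
have w1 : 0 <= (1 + ip I J) / 2 by rewrite divr_ge0 //; lra.
have w2 : 0 <= (1 - ip I J) / 2 by rewrite divr_ge0 //; lra.
split.
  rewrite -ler_sqr ?nnegrE ?vnorm_ge0 // E.
  have := ler_wpM2l w1 (sq _ _ lo0 l1); have := ler_wpM2l w2 (sq _ _ lo0 l2); lra.
rewrite -ler_sqr ?nnegrE ?vnorm_ge0 // E.
have := ler_wpM2l w1 (sq _ _ (cnorm_ge0 _) u1).
have := ler_wpM2l w2 (sq _ _ (cnorm_ge0 _) u2); lra.
Qed.

End GrowthOnSlices.

(** * Sharpness *)

Section SliceEmbedding.
Variables (R : realType) (m : nat).
Local Notation Cl := (clifford R m).
Local Notation C := (Cplx R).
Implicit Types (J : Cl) (a b : C).

Definition cemb J a : Cl := (complex.Re a)%:A + J * (complex.Im a)%:A.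
(* Inverse of X when X belongs to some C_J (with the junk value 0 at X = 0).   *)
Definition clinv (X : Cl) : Cl := (ip X X)^-1 *: clconj X.

Lemma clgen_imag (i : 'I_m) : imag_sphere (clgen R i).
Proof.
by apply/imag_sphereP; split; [exact: clconj_gen | exact: clgen_sqr].
Qed.

Lemma cembD J a b : cemb J (a + b) = cemb J a + cemb J b.
Proof. by rewrite /cemb cReD cImD !scalerDl mulrDr addrACA. Qed.

Lemma cemb_rc J (r : R) : cemb J (rc r) = r%:A.
Proof. by rewrite /cemb /= scale0r mulr0 addr0. Qed.

Lemma cembN J a : cemb J (- a) = - cemb J a.
Proof. by rewrite /cemb cReN cImN !scaleNr mulrN opprD. Qed.

Variable J : Cl.
Hypothesis SJ : imag_sphere J.

Lemma cembM a b : cemb J (a * b) = cemb J a * cemb J b.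
Proof.
have [_ JJ] := (imag_sphereP J).1 SJ.
have cE x : cemb J x = complex.Re x *: 1 + complex.Im x *: J.
  by rewrite /cemb -scalerAr mulr1.
rewrite !cE cReM cImM; move: (complex.Re a) (complex.Im a) (complex.Re b) (complex.Im b).
move=> p q r s.
have -> : (p *: 1 + q *: J) * (r *: 1 + s *: J) =
    (p * r) *: 1 + (p * s) *: J + ((q * r) *: J + (q * s) *: (J * J)).
  by rewrite mulrDl !mulrDr -!scalerAl -!scalerAr !mul1r mulr1 !scalerA.
rewrite JJ scalerN scalerBl scalerDl [_ *: J + - _]addrC addrACA.
by [].
Qed.

Lemma clinv_cemb a : clinv (cemb J a) = cemb J a^-1.
Proof.
have [cJ JJ] := (imag_sphereP J).1 SJ.
rewrite /clinv ip_slice // -cmod_sqr.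
have -> : clconj (cemb J a) = cemb J (Num.conj a).
  rewrite /cemb clconjD clconjM clconjZ clconj1 clconjZ clconj1 cJ cRe_conj cIm_conj.
  by rewrite scaleNr !mulrN -scalerAl mul1r -scalerAr mulr1.
have -> : a^-1 = rc ((cmod a ^+ 2)^-1) * Num.conj a.
  have [->|a0] := eqVneq a 0; first by rewrite invr0 rmorph0 mulr0.
  have c0 : Num.conj a != 0 by rewrite fmorph_eq0.
  by rewrite rcV -mul_conj invfM mulfVK.
by rewrite cembM cemb_rc -scalerAl mul1r.
Qed.

End SliceEmbedding.

Section Extremal.
Variables (R : realType) (n : nat) (i0 : 'I_n).
Local Notation C := (Cplx R).
Local Notation V := 'rV[C]_n.
Implicit Types (z w v y : V) (k : C -> C) (l : C).

(** Derivative at [z] of [y -> k (y 0 i0) *: y], where [c] and [l] are the value and derivative of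
    [k] at [z 0 i0]: a multiple of the identity plus a matrix of rank at most one. *)
Definition scale_jacobian (c l : C) z : 'M[C]_n :=
  c%:M + \matrix_(t, s) ((t == i0)%:R * l * z 0 s).

Lemma mul_scale_jacobian c l z v :
  v *m scale_jacobian c l z = c *: v + (l * v 0 i0) *: z.
Proof.
rewrite mulmxDr mul_mx_scalar; congr (_ + _); apply/rowP => s; rewrite !mxE.
rewrite (bigD1 i0) //= big1 => [|t ti]; last by rewrite mxE (negPf ti) !mul0r mulr0.
by rewrite mxE eqxx mul1r addr0; ring.
Qed.

Lemma fdiff_scale k l z : cdiff k (z 0 i0) l ->
  fdiff (fun y => k (y 0 i0) *: y) z (scale_jacobian (k (z 0 i0)) l z).
Proof.
move=> kd e e0.
have z1 : 0 < cnorm z + 1 by have := cnorm_ge0 z; lra.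
have l1 : 0 < cmod l + 1 by have := cmod_ge0 l; lra.
have [d d0 dP] := kd _ (divr_gt0 (divr_gt0 e0 (ltr0Sn _ 1)) z1).
exists (Num.min (Num.min d 1) (e / 2 / (cmod l + 1))).
  by rewrite !lt_min d0 ltr01 !divr_gt0.
move=> y; rewrite !lt_min => /andP [/andP [yd y1] yl].
rewrite mul_scale_jacobian.
have -> : k (y 0 i0) *: y - k (z 0 i0) *: z -
    (k (z 0 i0) *: (y - z) + (l * (y - z) 0 i0) *: z) =
  (k (y 0 i0) - k (z 0 i0) - l * (y - z) 0 i0) *: y + (l * (y - z) 0 i0) *: (y - z).
  by apply/rowP => s; rewrite !mxE; ring.
have c1 := coord_le_cnorm (y - z) i0.
have cz : cmod (z 0 i0 - z 0 i0) < d by rewrite subrr cmod0.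
have D : (y - z) 0 i0 = y 0 i0 - z 0 i0 by rewrite !mxE.
have := dP (z 0 i0) (y 0 i0) cz; rewrite -D => /(_ (le_lt_trans c1 yd)) H.
have yn : cnorm y <= cnorm z + 1 by have := cnorm_lowB y z; lra.
apply: le_trans (cnormD _ _) _; rewrite !cnormZ cmodM.
have A1 : cmod (k (y 0 i0) - k (z 0 i0) - l * (y - z) 0 i0) * cnorm y <= e / 2 * cnorm (y - z).
  apply: (@le_trans _ _ (e / 2 / (cnorm z + 1) * cmod ((y - z) 0 i0) * (cnorm z + 1))).
    by rewrite ler_pM ?cmod_ge0 ?cnorm_ge0.
  by rewrite mulrAC divfK ?gt_eqF // ler_wpM2l // ltW // divr_gt0.
have A2 : cmod l * cmod ((y - z) 0 i0) * cnorm (y - z) <= e / 2 * cnorm (y - z).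
  rewrite ler_wpM2r ?cnorm_ge0 //.
  move: yl; rewrite ltr_pdivlMr // => yl; apply: le_trans (ltW yl).
  by rewrite mulrC ler_pM ?cmod_ge0 //; lra.
by lra.
Qed.

(* The extremal map z / (1 - <z, e_i0>) and its inverse.                       *)
Definition extremal z : V := (1 - z 0 i0)^-1 *: z.
Definition extremal_inv w : V := (1 + w 0 i0)^-1 *: w.
Definition extremal_jacobian z := scale_jacobian (1 - z 0 i0)^-1 ((1 - z 0 i0)^-1 ^+ 2) z.

Lemma ball_den z : cball z -> 1 - z 0 i0 != 0.
Proof.
rewrite /cball /= => z1; rewrite subr_eq0; apply/eqP => E.
by have := coord_le_cnorm z i0; rewrite -E cmod1; lra.
Qed.

Lemma cdiff_affine (c0 c1 x : C) : cdiff (fun x => c0 + c1 * x) x c1.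
Proof.
have := cdiffD (cdiff_cst c0 x) (cdiffZ c1 (cdiff_id x)).
by rewrite add0r mulr1.
Qed.

Lemma extremal_fdiff z : cball z -> fdiff extremal z (extremal_jacobian z).
Proof.
move=> zb; have d0 := ball_den zb.
have d0' : 1 + -1 * z 0 i0 != 0 by rewrite mulN1r.
have := cdiff_comp (cdiff_affine 1 (-1) (z 0 i0)) (cdiff_inv d0').
rewrite mulN1r mulrN1 opprK => kd.
have := @fdiff_scale (fun x => (1 + -1 * x)^-1) _ z kd.
rewrite /extremal_jacobian mulN1r expr2 -invfM.
by apply: fdiff_congr; exists 1 => // y _; rewrite mulN1r.
Qed.

Lemma extremal_inv_differentiable w : 1 + w 0 i0 != 0 -> differentiable extremal_inv w.
Proof.
move=> d0; have d0' : 1 + 1 * w 0 i0 != 0 by rewrite mul1r.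
have kd := cdiff_comp (cdiff_affine 1 1 (w 0 i0)) (cdiff_inv d0').
apply: fdiff_differentiable; apply: fdiff_congr (@fdiff_scale (fun x => (1 + 1 * x)^-1) _ w kd).
by exists 1 => // y _; rewrite mul1r.
Qed.

Lemma extremalK z : cball z -> extremal_inv (extremal z) = z.
Proof.
move=> /ball_den d0; rewrite /extremal_inv /extremal scalerA mxE.
rewrite (_ : _ * _ = 1) ?scale1r //; field.
by rewrite d0 subrK oner_eq0.
Qed.

Lemma extremal_invK w : 1 + w 0 i0 != 0 -> extremal (extremal_inv w) = w.
Proof.
move=> d0; rewrite /extremal_inv /extremal scalerA mxE.
rewrite (_ : _ * _ = 1) ?scale1r //; field.
by rewrite d0 addrK oner_eq0.
Qed.

(** If [w = extremal z] then [1 + w_i0 = 1 / (1 - z_i0)], hence [w = (1 + w_i0) z], and [|z| < 1]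
    becomes the stated inequality. *)
Lemma extremal_image : extremal @` (@cball R n) = [set w | cnorm w < cmod (1 + w 0 i0)].
Proof.
apply/seteqP; split=> [_ [z zb <-]|w /= wP].
  have d0 := ball_den zb; rewrite /= /extremal cnormZ mxE.
  have -> : 1 + (1 - z 0 i0)^-1 * z 0 i0 = (1 - z 0 i0)^-1 by field.
  by rewrite gtr_pMr // cmod_gt0 // invr_eq0.
have d0 : 0 < cmod (1 + w 0 i0) by apply: le_lt_trans wP; exact: cnorm_ge0.
have dn0 : 1 + w 0 i0 != 0 by apply: contraTneq d0 => ->; rewrite cmod0 ltxx.
exists (extremal_inv w); last exact: extremal_invK.
by rewrite /cball /= cnormZ cmodV mulrC ltr_pdivrMr // mul1r.
Qed.

Lemma cball_open : open (@cball R n).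
Proof.
rewrite openE => z zb; apply/nbhs_cnorm; exact: cball_nbhs.
Qed.

Lemma extremal_image_open : open (extremal @` (@cball R n)).
Proof.
rewrite extremal_image openE => w /= wP; apply/nbhs_cnorm.
exists ((cmod (1 + w 0 i0) - cnorm w) / 2); first by rewrite divr_gt0 // subr_gt0.
move=> y yw /=.
have := coord_le_cnorm (y - w) i0; rewrite !mxE.
have := cnorm_lowB y w; have := cmod_lowB (1 + w 0 i0) (1 + y 0 i0).
rewrite opprD addrACA subrr add0r cmodC; lra.
Qed.

(** After squaring, the terms [|w_i0|^2] cancel and the image is the set where the concave function
    [h] is positive. *)
Lemma extremal_image_convex : convex_set (extremal @` (@cball R n)).
Proof.
rewrite extremal_image => x y lam /set_mem /= xP /set_mem /= yP; apply/mem_set => /=.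
have [r rE] : exists r : R, lam%:num = rc r.
  by exists (complex.Re lam%:num); rewrite /rc RRe_real // ger0_real.
have r0 : 0 <= r by have : 0 <= lam%:num by []; rewrite rE lecR.
have r1 : r <= 1 by have : lam%:num <= 1 by []; rewrite rE -rc1 lecR.
have -> : conv lam (x : convex_lmodType V) y = rc r *: x + rc (1 - r) *: y.
  by rewrite rcB rc1 -rE.
pose h (w : V) := 1 + 2 * complex.Re (w 0 i0) - \sum_(t | t != i0) cmod (w 0 t) ^+ 2.
have hP w : (cnorm w < cmod (1 + w 0 i0)) = (0 < h w).
  rewrite -ltr_sqr ?nnegrE ?cnorm_ge0 ?cmod_ge0 // cnorm_sqr (bigD1 i0) //= /h.
  by rewrite !cmod_sqr cReD cImD /=; apply/idP/idP => H; lra.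
move: xP yP; rewrite !hP => xP yP.
have conc : r * h x + (1 - r) * h y <= h (rc r *: x + rc (1 - r) *: y).
  rewrite /h !mxE cReD !cReM !cRe_rc !cIm_rc !mul0r !subr0 !mulrBr !mulr_sumr.
  have : \sum_(t | t != i0) cmod ((rc r *: x + rc (1 - r) *: y) 0 t) ^+ 2 <=
     \sum_(t | t != i0) r * cmod (x 0 t) ^+ 2 + \sum_(t | t != i0) (1 - r) * cmod (y 0 t) ^+ 2.
    rewrite -big_split /=; apply: ler_sum => t _; rewrite !mxE !cmod_sqr.
    rewrite !cReD !cImD !cReM !cImM !cRe_rc !cIm_rc !mul0r !addr0 !subr0.
    move: (complex.Re (x 0 t)) (complex.Im (x 0 t)) (complex.Re (y 0 t)) (complex.Im (y 0 t)) => a b c d.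
    rewrite -subr_ge0.
    have -> : r * (a ^+ 2 + b ^+ 2) + (1 - r) * (c ^+ 2 + d ^+ 2) -
      ((r * a + (1 - r) * c) ^+ 2 + (r * b + (1 - r) * d) ^+ 2) =
      r * (1 - r) * ((a - c) ^+ 2 + (b - d) ^+ 2) by ring.
    by rewrite !mulr_ge0 ?subr_ge0 ?addr_ge0 ?sqr_ge0.
  by lra.
apply: lt_le_trans conc.
have [->|rn0] := eqVneq r 0; first by lra.
have rp : 0 < r by rewrite lt_neqAle eq_sym rn0.
have : 0 < r * h x by rewrite mulr_gt0.
have : 0 <= (1 - r) * h y by apply: mulr_ge0; [rewrite subr_ge0 | exact: ltW].
lra.
Qed.

Lemma extremal_convex_mapping : convex_mapping (@cball R n) extremal.
Proof.
split; last exact: extremal_image_convex.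
split; first by split; [exact: cball_open | move=> z /extremal_fdiff /fdiff_differentiable].
exists extremal_inv; last exact: extremalK.
split; first exact: extremal_image_open.
move=> w; rewrite extremal_image /= => wP; apply: extremal_inv_differentiable.
by apply/eqP => E; move: wP; rewrite E cmod0; have := cnorm_ge0 w; lra.
Qed.

End Extremal.

Lemma pderiv_is_derive (R : realType) n (g : 'rV[Cplx R]_n -> R) v z (l : R) :
  is_derive (0 : R) 1 (along g v z) l -> derivable (along g v z) 0 1 /\ pderiv g v z = l.
Proof. by case=> gd <-; split; [exact: gd | rewrite /pderiv derive1E]. Qed.

Section ExtremalSlice.
Variables (R : realType) (m n : nat) (i0 : 'I_n).
Local Notation Cl := (clifford R m).
Local Notation C := (Cplx R).
Local Notation V := 'rV[C]_n.
Implicit Types (z w v y : V) (I J : Cl).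
Local Notation extremal := (extremal i0).
Local Notation extremal_jacobian := (extremal_jacobian i0).

Lemma extremal_jacobian_coord z v s : (v *m extremal_jacobian z) 0 s =
  (1 - z 0 i0)^-1 * v 0 s + (1 - z 0 i0)^-1 ^+ 2 * v 0 i0 * z 0 s.
Proof. by rewrite mul_scale_jacobian !mxE. Qed.

Lemma extremal_jacobian_continuous z v s : cball z ->
  {for z, continuous (fun y => (v *m extremal_jacobian y) 0 s)}.
Proof.
move=> zb; have d0 := ball_den i0 zb.
have uc : (fun y : V => (1 - y 0 i0)^-1) @ nbhs z --> (1 - z 0 i0)^-1.
  by apply: cvgV => //; apply: cvgB; [exact: cvg_cst | exact: coord_continuous].
rewrite (_ : (fun y => _) = (fun y : V => (1 - y 0 i0)^-1 * v 0 s +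
  (1 - y 0 i0)^-1 * (1 - y 0 i0)^-1 * v 0 i0 * y 0 s)); last first.
  by apply/funext => y; rewrite extremal_jacobian_coord expr2.
rewrite /prop_for /continuous_at.
have k1 : (fun _ : V => v 0 s) @ nbhs z --> v 0 s := @cvg_cst _ (v 0 s) V (nbhs z) (nbhs_filter z).
have k2 : (fun _ : V => v 0 i0) @ nbhs z --> v 0 i0 := @cvg_cst _ (v 0 i0) V (nbhs z) (nbhs_filter z).
have k3 : (fun y : V => y 0 s) @ z --> z 0 s by exact: coord_continuous.
have K := cvgD (cvgM uc k1) (cvgM (cvgM (cvgM uc uc) k2) k3).
exact: K.
Qed.

Lemma part_like_continuous (rho : C -> R) (c : C) : real_part_like rho -> {for c, continuous rho}.
Proof.
move=> rr; have [_ _ rN] := rr => P /nbhs_ballP [e /= e0 eP].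
apply/nbhs_cmod; exists e => // x xc; apply: eP.
by rewrite /ball /= -(part_likeB _ _ rr); apply: le_lt_trans (rN _) _; rewrite cmodC.
Qed.

Lemma extremal_part_derive (rho : C -> R) (c : R) z v s : real_part_like rho -> cball z ->
  is_derive (0 : R) 1 (along (fun y => c * rho (extremal y 0 s)) v z)
    (c * rho ((v *m extremal_jacobian z) 0 s)).
Proof.
move=> rr zb.
have E0 : fdiff extremal (z + rc 0 *: v) (extremal_jacobian z).
  by rewrite rc0 scale0r addr0; exact: extremal_fdiff.
exact: (is_deriveZ c (part_line_derive s rr E0)).
Qed.

(** On the ball the partial derivatives are entries of [extremal_jacobian], which are rational in
    the coordinates with nonvanishing denominator. The factor [c] serves as the indicator of the
    empty set [A]. *)
Lemma extremal_part_C1 (rho : C -> R) (c : R) s : real_part_like rho ->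
  C1_on (@cball R n) (fun y => c * rho (extremal y 0 s)).
Proof.
move=> rr v _ z zb; split.
  by have [] := pderiv_is_derive (extremal_part_derive c v s rr zb).
have zn : \forall y \near z, cball y by apply/nbhs_cnorm; exact: cball_nbhs.
have E : {near z, (fun y => c * rho ((v *m extremal_jacobian y) 0 s)) =1
    pderiv (fun y => c * rho (extremal y 0 s)) v}.
  near=> y; have yb : cball y by near: y.
  by have [_ ->] := pderiv_is_derive (extremal_part_derive c v s rr yb).
have Ez := nbhs_singleton E.
rewrite /prop_for /continuous_at -Ez; apply: cvg_trans (near_eq_cvg E) _.
apply: cvgM; first exact: cvg_cst.
apply: (@continuous_comp _ _ _ (fun y => (v *m extremal_jacobian y) 0 s) rho).
  exact: extremal_jacobian_continuous.
exact: part_like_continuous.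
Unshelve. all: by end_near.
Qed.

(** Both components are real, so the induced mapping preserves every slice C_J and restricts to
    [extremal] on each of them. *)
Definition extremal_stem z : cmodule R m n :=
  (\row_s (complex.Re (extremal z 0 s))%:A, \row_s (complex.Im (extremal z 0 s))%:A).

Definition extremal_slice (x : 'rV[Cl]_n) : 'rV[Cl]_n :=
  \row_s (clinv (1 - x 0 i0) * x 0 s).

Definition extremal_slice_derivative (x : 'rV[Cl]_n) : 'M[Cl]_n :=
  \matrix_(s, t) ((s == t)%:R * clinv (1 - x 0 i0) +
    (t == i0)%:R * (clinv (1 - x 0 i0) * clinv (1 - x 0 i0) * x 0 s)).

Lemma stem_coord1 z s (A : {set 'I_m}) : (extremal_stem z).1 0 s A =
  (A == finset.set0)%:R * complex.Re (extremal z 0 s).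
Proof. by rewrite mxE !ffunE /GRing.scale /= mulrC. Qed.

Lemma stem_coord2 z s (A : {set 'I_m}) : (extremal_stem z).2 0 s A =
  (A == finset.set0)%:R * complex.Im (extremal z 0 s).
Proof. by rewrite mxE !ffunE /GRing.scale /= mulrC. Qed.

Lemma extremal_stem_pderiv s v z : cball z -> stem_pderiv extremal_stem s v z =
  ((complex.Re ((v *m extremal_jacobian z) 0 s))%:A,
   (complex.Im ((v *m extremal_jacobian z) 0 s))%:A).
Proof.
move=> zb; congr pair; apply/ffunP => A; rewrite !ffunE /GRing.scale /=.
  rewrite (_ : (fun w => _) = (fun w => (A == finset.set0)%:R * complex.Re (extremal w 0 s))).
    have [_ ->] := pderiv_is_derive (extremal_part_derive (A == finset.set0)%:R v s (Re_part_like R) zb).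
    by rewrite mulrC.
  by apply/funext => w; rewrite stem_coord1.
rewrite (_ : (fun w => _) = (fun w => (A == finset.set0)%:R * complex.Im (extremal w 0 s))).
  have [_ ->] := pderiv_is_derive (extremal_part_derive (A == finset.set0)%:R v s (Im_part_like R) zb).
  by rewrite mulrC.
by apply/funext => w; rewrite stem_coord2.
Qed.

Lemma dir_beta_jacobian t z s : (dir_beta R t *m extremal_jacobian z) 0 s =
  (Complex 0 1 : C) * (dir_alpha R t *m extremal_jacobian z) 0 s.
Proof. by rewrite /dir_beta -scalemxAl mxE. Qed.

Lemma extremal_conj z : extremal (cconj z) = cconj (extremal z).
Proof.
by apply/rowP => s; rewrite !mxE rmorphM fmorphV rmorphB rmorph1.
Qed.

Lemma extremal_stem_holomorphic : holomorphic_stem extremal_stem.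
Proof.
split.
- move=> z _; rewrite /extremal_stem extremal_conj.
  split; apply/rowP => s; rewrite [LHS]mxE [cconj _ 0 s]mxE.
    by rewrite cRe_conj [RHS]mxE.
  by rewrite cIm_conj scaleNr !mxE.
- move=> s A; split.
    rewrite (_ : (fun z => _) = (fun w => (A == finset.set0)%:R * complex.Re (extremal w 0 s))).
      exact: extremal_part_C1 (Re_part_like R).
    by apply/funext => w; rewrite stem_coord1.
  rewrite (_ : (fun z => _) = (fun w => (A == finset.set0)%:R * complex.Im (extremal w 0 s))).
    exact: extremal_part_C1 (Im_part_like R).
  by apply/funext => w; rewrite stem_coord2.
(* The derivative along [dir_beta] is [i] times the one along [dir_alpha], so the two terms
   cancel. *)
- move=> s t z zb; rewrite /stem_dbar !extremal_stem_pderiv // dir_beta_jacobian /mul_i /=.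
  rewrite cReM cImM /= !mul0r !mul1r sub0r add0r scaleNr.
  apply: (scalerI (_ : (2 : R) != 0)); first by rewrite pnatr_eq0.
  by rewrite scaler0 scalerA mulfV ?pnatr_eq0 // scale1r; congr pair; rewrite /= subrr.
Qed.

Lemma slice_pointE J z s : slice_point J z 0 s = cemb J (z 0 s).
Proof. by rewrite mxE. Qed.

Lemma extremal_den J z : imag_sphere J ->
  clinv (1 - slice_point J z 0 i0) = cemb J (1 - z 0 i0)^-1.
Proof.
move=> SJ; rewrite slice_pointE -clinv_cemb // cembD cembN.
by rewrite -[in RHS]rc1 cemb_rc scale1r.
Qed.

Lemma extremal_slice_point J z : imag_sphere J ->
  extremal_slice (slice_point J z) = slice_point J (extremal z).
Proof.
move=> SJ; apply/rowP => s; rewrite mxE extremal_den // !slice_pointE -cembM //.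
by rewrite [extremal z 0 s]mxE.
Qed.

Lemma extremal_induces : induces extremal_stem extremal_slice.
Proof.
move=> z J zb SJ; rewrite extremal_slice_point //.
by apply/rowP => s; rewrite !mxE.
Qed.

Lemma cemb_nat J (b : bool) : cemb J (b%:R : C) = b%:R.
Proof. by case: b; rewrite -rcn cemb_rc ?scale1r ?scale0r. Qed.

Lemma extremal_slice_derivative_point J z s t : imag_sphere J ->
  extremal_slice_derivative (slice_point J z) s t =
  cemb J ((dir_alpha R t *m extremal_jacobian z) 0 s).
Proof.
move=> SJ; rewrite mxE extremal_den // slice_pointE extremal_jacobian_coord.
rewrite !mxE eqxx /= cembD !cembM // cemb_nat [i0 == t]eq_sym cemb_nat.
congr (_ + _); first by case: (s == t); rewrite ?mul1r ?mulr1 ?mul0r ?mulr0.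
by case: (t == i0); rewrite ?mul1r ?mulr1 ?mul0r ?mulr0 ?mul0r.
Qed.

Lemma extremal_slice0 : extremal_slice 0 = 0.
Proof. by apply/rowP => s; rewrite !mxE mulr0. Qed.

Lemma extremal_normalized : (0 < m)%N ->
  normalized_slice_convex extremal_slice extremal_slice_derivative.
Proof.
move=> m0; split.
- by exists extremal_stem; [exact: extremal_stem_holomorphic | exact: extremal_induces].
- exists (clgen R (Ordinal m0)); first exact: clgen_imag.
  have SI := clgen_imag R (Ordinal m0); split.
    by move=> _ [x [_ [z _ <-]] <-]; rewrite extremal_slice_point //; exists (extremal z).
  exists extremal; first exact: extremal_convex_mapping.
  by move=> z _; rewrite extremal_slice_point.
- exact: extremal_slice0.
- exists extremal_stem; split; first exact: extremal_stem_holomorphic.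
    exact: extremal_induces.
  move=> z J s t zb SJ; rewrite extremal_slice_derivative_point //.
  rewrite /stem_d !extremal_stem_pderiv // dir_beta_jacobian /mul_i /=.
  rewrite cReM cImM /= !mul0r !mul1r sub0r add0r scaleNr !opprK.
  have half (X : Cl) : (2^-1 : R) *: (X + X) = X.
    by rewrite scalerDr -scalerDl -[RHS]scale1r; congr (_ *: _); lra.
  by rewrite !half.
- have cl1 : clinv (1 : Cl) = 1.
    have := clinv_cemb (clgen_imag R (Ordinal m0)) 1.
    by rewrite invr1 -rc1 cemb_rc scale1r.
  apply/matrixP => s t; rewrite !mxE subr0 cl1 !mulr1 mul1r mulr0 addr0.
  by [].
Qed.

(** On this line the map is [r / (1 - r)]: positive [r] attains the upper bound and negative [r] the
    lower one. *)
Lemma extremal_norm (r : R) : r != 1 ->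
  cnorm (extremal (rc r *: delta_mx 0 i0)) = `|r| / `|1 - r|.
Proof.
move=> r1; rewrite cnormZ cnormZ cnorm_delta mulr1 cmodV !mxE !eqxx mulr1.
by rewrite -[X in X - _]rc1 -rcB !cmod_rc mulrC.
Qed.

End ExtremalSlice.

Theorem theorem3p5 (R : realType) (m n : nat) (hm : (1 <= m)%N) (hn : (1 <= n)%N) :
  (forall (f : 'rV[clifford R m]_n -> 'rV[clifford R m]_n)
      (df : 'rV[clifford R m]_n -> 'M[clifford R m]_n),
    normalized_slice_convex f df ->
    forall x : 'rV[clifford R m]_n, qball x ->
      vnorm x / (1 + vnorm x) <= vnorm (f x) /\
      vnorm (f x) <= vnorm x / (1 - vnorm x)) /\
  (forall r : R, 0 < r -> r < 1 ->
    (exists (f : 'rV[clifford R m]_n -> 'rV[clifford R m]_n)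
        (df : 'rV[clifford R m]_n -> 'M[clifford R m]_n)
        (x : 'rV[clifford R m]_n),
      [/\ normalized_slice_convex f df, qball x, vnorm x = r &
          vnorm x / (1 + vnorm x) = vnorm (f x)]) /\
    (exists (f : 'rV[clifford R m]_n -> 'rV[clifford R m]_n)
        (df : 'rV[clifford R m]_n -> 'M[clifford R m]_n)
        (x : 'rV[clifford R m]_n),
      [/\ normalized_slice_convex f df, qball x, vnorm x = r &
          vnorm (f x) = vnorm x / (1 - vnorm x)])).
Proof.
split; first exact: slice_convex_growth.
move=> r r0 r1.
pose i0 := Ordinal hn; pose J := clgen R (Ordinal hm).
have SJ : imag_sphere J := clgen_imag R (Ordinal hm).
pose z (s : R) : 'rV[Cplx R]_n := rc s *: delta_mx 0 i0.
have zn s : cnorm (z s) = `|s| by rewrite cnormZ cnorm_delta mulr1 cmod_rc.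
have xn s : vnorm (slice_point J (z s)) = `|s| by rewrite vnorm_slice.
have xb s : `|s| < 1 -> qball (slice_point J (z s)).
  by move=> s1; split; [exists J => //; exists (z s) | rewrite xn].
have fn s : s != 1 ->
    vnorm (extremal_slice i0 (slice_point J (z s))) = `|s| / `|1 - s|.
  by move=> s1; rewrite extremal_slice_point // vnorm_slice // extremal_norm.
split.
  exists (extremal_slice i0), (extremal_slice_derivative i0), (slice_point J (z (- r))).
  rewrite xn fn; last by apply/eqP; lra.
  split.
  - exact: extremal_normalized.
  - by apply: xb; rewrite normrN gtr0_norm.
  - by rewrite normrN gtr0_norm.
  - by rewrite opprK normrN !gtr0_norm //; lra.
exists (extremal_slice i0), (extremal_slice_derivative i0), (slice_point J (z r)).
rewrite xn fn; last by apply/eqP; lra.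
split.
- exact: extremal_normalized.
- by apply: xb; rewrite gtr0_norm.
- by rewrite gtr0_norm.
- by rewrite !gtr0_norm // subr_gt0.
Qed.
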